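(* Let $m\ge 0$. Every spacelike spherically symmetric constant mean curvature (SSCMC) surface $\Sigma$ in Schwarzschild spacetime of mass $m$ (in the region $r>2m$) with constant mean curvature $1$ is strongly asymptotically hyperbolic (near the future null-infinity $s=0$). Moreover, the scalar curvature $\mathcal S$ of $\Sigma$ satisfies $|\mathcal S+6|=O(s^6)$ and $\mathcal S+6\ge0$.
   Context: Put $h(r)=1-\frac{2m}{r}$ and $s=r^{-1}$. The Schwarzschild metric on $r>2m$ is $g_{\mathrm{Sch}}=-h\,dt^2+h^{-1}dr^2+r^2\sigma$, $\sigma$ the standard metric of the unit sphere $\mathbb S^2$. Mean curvature is one third of the trace of the second fundamental form with respect to the future directed unit normal. A spacelike SSCMC surface with constant mean curvature $H>0$ in this region is the graph $t=f(r)$, $r>2m$, of a function with $f'(r)=\frac{\ell}{h\sqrt{1+\ell^2}}$, $\ell=\frac1{\sqrt h}\left(Hr+\frac{c}{r^2}\right)$, for some constant $c$; here $H=1$. The future null-infinity corresponds to $s\to0$ along the surface. A Riemannian manifold $(X^3,g)$ is conformally compact if $X$ is the interior of a smooth manifold $\overline X$ with boundary $\partial X$ such that $\overline g=\tau^2g$ extends to a $C^3$ metric on $\overline X$ with $\tau>0$ in $X$, $\tau=0$ on $\partial X$ and $|d\tau|_{\overline g}>0$ on $\partial X$. $(X^3,g)$ is strongly asymptotically hyperbolic if it is conformally compact with a defining function $\tau$ such that near $\tau=0$, $g=\frac{1}{\sinh^2\tau}(d\tau^2+g_\tau)$, where $g_\tau$ is the induced metric on the level set of $\tau$ and $g_\tau=\sigma+\frac{\tau^3}{3}\zeta+O(\tau^4)$,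 where $\zeta$ is a symmetric two-tensor on $\mathbb S^2$ and the expansion can be differentiated twice. *)

(* Defs.v *)
From HB Require Import structures.
From mathcomp Require Import all_boot all_order all_algebra.
From mathcomp Require Import all_classical all_reals all_analysis.
Set Implicit Arguments.
Unset Strict Implicit.
Unset Printing Implicit Defensive.
Import Order.TTheory GRing.Theory Num.Theory.
Import numFieldNormedType.Exports.
Local Open Scope classical_set_scope.
Local Open Scope ring_scope.

(* Vectors are rows.  A covariant 2-tensor on an open subset of R^n is a
   matrix field T : 'rV_n -> 'M_n, with T(x)(v, w) = v *m T x *m w^T. *)

Section Calculus.
Context {R : realType}.

Definition partial n (i : 'I_n) (phi : 'rV[R]_n -> R) (x : 'rV[R]_n) : R :=
  'D_(delta_mx 0 i) phi x.

Definition partials n (l : seq 'I_n) (phi : 'rV[R]_n -> R) : 'rV[R]_n -> R :=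
  foldr (@partial n) phi l.

Fixpoint Ck (k n : nat) (U : set 'rV[R]_n) (phi : 'rV[R]_n -> R) : Prop :=
  (forall x, U x -> {for x, continuous phi}) /\
  if k is k'.+1 then
    forall i, (forall x, U x -> derivable phi x (delta_mx 0 i)) /\
              Ck k' U (partial i phi)
  else True.

Definition smooth n (U : set 'rV[R]_n) (phi : 'rV[R]_n -> R) : Prop :=
  forall k, Ck k U phi.

Definition differential n (phi : 'rV[R]_n -> R) (x : 'rV[R]_n) : 'rV[R]_n :=
  \row_i partial i phi x.

(* Row i is the partial derivative of F in the direction i. *)
Definition jac n N (F : 'rV[R]_n -> 'rV[R]_N) (x : 'rV[R]_n) : 'M[R]_(n, N) :=
  \matrix_(i, a) partial i (fun y => F y 0 a) x.

Definition pullback n N (F : 'rV[R]_n -> 'rV[R]_N) (T : 'rV[R]_N -> 'M[R]_N)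
    (x : 'rV[R]_n) : 'M[R]_n :=
  jac F x *m T (F x) *m (jac F x)^T.

Definition form n (A : 'M[R]_n) (v w : 'rV[R]_n) : R := (v *m A *m w^T) 0 0.

Definition posdef n (A : 'M[R]_n) : Prop :=
  A^T = A /\ forall v, v != 0 -> 0 < form A v v.

Definition sinh (x : R) : R := (expR x - expR (- x)) / 2.

End Calculus.

Section Geometry.
Context {R : realType}.

Definition christoffel n (G : 'rV[R]_n -> 'M[R]_n) (k i j : 'I_n)
    (x : 'rV[R]_n) : R :=
  2^-1 * \sum_l invmx (G x) k l *
    (partial i (fun y => G y l j) x + partial j (fun y => G y l i) x
     - partial l (fun y => G y i j) x).

Definition ricci n (G : 'rV[R]_n -> 'M[R]_n) (x : 'rV[R]_n) : 'M[R]_n :=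
  \matrix_(i, j)
   (\sum_k (partial k (christoffel G k i j) x
            - partial j (christoffel G k i k) x)
    + \sum_k \sum_l (christoffel G k k l x * christoffel G l i j x
                     - christoffel G k j l x * christoffel G l i k x)).

Definition scalar_curvature n (G : 'rV[R]_n -> 'M[R]_n) (x : 'rV[R]_n) : R :=
  \sum_i \sum_j invmx (G x) i j * ricci G x i j.

(* Component a of the ambient covariant derivative of the tangent field
   d_j F along d_i F, for a parametrized hypersurface F. *)
Definition cov_hess n N (G : 'rV[R]_N -> 'M[R]_N) (F : 'rV[R]_n -> 'rV[R]_N)
    (i j : 'I_n) (x : 'rV[R]_n) : 'rV[R]_N :=
  \row_a (partials [:: i; j] (fun y => F y 0 a) x
    + \sum_b \sum_c christoffel G a b c (F x) * jac F x i b * jac F x j c).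

(* K(X, Y) = <nabla_X nu, Y> = - <nu, nabla_X Y>; with this sign the
   hyperboloid t = sqrt (1 + r^2) in Minkowski space has mean curvature 1. *)
Definition second_ff n N (G : 'rV[R]_N -> 'M[R]_N) (F : 'rV[R]_n -> 'rV[R]_N)
    (nu : 'rV[R]_N) (x : 'rV[R]_n) : 'M[R]_n :=
  \matrix_(i, j) - form (G (F x)) (cov_hess G F i j x) nu.

Definition mean_curvature n N (G : 'rV[R]_N -> 'M[R]_N)
    (F : 'rV[R]_n -> 'rV[R]_N) (nu : 'rV[R]_N) (x : 'rV[R]_n) : R :=
  n%:R^-1 * \tr (invmx (pullback F G x) *m second_ff G F nu x).

(* Coordinate 0 of the ambient space is a time function. *)
Definition future_unit_normal n N (G : 'rV[R]_N.+1 -> 'M[R]_N.+1)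
    (F : 'rV[R]_n -> 'rV[R]_N.+1) (x : 'rV[R]_n) (nu : 'rV[R]_N.+1) : Prop :=
  [/\ form (G (F x)) nu nu = -1,
      forall i, form (G (F x)) (row i (jac F x)) nu = 0 &
      0 < nu 0 0].

End Geometry.

(* S^2 is the unit sphere of R^3 and a tensor on R^k x S^2 is given by a matrix
   field on R^(k+3), of which only the restriction to the tangent spaces
   matters; it is always read through the charts cyl b below.  In particular
   the standard metric sigma is the constant field 1%:M. *)

Section Sphere.
Context {R : realType}.

Definition normsq n (u : 'rV[R]_n) : R := (u *m u^T) 0 0.

Definition sphere : set 'rV[R]_3 := [set p : 'rV[R]_3 | normsq p = 1].

(* Inverse stereographic projections from the two poles; either one maps the
   closed unit disc onto a closed hemisphere. *)
Definition stereo (b : bool) (u : 'rV[R]_2) : 'rV[R]_(2 + 1) :=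
  row_mx ((2 / (1 + normsq u)) *: u)
         (((-1) ^+ b * (normsq u - 1) / (1 + normsq u))%:M).

Definition cyl k (b : bool) (x : 'rV[R]_(k + 2)) : 'rV[R]_(k + 3) :=
  row_mx (lsubmx x) (stereo b (rsubmx x)).

Definition collar (a e : R) : set 'rV[R]_(1 + 3) :=
  [set q : 'rV[R]_(1 + 3) | a < q 0 0 < e /\ sphere (rsubmx q)].

Definition slab (a e : R) : set 'rV[R]_(1 + 2) := [set x : 'rV[R]_(1 + 2) | a < x 0 0 < e].

End Sphere.

Section AsymptoticallyHyperbolic.
Context {R : realType}.

(* Conformal compactness at the end s = 0 of a metric g on a collar of points
   q = (s, p), s > 0, p in S^2.  The manifold with boundary is
   {0 <= s < e} x S^2, and a C^k object on it is the restriction of a C^k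
   object defined on {-e < s < e} x S^2. *)
Definition conformally_compact (g : 'rV[R]_(1 + 3) -> 'M[R]_(1 + 3))
    (tau : 'rV[R]_(1 + 3) -> R) (e : R) : Prop :=
  exists gbar : 'rV[R]_(1 + 3) -> 'M[R]_(1 + 3), forall b : bool,
  [/\ smooth (slab (- e) e) (tau \o cyl b),
      forall i j, Ck 3 (slab (- e) e) (fun x => pullback (cyl b) gbar x i j),
      forall x : 'rV[R]_(1 + 2), 0 <= x 0 0 < e -> posdef (pullback (cyl b) gbar x),
      forall x : 'rV[R]_(1 + 2), 0 < x 0 0 < e ->
        0 < tau (cyl b x) /\
        pullback (cyl b) gbar x =
          tau (cyl b x) ^+ 2 *: pullback (cyl b) g x &
      forall x : 'rV[R]_(1 + 2), x 0 0 = 0 ->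
        tau (cyl b x) = 0 /\
        let dtau := differential (tau \o cyl b) x in
        0 < Num.sqrt (form (invmx (pullback (cyl b) gbar x)) dtau dtau)].

(* (tau, pi) identifies a collar of the boundary with a subset of
   (0, +oo) x S^2 containing (0, t0) x S^2; it maps the level sets of tau to
   the spheres {t} x S^2, and gt t is the metric g_t on S^2. *)
Definition normal_form (g : 'rV[R]_(1 + 3) -> 'M[R]_(1 + 3))
    (tau : 'rV[R]_(1 + 3) -> R) (e t0 : R)
    (pi : 'rV[R]_(1 + 3) -> 'rV[R]_3)
    (gt : R -> 'rV[R]_3 -> 'M[R]_3) : Prop :=
  [/\ forall q, collar 0 e q -> sphere (pi q),
      forall b a, smooth (slab 0 e) (fun x => pi (cyl b x) 0 a),
      forall t p, 0 < t < t0 -> sphere p ->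
        exists! q, [/\ collar 0 e q, tau q = t & pi q = p] &
      forall b x, slab 0 e x ->
        let dtau := differential (tau \o cyl b) x in
        pullback (cyl b) g x =
          (sinh (tau (cyl b x)) ^+ 2)^-1 *:
            (dtau^T *m dtau
             + pullback (pi \o cyl b) (gt (tau (cyl b x))) x)].

(* g_t = sigma + (t^3/3) zeta + O(t^4) in C^2: a derivative of order at most 2
   of the remainder, k times in t, is O(t^(4-k)) uniformly on S^2. *)
Definition expansion (gt : R -> 'rV[R]_3 -> 'M[R]_3)
    (zeta : 'rV[R]_3 -> 'M[R]_3) (t0 : R) : Prop :=
  let err (b : bool) (i j : 'I_2) (z : 'rV[R]_(1 + 2)) : R :=
    pullback (stereo b)
      (fun p => gt (z 0 0) p - 1%:M - (z 0 0 ^+ 3 / 3) *: zeta p)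
      (rsubmx z) i j in
  (forall b i j, Ck 2 (slab 0 t0) (err b i j)) /\
  exists C : R, forall b i j (l : seq 'I_(1 + 2)) z,
    (size l <= 2)%N -> slab 0 t0 z -> normsq (rsubmx z) <= 1 ->
    `|partials l (err b i j) z| <= C * z 0 0 ^+ (4 - count_mem ord0 l).

Definition strongly_AH (g : 'rV[R]_(1 + 3) -> 'M[R]_(1 + 3)) : Prop :=
  exists (tau : 'rV[R]_(1 + 3) -> R) (e : R),
  [/\ 0 < e, conformally_compact g tau e &
  exists (t0 : R) (pi : 'rV[R]_(1 + 3) -> 'rV[R]_3)
         (gt : R -> 'rV[R]_3 -> 'M[R]_3) (zeta : 'rV[R]_3 -> 'M[R]_3),
  [/\ 0 < t0, normal_form g tau e t0 pi gt,
      forall b u, (pullback (stereo b) zeta u)^T = pullback (stereo b) zeta u,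
      forall b i j, smooth setT (fun u => pullback (stereo b) zeta u i j) &
      expansion gt zeta t0]].

End AsymptoticallyHyperbolic.

Section Schwarzschild.
Context {R : realType}.

Definition h (m r : R) : R := 1 - 2 * m / r.

(* At the point (t, r, p), p in S^2. *)
Definition gSch (m : R) (q : 'rV[R]_(1 + (1 + 3))) : 'M[R]_(1 + (1 + 3)) :=
  let r := rsubmx q 0 0 in
  block_mx (- h m r)%:M 0 0 (block_mx (h m r)^-1%:M 0 0 (r ^+ 2)%:M).

Definition gSch_chart (m : R) (b : bool) : 'rV[R]_4 -> 'M[R]_4 :=
  pullback (@cyl R 2 b) (gSch m).

(* The graph t = f(r); for n = 3 the remaining arguments are the point of S^2,
   for n = 2 its stereographic coordinates. *)
Definition graph (f : R -> R) n (x : 'rV[R]_(1 + n)) : 'rV[R]_(1 + (1 + n)) :=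
  row_mx (f (x 0 0))%:M x.

Definition SSCMC (m H : R) (f : R -> R) : Prop :=
  (forall r, 2 * m < r -> derivable f r 1 /\ derivable (f^`())%classic r 1) /\
  forall (b : bool) (x : 'rV[R]_3), 2 * m < x 0 0 ->
    let F := @graph f 2 in
    posdef (pullback F (gSch_chart m b) x) /\
    exists nu, future_unit_normal (gSch_chart m b) F x nu /\
               mean_curvature (gSch_chart m b) F nu x = H.

(* The induced metric at the point (r, p) of the graph. *)
Definition induced_metric (m : R) (f : R -> R) :
    'rV[R]_(1 + 3) -> 'M[R]_(1 + 3) :=
  pullback (@graph f 3) (gSch m).

(* (s, p) |-> (r, p) with r = 1 / s. *)
Definition of_s (q : 'rV[R]_(1 + 3)) : 'rV[R]_(1 + 3) :=
  row_mx ((q 0 0)^-1)%:M (rsubmx q).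

End Schwarzschild.

(* Main.v *)
Require Import Defs.
From HB Require Import structures.
From mathcomp Require Import all_boot all_order all_algebra.
From mathcomp Require Import all_classical all_reals all_analysis.
From mathcomp Require Import ring lra.
Set Implicit Arguments.
Unset Strict Implicit.
Unset Printing Implicit Defensive.
Import Order.TTheory GRing.Theory Num.Theory.
Import numFieldNormedType.Exports.
Local Open Scope classical_set_scope.
Local Open Scope ring_scope.

(** Write h = 1 - 2m/r. For a graph t = f(r) the mean curvature H satisfies
    3 H = r^-2 (r^2 rho)', where rho = h f' / sqrt (1/h - h f'^2) is the radial
    component of the future unit normal. Hence H = 1 gives rho = r + c/r^2 for a
    constant c (SSCMC_first_integral), and since 1/h - h f'^2 = 1/(h + rho^2) the
    induced metric is dr^2/V + r^2 sigma with
      V = h + rho^2 = 1 + r^2 + (2c - 2m)/r + c^2/r^4.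
    The metric is diagonal in stereographic charts, and its scalar curvature
    2 (1 - V)/r^2 - 2 V'/r (scalar_curvature_warped) equals - 6 + 6 c^2/r^6.
    This contains both claims about the scalar curvature.

    In the coordinate s = 1/r the metric is (ds^2/P + sigma)/s^2 with
    P = 1 + s^2 + a s^3 + b s^6, a = 2c - 2m, b = c^2. The boundary coordinate
    tau has to satisfy dtau/sinh tau = ds/(s sqrt P). For P = 1 + s^2 the
    solution is sinh tau = s; comparing with it one finds
      tanh (tau / 2) = s exp (D) / (1 + sqrt (1 + s^2)),
    where D(0) = 0 and D' is s^2 times a smooth function with value - a/2 at
    s = 0 (exponent_exists). So tau is smooth through s = 0 with tau ~ s
    (der_tau), which gives the compactification (conformally_compact_radial),
    and sinh(tau)^2 g = dtau^2 + Y^2 sigma with Y = sinh tau / s.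

    It remains to expand Y^2. An explicit formula expresses Y through exp D up
    to a remainder of order s^5, so that Y^2 = exp (2 D) + O(s^5)
    = 1 - a s^3/3 + O(s^4) = 1 - a tau^3/3 + O(tau^4), that is,
    zeta = - a sigma. The orders of vanishing are those of functions together
    with their first two derivatives (Ord), a notion stable under sums, products
    and integration from 0; the last step carries the bounds from s to tau
    through the inverse function (expansion_in_tau). *)

(** * Directional derivatives and functions of class C^k *)

Section DirectionalDerivatives.
Context {R : realType} {V : normedModType R}.
Implicit Types (f g : V -> R) (x v : V).

Lemma derC (c : R) x v : is_derive x v (fun=> c) 0.
Proof. exact: is_derive_cst. Qed.

Lemma derD f g x v (df dg : R) : is_derive x v f df -> is_derive x v g dg ->
  is_derive x v (fun y => f y + g y) (df + dg).
Proof. exact: is_deriveD. Qed.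

Lemma derN f x v (df : R) : is_derive x v f df ->
  is_derive x v (fun y => - f y) (- df).
Proof. exact: is_deriveN. Qed.

Lemma derM f g x v (df dg : R) : is_derive x v f df -> is_derive x v g dg ->
  is_derive x v (fun y => f y * g y) (df * g x + f x * dg).
Proof.
move=> hf hg.
have h : is_derive x v (fun y => f y * g y) _ := is_deriveM hf hg.
apply: is_derive_eq h _.
by rewrite /GRing.scale /= addrC mulrC.
Qed.

Lemma derX f n x v (df : R) : is_derive x v f df ->
  is_derive x v (fun y => f y ^+ n) (n%:R * f x ^+ n.-1 * df).
Proof.
move=> hf; have := is_deriveX n hf.
by rewrite /GRing.scale /= -exprfctE.
Qed.

Lemma derV f x v (df : R) : f x != 0 -> is_derive x v f df ->
  is_derive x v (fun y => (f y)^-1) (- (f x ^- 2 * df)).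
Proof.
move=> fx0 [hf <-]; split; first exact: derivableV.
by rewrite deriveV // /GRing.scale /= mulNr.
Qed.

(** Along the line x + R v this is the chain rule in one variable. *)
Lemma der_comp (F : R -> R) f x v (dF df : R) :
  is_derive (f x) 1 F dF -> is_derive x v f df ->
  is_derive x v (fun y => F (f y)) (dF * df).
Proof.
move=> hF hf.
pose l h := f (h *: v + x).
have l0 : l 0 = f x by rewrite /l scale0r add0r.
have E (f' : V -> R) : 'D_v f' x = 'D_1 (fun h : R => f' (h *: v + x)) 0.
  rewrite /derive; set u1 := fun h => _; set u2 := fun h => _.
  suff -> : u1 = u2 by [].
  apply/funext => h; rewrite /u1 /u2 /=.
  by rewrite scale0r !add0r addr0 [_%:A]mulr1.
have hl : is_derive (0 : R) 1 l df.
  by case: hf => h1 h2; split; [exact: (derivable1P _ _ _).1 h1|rewrite -E].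
have hF' : is_derive (l 0) 1 F dF by rewrite l0.
have [h1 h2] := is_derive1_comp hF' hl.
by split; [exact: (derivable1P _ _ _).2 h1|rewrite E].
Qed.

Lemma der_near f g x v (df : R) : (\near x, f x = g x) ->
  is_derive x v f df -> is_derive x v g df.
Proof. exact: near_eq_is_derive. Qed.

End DirectionalDerivatives.

Section OneVariable.
Context {R : realType}.
Implicit Types (F : R -> R) (x : R).

Lemma der_cont F x (df : R) : is_derive x 1 F df -> {for x, continuous F}.
Proof.
by move=> [h _]; apply/differentiable_continuous/derivable1_diffP.
Qed.

Lemma der_id x : is_derive x 1 (fun y : R => y) 1.
Proof. exact: is_derive_id. Qed.

Lemma der_inv x : x != 0 -> is_derive x 1 GRing.inv (- (x ^- 2 * 1)).
Proof. by move=> x0; exact: (@derV _ _ (fun y : R => y) _ _ _ x0 (der_id x)). Qed.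

Lemma der_addl c x : is_derive x 1 (+%R c) 1.
Proof.
by have := derD (derC c x 1) (der_id x); rewrite add0r.
Qed.

Lemma der_opp x : is_derive x 1 -%R (- 1).
Proof. exact: (derN (der_id x)). Qed.

Lemma der_mull c x : is_derive x 1 ( *%R c) c.
Proof.
by have := derM (derC c x 1) (der_id x); rewrite mul0r add0r mulr1.
Qed.

End OneVariable.

Section Elementary.
Context {R : realType} {V : normedModType R}.
Implicit Types (f : V -> R) (x v : V).

Lemma der_exp f x v (df : R) : is_derive x v f df ->
  is_derive x v (fun y => expR (f y)) (expR (f x) * df).
Proof. exact: der_comp. Qed.

Lemma der_sqrt f x v (df : R) : 0 < f x -> is_derive x v f df ->
  is_derive x v (fun y => Num.sqrt (f y)) ((2 * Num.sqrt (f x))^-1 * df).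
Proof. by move=> f0; apply: der_comp; exact: is_derive1_sqrt. Qed.

Lemma der_ln f x v (df : R) : 0 < f x -> is_derive x v f df ->
  is_derive x v (fun y => ln (f y)) ((f x)^-1 * df).
Proof. by move=> f0; apply: der_comp; exact: is_derive1_ln. Qed.

End Elementary.

Section Coordinates.
Context {R : realType} {n : nat}.
Implicit Types (U : set 'rV[R]_n) (phi psi : 'rV[R]_n -> R).

Lemma der_coord (x : 'rV[R]_n) v i : is_derive x v (fun y : 'rV[R]_n => y 0 i) (v 0 i).
Proof.
have df : differentiable (fun y : 'rV[R]_n => y 0 i) x.
  exact: differentiable_coord.
split; first exact: diff_derivable.
rewrite deriveE //.
have lin : linear (fun y : 'rV[R]_n => y 0 i) by move=> k u w; rewrite !mxE.
pose L := GRing.isLinear.Build _ _ _ _ _ lin.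
pose c : {linear 'rV[R]_n -> R} := HB.pack (fun y : 'rV[R]_n => y 0 i) L.
rewrite (_ : (fun y : 'rV[R]_n => y 0 i) = c) // diff_lin //.
exact: coord_continuous.
Qed.

Lemma der_partial i phi x (d : R) :
  is_derive x (delta_mx 0 i) phi d -> partial i phi x = d.
Proof. by move=> h; rewrite /partial derive_val. Qed.

Lemma near_open U phi psi x : open U -> U x -> (forall y, U y -> phi y = psi y) ->
  \near x, phi x = psi x.
Proof.
move=> oU Ux E.
by apply: (filterS _ (open_nbhs_nbhs (conj oU Ux))) => y /E.
Qed.

Lemma continuous_open_eq U phi psi x : open U -> U x ->
  (forall y, U y -> phi y = psi y) ->
  {for x, continuous phi} -> {for x, continuous psi}.
Proof.
move=> oU Ux E; rewrite /prop_for /continuous_at -(E x Ux) => c.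
have N := near_open oU Ux E.
exact: cvg_trans (near_eq_cvg N) c.
Qed.

Lemma contD phi psi x : {for x, continuous phi} -> {for x, continuous psi} ->
  {for x, continuous (fun y => phi y + psi y)}.
Proof. exact: continuousD. Qed.

Lemma contM phi psi x : {for x, continuous phi} -> {for x, continuous psi} ->
  {for x, continuous (fun y => phi y * psi y)}.
Proof. exact: continuousM. Qed.

Lemma Ck0 k U phi : Ck k U phi -> forall x, U x -> {for x, continuous phi}.
Proof. by case: k => [|k] []. Qed.

Lemma Ck_der k U phi : Ck k.+1 U phi ->
  forall i x, U x -> is_derive x (delta_mx 0 i) phi (partial i phi x).
Proof. by move=> [_ H] i x Ux; apply: derivableP; apply: (H i).1. Qed.

Lemma Ck_eq k U phi psi : open U -> (forall x, U x -> phi x = psi x) ->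
  Ck k U phi -> Ck k U psi.
Proof.
move=> oU; elim: k phi psi => [|k IH] phi psi E.
  by move=> [H _]; split=> // x Ux; apply: (continuous_open_eq oU Ux E); exact: H.
move=> [H D]; split.
  by move=> x Ux; apply: (continuous_open_eq oU Ux E); exact: H.
move=> i; have [D1 D2] := D i; split.
  by move=> x Ux; apply: (near_eq_derivable (near_open oU Ux E)); exact: D1.
by apply: IH D2 => x Ux; apply: near_eq_derive; exact: (near_open oU Ux).
Qed.

Lemma CkS k U phi : open U -> (forall x, U x -> {for x, continuous phi}) ->
  (forall i, exists psi, (forall x, U x ->
     is_derive x (delta_mx 0 i) phi (psi x)) /\ Ck k U psi) ->
  Ck k.+1 U phi.
Proof.
move=> oU cphi H; split=> // i; have [psi [D C]] := H i; split.
  by move=> x Ux; have [] := D x Ux.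
apply: Ck_eq C => // x Ux; symmetry; apply: der_partial; exact: D.
Qed.

Lemma CkW k U phi : Ck k.+1 U phi -> Ck k U phi.
Proof.
elim: k phi => [|k IH] phi [H D]; split=> // i.
by have [D1 D2] := D i; split=> //; exact: IH.
Qed.

Lemma CkC k U (c : R) : open U -> Ck k U (fun=> c).
Proof.
move=> oU; elim: k c => [|k IH] c; first (split; [move=> x _; apply: (@cst_continuous _ _ c)|exact: I]).
apply: (CkS oU) => [x _|i]; first by apply: (@cst_continuous _ _ c).
by exists (fun=> 0); split=> // x _; exact: derC.
Qed.

Lemma Ck_coord k U i : open U -> Ck k U (fun x : 'rV[R]_n => x 0 i).
Proof.
move=> oU; case: k => [|k]; first by split=> [x _|//]; exact: coord_continuous.
apply: CkS => // [x _|j]; first exact: coord_continuous.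
exists (fun=> (delta_mx 0 j : 'rV[R]_n) 0 i); split; last exact: CkC.
by move=> x _; exact: der_coord.
Qed.

Lemma CkD k U phi psi : open U -> Ck k U phi -> Ck k U psi ->
  Ck k U (fun x => phi x + psi x).
Proof.
move=> oU; elim: k phi psi => [|k IH] phi psi A B.
  by split=> // x Ux; apply: contD; [exact: (Ck0 A Ux)|exact: (Ck0 B Ux)].
apply: CkS => // [x Ux|i].
  by apply: contD; [exact: (Ck0 A Ux)|exact: (Ck0 B Ux)].
exists (fun x => partial i phi x + partial i psi x); split.
  by move=> x Ux; apply: derD; [exact: (Ck_der A)|exact: (Ck_der B)].
by apply: IH; [case: A => _ /(_ i) []|case: B => _ /(_ i) []].
Qed.

Lemma CkM k U phi psi : open U -> Ck k U phi -> Ck k U psi ->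
  Ck k U (fun x => phi x * psi x).
Proof.
move=> oU; elim: k phi psi => [|k IH] phi psi A B.
  by split=> // x Ux; apply: contM; [exact: (Ck0 A Ux)|exact: (Ck0 B Ux)].
apply: CkS => // [x Ux|i].
  by apply: contM; [exact: (Ck0 A Ux)|exact: (Ck0 B Ux)].
exists (fun x => partial i phi x * psi x + phi x * partial i psi x); split.
  by move=> x Ux; apply: derM; [exact: (Ck_der A)|exact: (Ck_der B)].
apply: CkD => //; apply: IH; try exact: CkW.
  by case: A => _ /(_ i) [].
by case: B => _ /(_ i) [].
Qed.

Lemma CkN k U phi : open U -> Ck k U phi -> Ck k U (fun x => - phi x).
Proof.
move=> oU A; apply: (@Ck_eq _ _ (fun x => -1 * phi x)) => // [x _|].
  by rewrite mulN1r.
by apply: CkM => //; exact: CkC.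
Qed.

Lemma CkX k U phi j : open U -> Ck k U phi -> Ck k U (fun x => phi x ^+ j).
Proof.
move=> oU A; elim: j => [|j IH]; first exact: CkC.
apply: (@Ck_eq _ _ (fun x => phi x * phi x ^+ j)) => // [x _|].
  by rewrite exprS.
exact: CkM.
Qed.

(** The chain rule, in a form suited to inductions on k for functions that
    satisfy a first-order differential equation. *)
Lemma Ck_comp k U (F F' : R -> R) phi : open U ->
  (forall x, U x -> is_derive (phi x) 1 F (F' (phi x))) ->
  Ck k.+1 U phi -> Ck k U (fun x => F' (phi x)) ->
  Ck k.+1 U (fun x => F (phi x)).
Proof.
move=> oU dF A B; apply: CkS => // [x Ux|i].
  apply: (@continuous_comp _ _ _ phi F); first exact: (Ck0 A Ux).
  exact: (der_cont (dF x Ux)).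
exists (fun x => F' (phi x) * partial i phi x); split.
  by move=> x Ux; apply: der_comp; [exact: dF|exact: (Ck_der A)].
by apply: CkM => //; case: A => _ /(_ i) [].
Qed.

Lemma Ck_comp0 U (F : R -> R) phi :
  (forall x, U x -> {for phi x, continuous F}) -> Ck 0 U phi ->
  Ck 0 U (fun x => F (phi x)).
Proof.
move=> cF A; split=> // x Ux.
by apply: (@continuous_comp _ _ _ phi F); [exact: (Ck0 A Ux)|exact: cF].
Qed.

Lemma CkV k U phi : open U -> (forall x, U x -> phi x != 0) -> Ck k U phi ->
  Ck k U (fun x => (phi x)^-1).
Proof.
move=> oU nz; elim: k => [|k IH] A.
  by apply: (@Ck_comp0 _ GRing.inv _ _ A) => x Ux; apply: inv_continuous; exact: nz.
apply: (@Ck_comp _ _ GRing.inv (fun y => - (y ^- 2 * 1)) phi) => // [x Ux|].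
  by apply: der_inv; exact: nz.
apply: (@Ck_eq _ _ (fun x => - ((phi x)^-1 * (phi x)^-1))) => // [x Ux|].
  by rewrite mulr1 expr2 invfM.
by apply: CkN => //; apply: CkM => //; apply: IH; exact: CkW.
Qed.

Lemma Ck_sqrt k U phi : open U -> (forall x, U x -> 0 < phi x) -> Ck k U phi ->
  Ck k U (fun x => Num.sqrt (phi x)).
Proof.
move=> oU pos; elim: k => [|k IH] A.
  by apply: (@Ck_comp0 _ Num.sqrt _ _ A) => x Ux; exact: sqrt_continuous.
apply: (@Ck_comp _ _ Num.sqrt (fun y => (2 * Num.sqrt y)^-1) phi) => // [x Ux|].
  by apply: is_derive1_sqrt; exact: pos.
apply: CkV => // [x Ux|]; first by rewrite mulf_neq0 // gt_eqF // sqrtr_gt0 pos.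
by apply: CkM => //; [exact: CkC|apply: IH; exact: CkW].
Qed.

Lemma Ck_expR k U phi : open U -> Ck k U phi -> Ck k U (fun x => expR (phi x)).
Proof.
move=> oU; elim: k => [|k IH] A.
  by apply: (@Ck_comp0 _ expR _ _ A) => x Ux; exact: continuous_expR.
by apply: (@Ck_comp _ _ expR expR phi) => //; apply: IH; exact: CkW.
Qed.

Lemma Ck_ln k U phi : open U -> (forall x, U x -> 0 < phi x) -> Ck k U phi ->
  Ck k U (fun x => ln (phi x)).
Proof.
move=> oU pos; case: k => [|k] A.
  by apply: (@Ck_comp0 _ (@ln R) _ _ A) => x Ux; apply: continuous_ln; exact: pos.
apply: (@Ck_comp _ _ (@ln R) GRing.inv phi) => // [x Ux|].
  by apply: is_derive1_ln; exact: pos.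
by apply: CkV => // [x Ux|]; [rewrite gt_eqF ?pos|exact: CkW].
Qed.

End Coordinates.

Section Slab.
Context {R : realType}.

Lemma open_halfspaces n (i : 'I_n) (a e : R) :
  open [set x : 'rV[R]_n | a < x 0 i < e].
Proof.
rewrite (_ : [set x | _] = (fun x : 'rV[R]_n => x 0 i) @^-1` [set y | a < y < e]) //.
apply: open_comp; first by move=> x _; exact: coord_continuous.
rewrite (_ : [set y | _] = `]a, e[%classic); first exact: interval_open.
by apply/seteqP; split=> y /=; rewrite in_itv.
Qed.

Lemma open_slab (a e : R) : open (slab a e).
Proof. exact: open_halfspaces. Qed.

End Slab.

(** Differentiates the function of the goal; the derivative is left to be
   unified, and the conditions for inverses are left as goals. *)
Ltac der_step :=
  match goal with
  | |- is_derive _ _ (fun _ => ?c) _ => eapply derC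
  | |- is_derive _ _ (fun y => fun_of_matrix y _ _) _ => eapply der_coord
  | |- is_derive _ _ (fun y => y) _ => eapply der_id
  | |- is_derive _ _ (fun y => _ + _) _ => eapply derD
  | |- is_derive _ _ (fun y => - _) _ => eapply derN
  | |- is_derive _ _ (fun y => _ * _) _ => eapply derM
  | |- is_derive _ _ (fun y => _ ^+ _) _ => eapply derX
  | |- is_derive _ _ (fun y => (_)^-1) _ => eapply derV
  | |- is_derive _ _ GRing.inv _ => eapply der_inv
  | |- is_derive _ _ -%R _ => eapply der_opp
  | |- is_derive _ _ (+%R _) _ => eapply der_addl
  | |- is_derive _ _ ( *%R _) _ => eapply der_mull
  | |- is_derive _ _ (fun y => expR _) _ => eapply der_exp
  | |- is_derive _ _ (fun y => Num.sqrt _) _ => eapply der_sqrt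
  | |- is_derive _ _ (fun y => ln _) _ => eapply der_ln
  | H : is_derive _ _ ?f _ |- is_derive _ _ ?f _ => exact H
  | |- is_derive _ _ _ _ => eassumption
  end.
Ltac der := repeat der_step.

(** Proves C^k regularity by structural recursion on the function; openness of
   the domain is looked up in the context, and the conditions on the arguments
   of inverses, square roots and logarithms are left as goals. *)
Ltac ck_open :=
  match goal with
  | H : open ?U |- open ?U => exact H
  | H : open _ |- open _ => exact H
  end.
Ltac ck_step :=
  match goal with
  | |- Ck _ _ (fun _ => ?c) => eapply CkC; ck_open
  | |- Ck _ _ (fun y => fun_of_matrix y _ _) => eapply Ck_coord; ck_open
  | |- Ck _ _ (fun y => _ + _) => eapply CkD; [ck_open| |]
  | |- Ck _ _ (fun y => - _) => eapply CkN; [ck_open|]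
  | |- Ck _ _ (fun y => _ * _) => eapply CkM; [ck_open| |]
  | |- Ck _ _ (fun y => _ ^+ _) => eapply CkX; [ck_open|]
  | |- Ck _ _ (fun y => (_)^-1) => eapply CkV; [ck_open| |]
  | |- Ck _ _ (fun y => expR _) => eapply Ck_expR; [ck_open|]
  | |- Ck _ _ (fun y => Num.sqrt _) => eapply Ck_sqrt; [ck_open| |]
  | |- Ck _ _ (fun y => ln _) => eapply Ck_ln; [ck_open| |]
  | H : Ck _ _ ?f |- Ck _ _ ?f => exact H
  | H : Ck _ _ _ |- Ck _ _ _ => exact H
  end.
Ltac ck := repeat ck_step.

(** * Diagonal metrics and their pullbacks *)

Section DiagonalMetrics.
Context {R : realType}.

Lemma invmx_diag n (d : 'rV[R]_n) : (forall i, d 0 i != 0) ->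
  invmx (diag_mx d) = diag_mx (map_mx GRing.inv d).
Proof.
move=> nz.
have E : diag_mx d *m diag_mx (map_mx GRing.inv d) = 1%:M.
  rewrite mul_diag_mx; apply/matrixP => i j; rewrite !mxE.
  by case: eqP => [->|_]; rewrite ?mulr1n ?mulfV // mulr0.
have [U _] := mulmx1_unit E.
by rewrite -[RHS](mulKmx U) E mulmx1.
Qed.

(** Only the diagonal entry k of the inverse metric contributes to the sum. *)
Lemma christoffel_diag n (G : 'rV[R]_n -> 'M[R]_n) (d : 'rV[R]_n -> 'rV[R]_n)
    (U : set 'rV[R]_n) (x : 'rV[R]_n) (k i j : 'I_n) :
  open U -> (forall y, U y -> G y = diag_mx (d y)) -> U x ->
  (forall l, d x 0 l != 0) ->
  christoffel G k i j x = 2^-1 * (d x 0 k)^-1 *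
    ((k == j)%:R * partial i (fun y => d y 0 k) x
     + (k == i)%:R * partial j (fun y => d y 0 k) x
     - (i == j)%:R * partial k (fun y => d y 0 i) x).
Proof.
move=> oU GE Ux nz.
have P a l c : partial a (fun y => G y l c) x
    = (l == c)%:R * partial a (fun y => d y 0 l) x.
  have -> : partial a (fun y => G y l c) x
      = partial a (fun y => d y 0 l *+ (l == c)) x.
    apply: near_eq_derive; apply: (near_open oU Ux) => y Uy.
    by rewrite GE // mxE.
  case: eqP => _; rewrite ?mulr1n ?mul1r // mul0r.
  by apply: der_partial; exact: derC.
rewrite /christoffel (bigD1 k) //= GE // invmx_diag // big1 => [|l lk].
  by rewrite !P !mxE eqxx mulr1n addr0 mulrA.
by rewrite !mxE eq_sym (negbTE lk) mulr0n mul0r.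
Qed.

Lemma diag_block (a b : nat) (A : 'rV[R]_a) (D : 'rV[R]_b) :
  block_mx (diag_mx A) 0 0 (diag_mx D) = diag_mx (row_mx A D).
Proof. by rewrite diag_mx_row. Qed.

Lemma posdef_diag n (d : 'rV[R]_n) : (forall i, 0 < d 0 i) -> posdef (diag_mx d).
Proof.
move=> pos; split; first by rewrite tr_diag_mx.
move=> v /eqP v0.
have F : Defs.form (diag_mx d) v v = \sum_i d 0 i * v 0 i ^+ 2.
  rewrite /Defs.form mul_mx_diag mxE; apply: eq_bigr => i _; rewrite !mxE.
  by rewrite -mulrA mulrCA -expr2.
have [i vi] : exists i, v 0 i != 0.
  apply: contrapT => /forallNP H; apply: v0; apply/rowP => i; rewrite mxE.
  by apply/eqP; apply/negPn/negP; exact: H.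
rewrite F (bigD1 i) //=; apply: ltr_pwDl.
  by rewrite mulr_gt0 // exprn_even_gt0.
by apply: sumr_ge0 => j _; rewrite mulr_ge0 ?sqr_ge0 // ltW.
Qed.

End DiagonalMetrics.

Section LinearChange.
Context {R : realType}.

Lemma derive_linear (V W : normedModType R) (L : {linear V -> W}) (phi : W -> R) x v :
  'D_v (fun y => phi (L y)) x = 'D_(L v) phi (L x).
Proof.
rewrite /derive; set u1 := fun h => _; set u2 := fun h => _.
suff -> : u1 = u2 by [].
by apply/funext => h; rewrite /u1 /u2 /= linearP.
Qed.

Lemma rsub_delta_r a b (j : 'I_b) :
  rsubmx (delta_mx 0 (rshift a j)) = delta_mx 0 j :> 'rV[R]_b.
Proof. by apply/rowP => l; rewrite !mxE eq_rshift. Qed.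

Lemma rsub_delta_l a b (j : 'I_a) :
  rsubmx (delta_mx 0 (lshift b j)) = 0 :> 'rV[R]_b.
Proof. by apply/rowP => l; rewrite !mxE eq_rlshift andbF. Qed.

Lemma partial_rsubmx_r a b (phi : 'rV[R]_b -> R) j (x : 'rV[R]_(a + b)) :
  partial (rshift a j) (fun y => phi (rsubmx y)) x = partial j phi (rsubmx x).
Proof. by rewrite /partial (derive_linear (@rsubmx R 1 a b)) /= rsub_delta_r. Qed.

Lemma partial_rsubmx_l a b (phi : 'rV[R]_b -> R) j (x : 'rV[R]_(a + b)) :
  partial (lshift b j) (fun y => phi (rsubmx y)) x = 0.
Proof.
by rewrite /partial (derive_linear (@rsubmx R 1 a b)) /= rsub_delta_l derive0.
Qed.

Lemma partial_coord n (i j : 'I_n) (x : 'rV[R]_n) :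
  partial i (fun y => y 0 j) x = (i == j)%:R.
Proof. by apply: der_partial; apply: is_derive_eq (der_coord _ _ _) _; rewrite mxE eq_sym. Qed.

End LinearChange.

Section StereographicCharts.
Context {R : realType}.
Implicit Types u : 'rV[R]_2.

(** The standard metric of the sphere is conf u |du|^2 in either chart. *)
Definition conf u : R := 4 / (1 + normsq u) ^+ 2.

Lemma normsqE u : normsq u = u 0 0 ^+ 2 + u 0 1 ^+ 2.
Proof.
rewrite /normsq mxE big_ord_recl big_ord1 !mxE -!expr2.
by congr (_ + u 0 _ ^+ 2); exact/val_inj.
Qed.

Lemma normsq_ge0 u : 0 <= normsq u.
Proof. by rewrite normsqE addr_ge0 ?sqr_ge0. Qed.

Lemma normsqD_gt0 u : 0 < 1 + normsq u.
Proof. by rewrite ltr_pwDl ?normsq_ge0. Qed.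

Lemma normsqD_neq0 u : 1 + normsq u != 0.
Proof. by rewrite gt_eqF ?normsqD_gt0. Qed.

Lemma conf_gt0 u : 0 < conf u.
Proof. by rewrite divr_gt0 // exprn_gt0 ?normsqD_gt0. Qed.

Lemma ord2P (P : 'I_2 -> Prop) : P 0 -> P 1 -> forall i, P i.
Proof.
move=> P0 P1 [[|[|//]] h]; first by rewrite (_ : Ordinal h = 0) //; exact/val_inj.
by rewrite (_ : Ordinal h = 1) //; exact/val_inj.
Qed.

Lemma der_normsq u j : is_derive u (delta_mx 0 j) (@normsq R 2) (2 * u 0 j).
Proof.
rewrite (_ : @normsq R 2 = fun y => y 0 0 ^+ 2 + y 0 1 ^+ 2); last first.
  by apply/funext => y; exact: normsqE.
eapply is_derive_eq; first exact: (derD (derX 2 (der_coord _ _ _)) (derX 2 (der_coord _ _ _))).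
by elim/ord2P: j; rewrite !mxE /=; ring.
Qed.

Lemma partial_stereo_l b u i j :
  partial j (fun y => stereo b y 0 (lshift 1 i)) u
  = 2 * (i == j)%:R / (1 + normsq u) - 4 * u 0 i * u 0 j / (1 + normsq u) ^+ 2.
Proof.
apply: der_partial.
rewrite (_ : (fun y => _) = fun y => 2 * (1 + normsq y)^-1 * y 0 i); last first.
  by apply/funext => y; rewrite /stereo row_mxEl mxE.
have N := der_normsq u j; have nz := normsqD_neq0 u.
eapply is_derive_eq; first by der.
by rewrite mxE /=; field.
Qed.

Lemma partial_stereo_r b u j :
  partial j (fun y => stereo b y 0 (rshift 2 0)) u
  = (-1) ^+ b * 4 * u 0 j / (1 + normsq u) ^+ 2.
Proof.
apply: der_partial.
rewrite (_ : (fun y => _) = fun y => (-1) ^+ b * (normsq y - 1) * (1 + normsq y)^-1); last first.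
  by apply/funext => y; rewrite /stereo row_mxEr mxE eqxx mulr1n.
have N := der_normsq u j; have nz := normsqD_neq0 u.
eapply is_derive_eq; first by der.
by cbv beta; set s := (-1) ^+ b; field.
Qed.

(** The cross terms of the two planar components of the projection are
    cancelled by the derivatives of the height. *)
Lemma stereo_conformal b u :
  jac (stereo b) u *m (jac (stereo b) u)^T = (conf u)%:M.
Proof.
apply/matrixP => i j; rewrite !mxE.
rewrite (@big_split_ord _ _ _ 2 1) /=.
rewrite big_ord1 big_ord_recl big_ord1 !mxE.
rewrite (_ : lift ord0 ord0 = 1) ?[ord0]/(0 : 'I_2) ?[ord0]/(0 : 'I_1); last exact/val_inj.
rewrite ?[Zp0]/(0 : 'I_2) !partial_stereo_l !partial_stereo_r /conf.
have s1 : (-1) ^+ b * (-1) ^+ b = 1 :> R by rewrite -expr2 sqrr_sign.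
have := normsqD_neq0 u.
rewrite normsqE => nz.
set s := (-1) ^+ b in s1 *.
set u0 := u 0 0 in nz *; set u1 := u 0 1 in nz *.
rewrite ?[u 0 Zp0]/u0.
have Hs (p q r : R) : s * 4 * p / r * (s * 4 * q / r) = 4 * p / r * (4 * q / r)
  by rewrite -[RHS]mul1r -s1; ring.
rewrite Hs; elim/ord2P: i; elim/ord2P: j; rewrite /= ?mulr1n ?mulr0n -/u0 -/u1; by field.
Qed.

End StereographicCharts.

Section Charts.
Context {R : realType}.

Lemma jac_cyl k b (x : 'rV[R]_(k + 2)) :
  jac (cyl b) x = block_mx 1%:M 0 0 (jac (stereo b) (rsubmx x)) :> 'M[R]_(k + 2, k + 3).
Proof.
apply/matrixP => i a; rewrite [LHS]mxE.
case: (split_ordP i) => i' ->; case: (split_ordP a) => a' ->;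
  rewrite ?block_mxEul ?block_mxEur ?block_mxEdl ?block_mxEdr !mxE.
- rewrite (_ : (fun y => _) = fun y : 'rV[R]_(k + 2) => y 0 (lshift 2 a')).
    by rewrite partial_coord eq_lshift.
  by apply/funext => y; rewrite /cyl row_mxEl mxE.
- rewrite (_ : (fun y => _) = fun y : 'rV[R]_(k + 2) => stereo b (rsubmx y) 0 a').
    by rewrite (partial_rsubmx_l (fun u => stereo b u 0 a')).
  by apply/funext => y; rewrite /cyl row_mxEr.
- rewrite (_ : (fun y => _) = fun y : 'rV[R]_(k + 2) => y 0 (lshift 2 a')).
    by rewrite partial_coord eq_rlshift.
  by apply/funext => y; rewrite /cyl row_mxEl mxE.
- rewrite (_ : (fun y => _) = fun y : 'rV[R]_(k + 2) => stereo b (rsubmx y) 0 a').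
    by rewrite (partial_rsubmx_r (fun u => stereo b u 0 a')).
  by apply/funext => y; rewrite /cyl row_mxEr.
Qed.

(** The chart acts on the sphere factor only, where it is conformal. *)
Lemma pullback_cyl k b (T : 'rV[R]_(k + 3) -> 'M[R]_(k + 3)) x A (c : R) :
  T (cyl b x) = block_mx A 0 0 c%:M ->
  pullback (cyl b) T x = block_mx A 0 0 (c * conf (rsubmx x))%:M :> 'M[R]_(k + 2).
Proof.
move=> E; rewrite /pullback E jac_cyl tr_block_mx !mulmx_block.
rewrite !trmx0 trmx1 !mul1mx !mulmx1 !mul0mx !mulmx0 !addr0 !add0r !mul0mx.
by rewrite mul_mx_scalar -scalemxAl stereo_conformal scale_scalar_mx.
Qed.

(** The time and radial coordinates are regrouped, so that the metric is read as a
    matrix on R^2 x S^2. *)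
Lemma gSch_block m (q : 'rV[R]_(2 + 3)) :
  let r := @rsubmx _ 1 1 4 q 0 0 in
  gSch m q = block_mx (@block_mx _ 1 1 1 1 (- h m r)%:M 0 0 (h m r)^-1%:M) 0 0
    (r ^+ 2)%:M :> 'M[R]_(2 + 3).
Proof.
move=> r; rewrite /gSch -/r.
have := @block_mxA R 1 1 3 1 1 3 (- h m r)%:M 0 0 0 (h m r)^-1%:M 0 0 0 (r ^+ 2)%:M.
by rewrite /= !row_mx0 !col_mx0 castmx_id.
Qed.

Lemma jac_graph f n (x : 'rV[R]_(1 + n)) : derivable f (x 0 0) 1 ->
  jac (@graph R f n) x = row_mx (col_mx (f^`()%classic (x 0 0))%:M 0) 1%:M.
Proof.
move=> df; apply/matrixP => i a; rewrite [LHS]mxE.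
case: (split_ordP a) => a' ->; rewrite ?row_mxEl ?row_mxEr.
  rewrite (_ : (fun y => _) = fun y : 'rV[R]_(1 + n) => f (y 0 0)); last first.
    by apply/funext => y; rewrite /graph row_mxEl mxE ord1 mulr1n.
  apply: der_partial; apply: is_derive_eq.
    by apply: der_comp (der_coord _ _ _); apply: derivableP.
  rewrite derive1E mxE /= !ord1.
  case: (split_ordP i) => i' ->; rewrite ?col_mxEu ?col_mxEd !mxE ?ord1 //=.
  by rewrite mulr1 mulr1n.
  by rewrite mulr0.
rewrite (_ : (fun y => _) = fun y : 'rV[R]_(1 + n) => y 0 a').
  by rewrite partial_coord mxE.
by apply/funext => y; rewrite /graph row_mxEr.
Qed.

(** The tangent vector of the graph in the direction r is f' d/dt + d/dr. *)
Lemma pullback_graph f n (T : 'rV[R]_(1 + (1 + n)) -> 'M[R]_(1 + (1 + n)))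
    (x : 'rV[R]_(1 + n)) (al be : R) D : derivable f (x 0 0) 1 ->
  T (graph f x) = block_mx al%:M 0 0 (block_mx be%:M 0 0 D) ->
  pullback (@graph R f n) T x
    = block_mx (be + al * f^`()%classic (x 0 0) ^+ 2)%:M 0 0 D.
Proof.
move=> df E; rewrite /pullback E jac_graph // tr_row_mx trmx1 mul_row_block.
rewrite !mulmx0 addr0 add0r mul1mx mul_row_col mulmx1.
rewrite tr_col_mx trmx0 tr_scalar_mx mul_col_mx mul_col_row mul0mx !mulmx0 !mul0mx.
rewrite add_block_mx !addr0 !add0r; congr block_mx.
by rewrite -!scalar_mxM -raddfD; congr _%:M; ring.
Qed.

Lemma jac_of_s (q : 'rV[R]_(1 + 3)) : q 0 0 != 0 ->
  jac (@of_s R) q = block_mx (- (q 0 0) ^- 2)%:M 0 0 1%:M.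
Proof.
move=> q0; apply/matrixP => i a; rewrite [LHS]mxE.
case: (split_ordP a) => a' ->; last first.
  rewrite (_ : (fun y => _) = fun y : 'rV[R]_(1 + 3) => y 0 (rshift 1 a')).
    rewrite partial_coord.
    case: (split_ordP i) => i' ->; rewrite ?block_mxEur ?block_mxEdr !mxE.
      by rewrite eq_lrshift.
    by rewrite eq_rshift.
  by apply/funext => y; rewrite /of_s row_mxEr mxE.
rewrite (_ : (fun y => _) = fun y : 'rV[R]_(1 + 3) => (y 0 0)^-1); last first.
  by apply/funext => y; rewrite /of_s row_mxEl mxE ord1 mulr1n.
apply: der_partial; eapply is_derive_eq; first by der.
case: (split_ordP i) => i' ->; rewrite ?block_mxEul ?block_mxEdl !mxE ?ord1 /=.
  by rewrite mulr1 mulr1n.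
by rewrite mulr0 oppr0.
Qed.

Lemma pullback_of_s (T : 'rV[R]_(1 + 3) -> 'M[R]_(1 + 3)) (q : 'rV[R]_(1 + 3)) (A : R) D :
  q 0 0 != 0 -> T (of_s q) = block_mx A%:M 0 0 D ->
  pullback (@of_s R) T q = block_mx (A / q 0 0 ^+ 4)%:M 0 0 D.
Proof.
move=> q0 E; rewrite /pullback E jac_of_s // tr_block_mx !mulmx_block.
rewrite !trmx0 trmx1 tr_scalar_mx !mul0mx !mulmx0 !addr0 !add0r !mul1mx !mulmx1 !mul0mx.
congr block_mx; rewrite -!scalar_mxM; congr _%:M; field.
exact: q0.
Qed.

End Charts.

(** * Scalar curvature of rotationally symmetric metrics *)

Section SlabCoordinates.

Definition crd0 : 'I_(1 + 2) := @Ordinal 3 0 isT.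
Definition crd1 : 'I_(1 + 2) := @Ordinal 3 1 isT.
Definition crd2 : 'I_(1 + 2) := @Ordinal 3 2 isT.

Lemma sum3 (V : nmodType) (F : 'I_(1 + 2) -> V) :
  \sum_i F i = F crd0 + F crd1 + F crd2.
Proof.
rewrite !big_ord_recl big_ord0 addr0 !addrA.
by congr (F _ + F _ + F _); exact/val_inj.
Qed.

Lemma ord3P (P : 'I_(1 + 2) -> Prop) :
  P crd0 -> P crd1 -> P crd2 -> forall i, P i.
Proof.
move=> P0 P1 P2 [[|[|[|//]]] h].
- by rewrite (_ : Ordinal h = crd0) //; exact/val_inj.
- by rewrite (_ : Ordinal h = crd1) //; exact/val_inj.
- by rewrite (_ : Ordinal h = crd2) //; exact/val_inj.
Qed.

End SlabCoordinates.

Section WarpedProduct.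
Context {R : realType}.
Implicit Types x y : 'rV[R]_(1 + 2).

Let zeroE : 0 = crd0. Proof. exact/val_inj. Qed.

Lemma conf_coord x :
  conf (rsubmx x) = 4 * (1 + (x 0 crd1 ^+ 2 + x 0 crd2 ^+ 2)) ^- 2.
Proof.
rewrite /conf normsqE !mxE.
by congr (_ / (1 + (x 0 _ ^+ 2 + x 0 _ ^+ 2)) ^+ 2); exact/val_inj.
Qed.

Variables (a : R) (V V1 : R -> R).
Hypothesis a0 : 0 <= a.
Hypothesis Vpos : forall r, a < r -> 0 < V r.
Hypothesis dV : forall r, a < r -> is_derive r 1 V (V1 r).

Let U : set 'rV[R]_(1 + 2) := [set x | a < x 0 0].

Let oU : open U.
Proof.
rewrite (_ : U = (fun x : 'rV[R]_(1 + 2) => x 0 0) @^-1` [set y | a < y]) //.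
by apply: open_comp; [move=> x _; exact: coord_continuous|exact: open_gt].
Qed.

Definition warped x : 'rV[R]_(1 + 2) :=
  row_mx (const_mx (V (x 0 0))^-1) (const_mx (x 0 0 ^+ 2 * conf (rsubmx x))).

Let N x := 1 + (x 0 crd1 ^+ 2 + x 0 crd2 ^+ 2).
Let N0 x : N x != 0.
Proof. by rewrite gt_eqF // ltr_pwDl // addr_ge0 ?sqr_ge0. Qed.

Let w0 x : warped x 0 crd0 = (V (x 0 crd0))^-1.
Proof.
rewrite (_ : crd0 = lshift 2 0) ?row_mxEl ?mxE -?zeroE; last exact/val_inj.
by congr ((V (x 0 _))^-1); exact/val_inj.
Qed.
Let w1 x : warped x 0 crd1 = x 0 crd0 ^+ 2 * (4 * (1 + (x 0 crd1 ^+ 2 + x 0 crd2 ^+ 2)) ^- 2).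
Proof.
rewrite {1}(_ : crd1 = rshift 1 0) /warped ?row_mxEr ?mxE ?conf_coord ?zeroE //.
exact/val_inj.
Qed.
Let w2 x : warped x 0 crd2 = x 0 crd0 ^+ 2 * (4 * (1 + (x 0 crd1 ^+ 2 + x 0 crd2 ^+ 2)) ^- 2).
Proof.
rewrite {1}(_ : crd2 = rshift 1 1) /warped ?row_mxEr ?mxE ?conf_coord ?zeroE //.
exact/val_inj.
Qed.

Let Dw (i k : nat) x : R :=
  match i, k with
  | 0, 0 => - V1 (x 0 crd0) / V (x 0 crd0) ^+ 2
  | _, 0 => 0
  | 0, _ => 2 * x 0 crd0 * (4 * N x ^- 2)
  | 1, _ => x 0 crd0 ^+ 2 * (- 16 * x 0 crd1 * N x ^- 3)
  | _, _ => x 0 crd0 ^+ 2 * (- 16 * x 0 crd2 * N x ^- 3)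
  end.

Let Dw0 x : U x -> forall k i : 'I_(1+2), partial i (fun y => warped y 0 k) x = Dw i k x.
Proof.
rewrite /U /= zeroE => Ux; have V0 := Vpos Ux; have V0' : V (x 0 crd0) != 0 by rewrite gt_eqF.
have dVx i : is_derive x (delta_mx 0 i) (fun y : 'rV[R]_(1 + 2) => V (y 0 crd0)) _ :=
  der_comp (dV Ux) (der_coord x (delta_mx 0 i) crd0).
have Nx : N x ^+ 2 != 0 by rewrite expf_neq0.
have Nx1 := N0 x.
elim/ord3P.
- under eq_fun do rewrite w0.
  move=> i; have H := dVx i; apply: der_partial; eapply is_derive_eq; first by der.
  by elim/ord3P: i {H}; rewrite mxE /=; field.
- under eq_fun do rewrite w1.
  move=> i; apply: der_partial; eapply is_derive_eq; first by der.
  by elim/ord3P: i; rewrite !mxE /= /N; field.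
- under eq_fun do rewrite w2.
  move=> i; apply: der_partial; eapply is_derive_eq; first by der.
  by elim/ord3P: i; rewrite !mxE /= /N; field.
Qed.

Let g0 x := - V1 (x 0 crd0) / (2 * V (x 0 crd0)).
Let ga x := - (x 0 crd0 * V (x 0 crd0) * (4 * (1 + (x 0 crd1 ^+ 2 + x 0 crd2 ^+ 2)) ^- 2)).
Let gb x := (x 0 crd0)^-1.
Let e1 x := - 2 * x 0 crd1 * (1 + (x 0 crd1 ^+ 2 + x 0 crd2 ^+ 2))^-1.
Let e2 x := - 2 * x 0 crd2 * (1 + (x 0 crd1 ^+ 2 + x 0 crd2 ^+ 2))^-1.

Let Gam (k i j : nat) : 'rV[R]_(1 + 2) -> R :=
  match k, i, j with
  | 0, 0, 0 => g0
  | 0, 1, 1 | 0, 2, 2 => ga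
  | 1, 0, 1 | 1, 1, 0 | 2, 0, 2 | 2, 2, 0 => gb
  | 1, 1, 1 | 2, 1, 2 | 2, 2, 1 => e1
  | 2, 2, 2 | 1, 1, 2 | 1, 2, 1 => e2
  | 1, 2, 2 => fun x => - e1 x
  | 2, 1, 1 => fun x => - e2 x
  | _, _, _ => fun=> 0
  end.

Variable G : 'rV[R]_(1 + 2) -> 'M[R]_(1 + 2).
Hypothesis GE : forall x, U x -> G x = diag_mx (warped x).

Let warped_neq0 x : U x -> forall i, warped x 0 i != 0.
Proof.
rewrite /U /= zeroE => Ux; have V0 := Vpos Ux.
have x0 : x 0 crd0 != 0 by rewrite gt_eqF // (le_lt_trans a0).
have Nx : N x ^+ 2 != 0 by rewrite expf_neq0.
elim/ord3P; rewrite ?w0 ?w1 ?w2 ?invr_eq0 ?(gt_eqF V0) //;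
by rewrite !mulf_neq0 // ?invr_neq0 // expf_neq0.
Qed.

Let christoffelE x : U x -> forall k i j : 'I_(1 + 2),
  christoffel G k i j x = Gam k i j x.
Proof.
move=> Ux k i j.
rewrite (christoffel_diag k i j oU GE Ux (warped_neq0 Ux)) !(Dw0 Ux).
move: Ux; rewrite /U /= zeroE => Ux; have V0 := Vpos Ux.
have V0' : V (x 0 crd0) != 0 by rewrite gt_eqF.
have x0 : x 0 crd0 != 0 by rewrite gt_eqF // (le_lt_trans a0).
have Nx1 := N0 x; rewrite /N in Nx1.
elim/ord3P: k; rewrite ?w0 ?w1 ?w2; elim/ord3P: i; elim/ord3P: j;
  rewrite /= /N /g0 /ga /gb /e1 /e2; by field; rewrite ?Nx1 ?V0' ?x0.
Qed.

Let partial_christoffel x : U x -> forall l k i j : 'I_(1 + 2),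
  partial l (christoffel G k i j) x = partial l (Gam k i j) x.
Proof.
move=> Ux l k i j; apply: near_eq_derive; apply: (near_open oU Ux) => y Uy.
exact: christoffelE.
Qed.

(** For dr^2/V + r^2 sigma the radial sectional curvatures are - V'/(2r) and
    the curvature of the tangent planes of the spheres is (1 - V)/r^2. *)
Lemma scalar_curvature_warped x : a < x 0 0 ->
  scalar_curvature G x
    = 2 * (1 - V (x 0 0)) / x 0 0 ^+ 2 - 2 * V1 (x 0 0) / x 0 0.
Proof.
move=> Ux; have Px := partial_christoffel Ux; have Cx := christoffelE Ux.
have E : scalar_curvature G x = \sum_i (warped x 0 i)^-1 * ricci G x i i.
  rewrite /scalar_curvature GE // (invmx_diag (warped_neq0 Ux)).
  apply: eq_bigr => i _; rewrite (bigD1 i) //= big1 ?addr0 => [|j ji].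
    by rewrite !mxE eqxx mulr1n.
  by rewrite !mxE eq_sym (negbTE ji) mulr0n mul0r.
rewrite {}E.
move: Ux; rewrite /U /= zeroE => Ux; have V0 := Vpos Ux.
have V0' : V (x 0 crd0) != 0 by rewrite gt_eqF.
have x0 : x 0 crd0 != 0 by rewrite gt_eqF // (le_lt_trans a0).
have Nx1 := N0 x; rewrite /N in Nx1.
have Nx2 : (1 + (x 0 crd1 ^+ 2 + x 0 crd2 ^+ 2)) ^+ 2 != 0 by rewrite expf_neq0.
have pz l : partial l (fun=> 0 : R) x = 0 by apply: der_partial; exact: derC.
have dVx i : is_derive x (delta_mx 0 i) (fun y : 'rV[R]_(1 + 2) => V (y 0 crd0)) _ :=
  der_comp (dV Ux) (der_coord x (delta_mx 0 i) crd0).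
have pga : partial crd0 ga x = - ((V (x 0 crd0) + x 0 crd0 * V1 (x 0 crd0))
    * (4 * (1 + (x 0 crd1 ^+ 2 + x 0 crd2 ^+ 2)) ^- 2)).
  have H := dVx crd0; rewrite /ga; apply: der_partial; eapply is_derive_eq; first by der.
  by rewrite !mxE /=; field.
have pgb : partial crd0 gb x = - (x 0 crd0) ^- 2.
  rewrite /gb; apply: der_partial; eapply is_derive_eq; first by der.
  by rewrite !mxE /=; field.
have pe1 : partial crd1 e1 x = - 2 * (1 + (x 0 crd1 ^+ 2 + x 0 crd2 ^+ 2))^-1
    + 4 * x 0 crd1 ^+ 2 * (1 + (x 0 crd1 ^+ 2 + x 0 crd2 ^+ 2)) ^- 2.
  rewrite /e1; apply: der_partial; eapply is_derive_eq; first by der.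
  by rewrite !mxE /=; field.
have pe2 : partial crd2 e2 x = - 2 * (1 + (x 0 crd1 ^+ 2 + x 0 crd2 ^+ 2))^-1
    + 4 * x 0 crd2 ^+ 2 * (1 + (x 0 crd1 ^+ 2 + x 0 crd2 ^+ 2)) ^- 2.
  rewrite /e2; apply: der_partial; eapply is_derive_eq; first by der.
  by rewrite !mxE /=; field.
have pN1 : partial crd1 (fun x => - e1 x) x = - partial crd1 e1 x.
  rewrite pe1 /e1; apply: der_partial; eapply is_derive_eq; first by der.
  by rewrite !mxE /=; field.
have pN2 : partial crd2 (fun x => - e2 x) x = - partial crd2 e2 x.
  rewrite pe2 /e2; apply: der_partial; eapply is_derive_eq; first by der.
  by rewrite !mxE /=; field.
have R0 : ricci G x crd0 crd0 = - V1 (x 0 crd0) / (x 0 crd0 * V (x 0 crd0)).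
  rewrite mxE !sum3 !Px !Cx /= !pz pgb subrr /g0 /gb /=.
  by field; rewrite V0'.
(* The curvature of the round sphere in a stereographic chart. *)
have curv0 : 4 * (1 + (x 0 crd1 ^+ 2 + x 0 crd2 ^+ 2))^-1
    - 4 * (x 0 crd1 ^+ 2 + x 0 crd2 ^+ 2) * (1 + (x 0 crd1 ^+ 2 + x 0 crd2 ^+ 2)) ^- 2
    = 4 * (1 + (x 0 crd1 ^+ 2 + x 0 crd2 ^+ 2)) ^- 2 by field.
have R1 : ricci G x crd1 crd1 = (1 - V (x 0 crd0) - x 0 crd0 * V1 (x 0 crd0) / 2)
    * (4 * (1 + (x 0 crd1 ^+ 2 + x 0 crd2 ^+ 2)) ^- 2).
  rewrite mxE !sum3 !Px !Cx /= !pz pN2 pga pe1 pe2 /g0 /ga /gb /e1 /e2 /=.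
  move: curv0; set u1 := x 0 crd1 in Nx1 Nx2 *; set u2 := x 0 crd2 in Nx1 Nx2 *.
  set r := x 0 crd0 in x0 V0' *; set v := V r in V0' *; set v1 := V1 r.
  move: (1 + (u1 ^+ 2 + u2 ^+ 2)) Nx1 => n n0 curv0.
  transitivity ((- v - r * v1 / 2) * (4 * n ^- 2)
    + (4 * n^-1 - 4 * (u1 ^+ 2 + u2 ^+ 2) * n ^- 2)); last by rewrite curv0; ring.
  by field; rewrite ?n0 ?x0 ?V0'.
have R2 : ricci G x crd2 crd2 = (1 - V (x 0 crd0) - x 0 crd0 * V1 (x 0 crd0) / 2)
    * (4 * (1 + (x 0 crd1 ^+ 2 + x 0 crd2 ^+ 2)) ^- 2).
  rewrite mxE !sum3 !Px !Cx /= !pz pN1 pga pe1 pe2 /g0 /ga /gb /e1 /e2 /=.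
  move: curv0; set u1 := x 0 crd1 in Nx1 Nx2 *; set u2 := x 0 crd2 in Nx1 Nx2 *.
  set r := x 0 crd0 in x0 V0' *; set v := V r in V0' *; set v1 := V1 r.
  move: (1 + (u1 ^+ 2 + u2 ^+ 2)) Nx1 => n n0 curv0.
  transitivity ((- v - r * v1 / 2) * (4 * n ^- 2)
    + (4 * n^-1 - 4 * (u1 ^+ 2 + u2 ^+ 2) * n ^- 2)); last by rewrite curv0; ring.
  by field; rewrite ?n0 ?x0 ?V0'.
rewrite sum3 w0 w1 w2 R0 R1 R2.
move: (1 + (x 0 crd1 ^+ 2 + x 0 crd2 ^+ 2)) Nx1 => n n0.
by field; rewrite ?n0 ?x0 ?V0'.
Qed.

End WarpedProduct.

(** * The mean curvature equation and its first integral *)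

Lemma der_lapse (R : realType) (m r : R) : r != 0 ->
  is_derive r 1 (h m) (2 * m / r ^+ 2).
Proof.
move=> r0.
have -> : h m = fun y => 1 - 2 * m * y^-1 by apply/funext.
eapply is_derive_eq; first (der; exact: r0).
by rewrite /=; field.
Qed.

Section MeanCurvature.
Context {R : realType}.

Let o0 : 'I_(1 + (1 + 2)) := @Ordinal 4 0 isT.
Let o1 : 'I_(1 + (1 + 2)) := @Ordinal 4 1 isT.
Let o2 : 'I_(1 + (1 + 2)) := @Ordinal 4 2 isT.
Let o3 : 'I_(1 + (1 + 2)) := @Ordinal 4 3 isT.
Let sum4 (F : 'I_(1 + (1 + 2)) -> R) : \sum_i F i = F o0 + F o1 + F o2 + F o3.
Proof.
rewrite !big_ord_recl big_ord0 addr0 !addrA.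
by congr (F _ + F _ + F _ + F _); exact/val_inj.
Qed.

Let ord4P (P : 'I_(1 + (1 + 2)) -> Prop) : P o0 -> P o1 -> P o2 -> P o3 -> forall i, P i.
Proof.
move=> P0 P1 P2 P3 [[|[|[|[|//]]]] h].
- by rewrite (_ : Ordinal h = o0) //; exact/val_inj.
- by rewrite (_ : Ordinal h = o1) //; exact/val_inj.
- by rewrite (_ : Ordinal h = o2) //; exact/val_inj.
- by rewrite (_ : Ordinal h = o3) //; exact/val_inj.
Qed.

Variables (m : R).
Hypothesis m0 : 0 <= m.

Let c2 (y : 'rV[R]_(1 + (1 + 2))) := @rsubmx _ 1 2 2 y.

Lemma gSch_chartE b (y : 'rV[R]_(1 + (1 + 2))) :
  let r := y 0 o1 in
  gSch_chart m b y = block_mx (- h m r)%:M 0 0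
    (block_mx (h m r)^-1%:M 0 0 (r ^+ 2 * conf (c2 y))%:M)
    :> 'M[R]_(1 + (1 + 2)).
Proof.
move=> r; rewrite /gSch_chart.
have rE : @rsubmx _ 1 1 4 (@cyl R 2 b y) 0 0 = r.
  rewrite /cyl !mxE.
  case: (split_ordP _) => j E; last by move: (congr1 val E).
  by rewrite mxE; congr (y 0 _); apply: val_inj; have /= jv := congr1 val E; rewrite /= -jv.
have := @block_mxA R 1 1 2 1 1 2 (- h m r)%:M 0 0 0 (h m r)^-1%:M 0 0 0
  (r ^+ 2 * conf (c2 y))%:M.
rewrite /= !row_mx0 !col_mx0 castmx_id => ->.
have := @gSch_block _ m (@cyl R 2 b y); rewrite rE => E.
exact: (@pullback_cyl R 2 b _ y _ _ E).
Qed.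

Definition schw_diag (y : 'rV[R]_(1 + (1 + 2))) : 'rV[R]_(1 + (1 + 2)) :=
  row_mx (const_mx (- h m (y 0 o1))) (row_mx (const_mx (h m (y 0 o1))^-1)
    (const_mx (y 0 o1 ^+ 2 * conf (c2 y)))).

Lemma gSch_chart_diag b y : gSch_chart m b y = diag_mx (schw_diag y) :> 'M[R]_(1 + (1 + 2)).
Proof. by rewrite gSch_chartE /schw_diag -!diag_block !diag_const_mx. Qed.

Let d0 y : schw_diag y 0 o0 = - h m (y 0 o1).
Proof.
by rewrite (_ : o0 = lshift _ 0) ?row_mxEl ?mxE //; exact/val_inj.
Qed.
Let d1 y : schw_diag y 0 o1 = (h m (y 0 o1))^-1.
Proof.
by rewrite {1}(_ : o1 = rshift 1 (lshift 2 0)) /schw_diag ?row_mxEr ?row_mxEl ?mxE //; exact/val_inj.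
Qed.

Let confE (y : 'rV[R]_(1 + (1 + 2))) :
  conf (c2 y) = 4 * (1 + (y 0 o2 ^+ 2 + y 0 o3 ^+ 2)) ^- 2.
Proof.
rewrite /conf normsqE !mxE.
by congr (_ / (1 + (y 0 _ ^+ 2 + y 0 _ ^+ 2)) ^+ 2); exact/val_inj.
Qed.

Let d2 y : schw_diag y 0 o2 = y 0 o1 ^+ 2 * (4 * (1 + (y 0 o2 ^+ 2 + y 0 o3 ^+ 2)) ^- 2).
Proof.
rewrite {1}(_ : o2 = rshift 1 (rshift 1 0)) /schw_diag ?row_mxEr ?mxE ?confE //; exact/val_inj.
Qed.
Let d3 y : schw_diag y 0 o3 = y 0 o1 ^+ 2 * (4 * (1 + (y 0 o2 ^+ 2 + y 0 o3 ^+ 2)) ^- 2).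
Proof.
rewrite {1}(_ : o3 = rshift 1 (rshift 1 1)) /schw_diag ?row_mxEr ?mxE ?confE //; exact/val_inj.
Qed.

Let U : set 'rV[R]_(1 + (1 + 2)) := [set y | 2 * m < y 0 o1].
Let oU : open U.
Proof.
rewrite (_ : U = (fun x : 'rV[R]_(1 + (1 + 2)) => x 0 o1) @^-1` [set y | 2 * m < y]) //.
by apply: open_comp; [move=> x _; exact: coord_continuous|exact: open_gt].
Qed.

Let oU3 : open [set z : 'rV[R]_(1 + 2) | 2 * m < z 0 0].
Proof.
rewrite (_ : [set z | _] = (fun x : 'rV[R]_(1 + 2) => x 0 0) @^-1` [set y | 2 * m < y]) //.
by apply: open_comp; [move=> x _; exact: coord_continuous|exact: open_gt].
Qed.

Lemma h_gt0 (r : R) : 2 * m < r -> 0 < h m r.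
Proof.
move=> mr; have r0 : 0 < r by apply: le_lt_trans mr; rewrite mulr_ge0.
by rewrite /h subr_gt0 ltr_pdivrMr // mul1r.
Qed.

Let Dh r : R := 2 * m / r ^+ 2.

Lemma der_h (r : R) : 0 < r -> is_derive r 1 (h m) (Dh r).
Proof. by move=> r0; apply: der_lapse; rewrite gt_eqF. Qed.

Let schw_neq0 y : U y -> forall l, schw_diag y 0 l != 0.
Proof.
rewrite /U /= => Uy; have H := h_gt0 Uy.
have y0 : y 0 o1 != 0 by rewrite gt_eqF // (le_lt_trans _ Uy) // mulr_ge0.
have N0 : (1 + (y 0 o2 ^+ 2 + y 0 o3 ^+ 2)) ^+ 2 != 0.
  by rewrite expf_neq0 // gt_eqF // ltr_pwDl // addr_ge0 ?sqr_ge0.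
by elim/ord4P; rewrite ?d0 ?d1 ?d2 ?d3 ?oppr_eq0 ?invr_eq0 ?(gt_eqF H) //
  !mulf_neq0 // ?invr_neq0 // expf_neq0.
Qed.

(** At the centre of the chart only the radial derivatives survive. *)
Let Dd (i k : nat) (r : R) : R :=
  match i, k with
  | 1, 0 => - Dh r
  | 1, 1 => - Dh r / h m r ^+ 2
  | 1, _ => 8 * r
  | _, _ => 0
  end.

Let partial_d y : U y -> y 0 o2 = 0 -> y 0 o3 = 0 ->
  forall k i : 'I_(1 + (1 + 2)), partial i (fun z => schw_diag z 0 k) y = Dd i k (y 0 o1).
Proof.
move=> Uy y2 y3; have H := h_gt0 Uy; have H' : h m (y 0 o1) != 0 by rewrite gt_eqF.
have r0 : 0 < y 0 o1 by rewrite (le_lt_trans _ Uy) // mulr_ge0.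
have N0 : (1 + (y 0 o2 ^+ 2 + y 0 o3 ^+ 2)) ^+ 2 != 0.
  by rewrite expf_neq0 // gt_eqF // ltr_pwDl // addr_ge0 ?sqr_ge0.
have dhy i : is_derive y (delta_mx 0 i) (fun z : 'rV[R]_(1 + (1 + 2)) => h m (z 0 o1)) _ :=
  der_comp (der_h r0) (der_coord y (delta_mx 0 i) o1).
elim/ord4P => i.
- under eq_fun do rewrite d0.
  have Hi := dhy i; apply: der_partial; eapply is_derive_eq; first by der.
  by elim/ord4P: i {Hi}; rewrite mxE /= ?mulr0 ?mulr1 ?oppr0.
- under eq_fun do rewrite d1.
  have Hi := dhy i; apply: der_partial; eapply is_derive_eq; first by der.
  by elim/ord4P: i {Hi}; rewrite mxE /=; field.
- under eq_fun do rewrite d2.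
  apply: der_partial; eapply is_derive_eq; first by der.
  by elim/ord4P: i; rewrite !mxE /= y2 y3; field.
- under eq_fun do rewrite d3.
  apply: der_partial; eapply is_derive_eq; first by der.
  by elim/ord4P: i; rewrite !mxE /= y2 y3; field.
Qed.

Let christoffelE b y (k i j : 'I_(1 + (1 + 2))) : U y -> y 0 o2 = 0 -> y 0 o3 = 0 ->
  christoffel (gSch_chart m b) k i j y = 2^-1 * (schw_diag y 0 k)^-1 *
    ((k == j)%:R * Dd i k (y 0 o1) + (k == i)%:R * Dd j k (y 0 o1)
     - (i == j)%:R * Dd k i (y 0 o1)).
Proof.
move=> Uy y2 y3.
rewrite (christoffel_diag k i j oU (fun z _ => gSch_chart_diag b z) Uy (schw_neq0 Uy)).
by rewrite !partial_d.
Qed.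

Variable f : R -> R.

Let x_ (r : R) : 'rV[R]_(1 + 2) := row_mx r%:M 0.

Let F := @graph R f 2.

(** By rotational symmetry it suffices to compute at the centre of the chart, where
    the first derivatives of the conformal factor vanish. The unit normal is
    n0 (d/dt + h^2 f' d/dr), and W is the radial coefficient of the induced
    metric. *)
Lemma mean_curvature_graph r (b : bool) (nu : 'rV[R]_(1 + (1 + 2))) :
  let f1 := f^`()%classic in let f2 := f1^`()%classic in
  2 * m < r -> (forall r, 2 * m < r -> derivable f r 1 /\ derivable f1 r 1) ->
  posdef (pullback F (gSch_chart m b) (x_ r)) ->
  future_unit_normal (gSch_chart m b) F (x_ r) nu ->
  let W := (h m r)^-1 - h m r * f1 r ^+ 2 in
  exists n0 : R, [/\ 0 < n0, 0 < W, n0 ^+ 2 * h m r ^+ 2 * W = 1 &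
    mean_curvature (gSch_chart m b) F nu (x_ r) = 3^-1 *
     (h m r * n0 * (f2 r + 3 * f1 r * Dh r / (2 * h m r)
         - h m r * Dh r * f1 r ^+ 3 / 2) / W
      + 2 * (h m r ^+ 2 * f1 r * n0) / r)].
Proof.
move=> f1 f2 mr df.
have r0 : 0 < r by apply: le_lt_trans mr; rewrite mulr_ge0.
have r0' : r != 0 by rewrite gt_eqF.
have H := h_gt0 mr; have H' : h m r != 0 by rewrite gt_eqF.
have x0 : x_ r 0 0 = r.
  by rewrite /x_ (_ : (0 : 'I_(1 + 2)) = lshift 2 0) ?row_mxEl ?mxE ?mulr1n //; exact/val_inj.
have [dfr dfr1] := df r mr.
have dfx : derivable f (x_ r 0 0) 1 by rewrite x0.
set y := F (x_ r).
have yr i : y 0 (rshift 1 i) = x_ r 0 i by rewrite /y /F /graph row_mxEr.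
have y1 : y 0 o1 = r.
  by rewrite (_ : o1 = rshift 1 0) ?yr ?x0 //; exact/val_inj.
have y2 : y 0 o2 = 0.
  rewrite (_ : o2 = rshift 1 (rshift 1 0)) ?yr /x_ ?row_mxEr ?mxE //; exact/val_inj.
have y3 : y 0 o3 = 0.
  rewrite (_ : o3 = rshift 1 (rshift 1 1)) ?yr /x_ ?row_mxEr ?mxE //; exact/val_inj.
have Uy : U y by rewrite /U /= y1.
have PB : pullback F (gSch_chart m b) (x_ r) = diag_mx (row_mx
    (const_mx ((h m r)^-1 - h m r * f1 r ^+ 2)) (const_mx (4 * r ^+ 2))).
  have E := gSch_chartE b y; rewrite /= confE y1 y2 y3 in E.
  rewrite (pullback_graph dfx E) x0 -diag_block !diag_const_mx.
  by rewrite -/f1; congr (block_mx _%:M 0 0 _%:M); [ring|field].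
set W := (h m r)^-1 - h m r * f1 r ^+ 2 in PB *.
move=> /= pdef fun_nu; move: pdef; rewrite PB => -[_ pdef].
pose e : 'rV[R]_(1 + 2) := row_mx (const_mx W) (const_mx (4 * r ^+ 2)).
have e0 : e 0 crd0 = W.
  by rewrite /e (_ : crd0 = lshift 2 0) ?row_mxEl ?mxE //; exact/val_inj.
have e1 : e 0 crd1 = 4 * r ^+ 2.
  by rewrite /e (_ : crd1 = rshift 1 0) ?row_mxEr ?mxE //; exact/val_inj.
have e2 : e 0 crd2 = 4 * r ^+ 2.
  by rewrite /e (_ : crd2 = rshift 1 1) ?row_mxEr ?mxE //; exact/val_inj.
have PBe : pullback F (gSch_chart m b) (x_ r) = diag_mx e := PB.
have {}pdef : forall v, v != 0 -> 0 < Defs.form (diag_mx e) v v := pdef.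
clearbody e.
have W0 : 0 < W.
  have := pdef (delta_mx 0 crd0); rewrite /Defs.form mul_mx_diag mxE sum3 !mxE e0 e1 e2.
  rewrite /= !mul0r !addr0 mulr1 mul1r; apply; apply/eqP => /matrixP /(_ 0 crd0).
  by rewrite !mxE /= => /eqP; rewrite oner_eq0.
have W0' : W != 0 by rewrite gt_eqF.
have formE (v w : 'rV[R]_(1 + (1 + 2))) : Defs.form (gSch_chart m b y) v w
    = \sum_k v 0 k * schw_diag y 0 k * w 0 k.
  by rewrite gSch_chart_diag /Defs.form mul_mx_diag mxE; apply: eq_bigr => k _; rewrite !mxE.
have J0 i : jac F (x_ r) i o0 = (i == crd0)%:R * f1 r.
  rewrite jac_graph // x0 (_ : o0 = lshift _ 0) ?row_mxEl; last exact/val_inj.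
  case: (split_ordP i) => j ->; rewrite ?col_mxEu ?col_mxEd !mxE ?ord1 ?mulr1n ?mul0r //.
  by rewrite mul1r.
have JS i j : jac F (x_ r) i (rshift 1 j) = (i == j)%:R.
  by rewrite jac_graph // row_mxEr mxE.
have E1 : o1 = rshift 1 crd0 by exact/val_inj.
have E2 : o2 = rshift 1 crd1 by exact/val_inj.
have E3 : o3 = rshift 1 crd2 by exact/val_inj.
case: fun_nu => norm orth pos.
have rowJ i k : row i (jac F (x_ r)) 0 k = jac F (x_ r) i k by rewrite [LHS]mxE.
have n1E : nu 0 o1 = h m r ^+ 2 * f1 r * nu 0 o0.
  have := orth crd0; rewrite formE sum4 !rowJ J0 E1 E2 E3 !JS -E1 -E2 -E3 d0 d1 y1 /= => K.
  have : h m r * (h m r * f1 r * nu 0 o0) = h m r * ((h m r)^-1 * nu 0 o1).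
    by congr (_ * _); move/eqP: K; rewrite !mul0r !mul1r !addr0 !mulrN !mulNr addrC subr_eq0 => /eqP ->; ring.
  move=> K2; transitivity (h m r * ((h m r)^-1 * nu 0 o1)); first by rewrite mulVKf.
  by rewrite -K2; ring.
have centre : r ^+ 2 * (4 * (1 + (0 ^+ 2 + 0 ^+ 2)) ^- 2) = 4 * r ^+ 2 by field.
have r4 : 4 * r ^+ 2 != 0 by rewrite mulf_neq0 // expf_neq0.
have n2E : nu 0 o2 = 0.
  have := orth crd1; rewrite formE sum4 !rowJ J0 E1 E2 E3 !JS -E1 -E2 -E3 d2 y1 y2 y3 /=.
  by rewrite !mul0r !mul1r ?add0r ?addr0 centre => /eqP; rewrite mulf_eq0 (negbTE r4) => /eqP.
have n3E : nu 0 o3 = 0.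
  have := orth crd2; rewrite formE sum4 !rowJ J0 E1 E2 E3 !JS -E1 -E2 -E3 d3 y1 y2 y3 /=.
  by rewrite !mul0r !mul1r ?add0r ?addr0 centre => /eqP; rewrite mulf_eq0 (negbTE r4) => /eqP.
have nuE : nu 0 o0 ^+ 2 * h m r ^+ 2 * W = 1.
  move: norm; rewrite formE sum4 n2E n3E n1E d0 d1 y1 !mulr0 !addr0 => N.
  by rewrite -[RHS]opprK -N /W; field.
exists (nu 0 o0); split=> //.
  by rewrite (_ : o0 = 0) //; exact/val_inj.
have cov0 i : cov_hess (gSch_chart m b) F i i (x_ r) 0 o0
    = (i == crd0)%:R * (f2 r + f1 r * Dh r / h m r).
  have -> : cov_hess (gSch_chart m b) F i i (x_ r) 0 o0 =
      partials [:: i; i] (fun z => F z 0 o0) (x_ r)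
      + \sum_c \sum_l christoffel (gSch_chart m b) o0 c l y
          * jac F (x_ r) i c * jac F (x_ r) i l by rewrite [LHS]mxE.
  have -> : partials [:: i; i] (fun z => F z 0 o0) (x_ r) = (i == crd0)%:R * f2 r.
    rewrite /partials /=.
    have P (z : 'rV[R]_(1 + 2)) : 2 * m < z 0 0 ->
        partial i (fun z => F z 0 o0) z = (i == crd0)%:R * f1 (z 0 0).
      move=> mz; have -> : (fun z => F z 0 o0) = (fun z : 'rV[R]_(1 + 2) => f (z 0 0)).
        apply/funext => w; rewrite /F /graph (_ : o0 = lshift _ 0) ?row_mxEl ?mxE ?mulr1n //.
        exact/val_inj.
      apply: der_partial; eapply is_derive_eq.
        apply: der_comp; first exact: (derivableP (df _ mz).1).
        exact: der_coord.
      rewrite mxE eqxx /= mulrC -/f1 /f1 derive1E.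
      by rewrite eq_sym; congr ((_ == _)%:R * _); apply/val_inj.
    have -> : partial i (partial i (fun z => F z 0 o0)) (x_ r)
        = partial i (fun z : 'rV[R]_(1 + 2) => (i == crd0)%:R * f1 (z 0 0)) (x_ r).
      apply: near_eq_derive; apply: (near_open oU3 _ P).
      by rewrite /= x0.
    have D2 : is_derive (x_ r 0 0) 1 f1 (f2 r).
      by rewrite x0 /f2 derive1E; exact: (derivableP dfr1).
    apply: der_partial; eapply is_derive_eq.
      eapply derM; [eapply derC|eapply der_comp; [exact: D2|eapply der_coord]].
    rewrite mxE eqxx /= mul0r add0r; case: (i =P crd0) => [->|]; last by rewrite !mul0r.
    by rewrite (_ : (0 == crd0) = true) ?mulr1.
  rewrite sum4 !sum4 !christoffelE // y1 d0 y1 E1 E2 E3 !JS !J0 -E1 -E2 -E3 /=.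
  by elim/ord3P: i => /=; field; rewrite H'.
have cov1 i : cov_hess (gSch_chart m b) F i i (x_ r) 0 o1
    = if i == crd0 then h m r * Dh r * f1 r ^+ 2 / 2 - Dh r / (2 * h m r)
      else - 4 * r * h m r.
  have -> : cov_hess (gSch_chart m b) F i i (x_ r) 0 o1 =
      partials [:: i; i] (fun z => F z 0 o1) (x_ r)
      + \sum_c \sum_l christoffel (gSch_chart m b) o1 c l y
          * jac F (x_ r) i c * jac F (x_ r) i l by rewrite [LHS]mxE.
  have -> : partials [:: i; i] (fun z => F z 0 o1) (x_ r) = 0.
    rewrite /partials /=.
    have -> : partial i (fun z => F z 0 o1) = fun=> (i == crd0)%:R.
      apply/funext => z; rewrite -(partial_coord i crd0 z); congr (partial _ _ _).
      by apply/funext => w; rewrite E1 /F /graph row_mxEr.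
    by apply: der_partial; exact: derC.
  rewrite sum4 !sum4 !christoffelE // y1 d1 y1 E1 E2 E3 !JS !J0 -E1 -E2 -E3 /=.
  by elim/ord3P: i => /=; field; rewrite H'.
rewrite /mean_curvature PBe invmx_diag; last first.
  by elim/ord3P; rewrite ?e0 ?e1 ?e2.
rewrite mul_diag_mx /mxtrace sum3 !mxE e0 e1 e2 !formE !sum4 !cov0 !cov1.
rewrite n2E n3E n1E d0 d1 y1 /=.
rewrite !mulr0 !addr0; congr (_ * _).
move: W W0' (nu 0 o0) (f2 r) (f1 r) (Dh r) (h m r) H' {PB W0 e0 n1E nuE cov0 cov1} => {}W W0'.
move=> n0 a2 a1 dh hr hr0.
by field; rewrite W0' hr0 r0'.
Qed.

End MeanCurvature.

Section FirstIntegral.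
Context {R : realType}.

Lemma eq_of_der0 (F : R -> R) (a x y : R) :
  (forall r, a < r -> is_derive r 1 F 0) -> a < x -> a < y -> F x = F y.
Proof.
move=> dF; wlog xy : x y / x <= y.
  by move=> H ax ay; case: (leP x y) => [/H|/ltW /H] E; [|symmetry]; exact: E.
move=> ax ay; apply/eqP; rewrite eq_sym -subr_eq0; apply/eqP.
have [||c _ ->] := @MVT_segment R F (fun=> 0) x y xy; last by rewrite mul0r.
  by move=> z; rewrite in_itv /= => /andP[xz _]; apply: dF; exact: lt_trans xz.
apply: derivable_within_continuous => z; rewrite in_itv /= => /andP[xz _].
by have [] := dF z (lt_le_trans ax xz).
Qed.

Variables (m : R) (f : R -> R).
Hypothesis m0 : 0 <= m.
Hypothesis hf : SSCMC m 1 f.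

Let f1 : R -> R := f^`()%classic.
Let f2 : R -> R := f1^`()%classic.
Let W r := (h m r)^-1 - h m r * f1 r ^+ 2.

Let df1 r : 2 * m < r -> is_derive r 1 f1 (f2 r).
Proof. by move=> mr; rewrite /f2 derive1E; exact: (derivableP (hf.1 r mr).2). Qed.

Let mean_curvature_ode r : 2 * m < r -> 0 < W r /\
  (f2 r + 3 * f1 r * (2 * m / r ^+ 2) / (2 * h m r)
    - h m r * (2 * m / r ^+ 2) * f1 r ^+ 3 / 2) / (W r * Num.sqrt (W r))
  + 2 * (h m r * f1 r / Num.sqrt (W r)) / r = 3.
Proof.
move=> mr; have H := h_gt0 m0 mr.
have x0 : (row_mx r%:M 0 : 'rV[R]_(1 + 2)) 0 0 = r.
  by rewrite (_ : (0 : 'I_(1 + 2)) = lshift 2 0) ?row_mxEl ?mxE ?mulr1n //; exact/val_inj.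
have [pd [nu [fun_nu mc]]] : posdef (pullback (@graph R f 2) (gSch_chart m false) (row_mx r%:M 0))
    /\ exists nu, future_unit_normal (gSch_chart m false) (@graph R f 2) (row_mx r%:M 0) nu
      /\ mean_curvature (gSch_chart m false) (@graph R f 2) nu (row_mx r%:M 0) = 1.
  by apply: hf.2; rewrite x0.
have [n0 [n0pos posW n0E mcE]] := mean_curvature_graph m0 mr hf.1 pd fun_nu.
have W0 : 0 < W r := posW.
split; first exact: W0.
have sW : 0 < Num.sqrt (W r) by rewrite sqrtr_gt0.
have WE : W r = Num.sqrt (W r) ^+ 2 by rewrite sqr_sqrtr // ltW.
have nE : n0 = (h m r * Num.sqrt (W r))^-1.
  have P : 0 < n0 * h m r * Num.sqrt (W r) by rewrite !mulr_gt0.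
  have : n0 * h m r * Num.sqrt (W r) = 1.
    apply/eqP; rewrite -(@eqrXn2 _ 2) ?expr1n ?ltW // !exprMn -WE; exact/eqP.
  move=> E; apply: (mulIf (lt0r_neq0 (mulr_gt0 H sW))).
  by rewrite mulVf ?mulrA // lt0r_neq0 // mulr_gt0.
have := mc; rewrite mcE nE -/f1 -/f2 -/(W r) => E.
have r0 : r != 0 by rewrite gt_eqF // (le_lt_trans _ mr) // mulr_ge0.
have := congr1 (fun z => 3 * z) E; rewrite /= mulr1 mulVKf // => {}E.
rewrite -[RHS]E.
move: (W r) W0 (Num.sqrt (W r)) sW (h m r) H (f1 r) (f2 r) {E nE WE mcE n0E posW} r0.
move=> w w0 s s0 k k0 a b r0.
have wz : w != 0 by rewrite gt_eqF.
have sz : s != 0 by rewrite gt_eqF.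
have kz : k != 0 by rewrite gt_eqF.
by field; rewrite wz sz kz r0.
Qed.

(** The mean curvature equation has divergence form in the radial variable:
    with rho = h f' / sqrt (1/h - h f'^2), the radial component of the unit
    normal, it reads (r^2 rho)' = 3 r^2. *)
Lemma SSCMC_first_integral : exists c : R, forall r, 2 * m < r ->
  [/\ derivable f r 1, 0 < h m r + (r + c / r ^+ 2) ^+ 2 &
  (h m r)^-1 + - h m r * f^`()%classic r ^+ 2
    = (h m r + (r + c / r ^+ 2) ^+ 2)^-1].
Proof.
pose rho r := h m r * f1 r / Num.sqrt (W r).
pose C r := r ^+ 2 * rho r - r ^+ 3.
have dC r : 2 * m < r -> is_derive r 1 C 0.
  move=> mr; have [W0 E] := mean_curvature_ode mr.
  have r0 : r != 0 by rewrite gt_eqF // (le_lt_trans _ mr) // mulr_ge0.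
  have H := h_gt0 m0 mr; have H' : h m r != 0 by rewrite gt_eqF.
  have dh := der_lapse m r0; have d1 := df1 mr.
  have sW : Num.sqrt (W r) != 0 by rewrite gt_eqF // sqrtr_gt0.
  have dW : is_derive r 1 W (- (h m r ^- 2 * (2 * m / r ^+ 2))
      - (2 * m / r ^+ 2 * f1 r ^+ 2 + h m r * (2 * f1 r * f2 r))).
    rewrite /W; eapply is_derive_eq; first by der.
    by rewrite /= ?expr1; ring.
  have dsW : is_derive r 1 (fun y => Num.sqrt (W y)) _ := der_sqrt W0 dW.
  rewrite /C /rho; eapply is_derive_eq; first by der.
  rewrite /= ?expr1 ?mulr1.
  have WE : W r = Num.sqrt (W r) ^+ 2 by rewrite sqr_sqrtr // ltW.
  have Wh : h m r * W r = 1 - h m r ^+ 2 * f1 r ^+ 2 by rewrite /W; field.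
  set s := Num.sqrt (W r) in E WE sW *; rewrite WE in E Wh.
  move: E Wh; move: s sW {WE} => s s0.
  move: (2 * m / r ^+ 2) (h m r) H' (f1 r) (f2 r).
  move=> dh' k k0 a b E Wh.
  have S : s^-1 = (1 - k ^+ 2 * a ^+ 2) / (k * s ^+ 3).
    by rewrite -Wh; field; rewrite s0 k0.
  have key : (dh' * a + k * b) * s^-1
      + k * a / (2 * s ^+ 3) * (dh' / k ^+ 2 + dh' * a ^+ 2 + 2 * k * a * b)
      = (b + 3 * a * dh' / (2 * k) - k * dh' * a ^+ 3 / 2) / (s ^+ 2 * s).
    by rewrite S; field; rewrite s0 k0.
  transitivity (r ^+ 2 * ((dh' * a + k * b) * s^-1
      + k * a / (2 * s ^+ 3) * (dh' / k ^+ 2 + dh' * a ^+ 2 + 2 * k * a * b))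
      + 2 * r * (k * a / s) - 3 * r ^+ 2).
    by field; rewrite s0 k0.
  rewrite key.
  transitivity (r ^+ 2 * ((b + 3 * a * dh' / (2 * k) - k * dh' * a ^+ 3 / 2)
     / (s ^+ 2 * s) + 2 * (k * a / s) / r - 3)); first by field; rewrite s0 k0 r0.
  by rewrite E subrr mulr0.
pose c := C (2 * m + 1).
exists c => r mr; have [W0 _] := mean_curvature_ode mr.
have r0 : r != 0 by rewrite gt_eqF // (le_lt_trans _ mr) // mulr_ge0.
have H := h_gt0 m0 mr; have H' : h m r != 0 by rewrite gt_eqF.
have cE : r + c / r ^+ 2 = rho r.
  rewrite /c (_ : C (2 * m + 1) = C r); last first.
    by apply: (eq_of_der0 dC) => //; rewrite ltrDl.
  by rewrite /C; field.
have WE : W r = (h m r + rho r ^+ 2)^-1.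
  have sW : Num.sqrt (W r) != 0 by rewrite gt_eqF // sqrtr_gt0.
  have Wz : W r != 0 by rewrite gt_eqF.
  rewrite /rho !exprMn exprVn sqr_sqrtr ?ltW //; apply: invr_inj; rewrite invrK.
  have Wh : h m r * W r = 1 - h m r ^+ 2 * f1 r ^+ 2 by rewrite /W; field.
  apply: (mulIf Wz); rewrite mulVf // mulrDl Wh mulfVK //; ring.
split.
- exact: (hf.1 r mr).1.
- by rewrite cE ltr_pwDl // sqr_ge0.
- by rewrite cE -WE /W mulNr.
Qed.

End FirstIntegral.

(** * The inverse hyperbolic tangent *)

Section Artanh.
Context {R : realType}.
Implicit Types (F G : R -> R) (x t : R).

Lemma cont0_linear G (C d : R) : 0 < d ->
  (forall x, - d < x < d -> `|G x| <= C * `|x|) -> {for 0, continuous G}.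
Proof.
move=> d0 H.
have z : - d < 0 < d by rewrite oppr_lt0 d0.
have G0 : G 0 = 0 by have := H 0 z; rewrite normr0 mulr0 normr_le0 => /eqP.
have C1 : 0 < `|C| + 1 by rewrite ltr_wpDl.
apply/cvgrPdist_lt => eps eps0; rewrite G0.
apply/nbhs_ballP; exists (Num.min d (eps / (`|C| + 1))) => /=.
  by rewrite lt_min d0 divr_gt0.
move=> x; rewrite /ball /= !sub0r !normrN lt_min => /andP[xd xe].
apply: le_lt_trans (H x _) _; first by rewrite -ltr_norml.
apply: (@le_lt_trans _ _ ((`|C| + 1) * `|x|)); last by rewrite mulrC -ltr_pdivlMr.
by rewrite ler_wpM2r // (le_trans (ler_norm C)) // lerDl.
Qed.

Lemma der0_quadratic F (C d : R) : 0 < d ->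
  (forall x, - d < x < d -> `|F x| <= C * x ^+ 2) -> is_derive (0 : R) 1 F 0.
Proof.
move=> d0 H.
have z : - d < 0 < d by rewrite oppr_lt0 d0.
have F0 : F 0 = 0 by have := H 0 z; rewrite expr0n mulr0 normr_le0 => /eqP.
apply/is_derive1_caratheodory; exists (fun x => F x / x); split.
- move=> x; rewrite F0 !subr0; have [->|x0] := eqVneq x 0; first by rewrite F0 mulr0.
  by rewrite mulfVK.
- apply: (@cont0_linear _ C d d0) => x xd.
  have [->|x0] := eqVneq x 0; first by rewrite F0 mul0r normr0 mulr0.
  rewrite normrM normfV ler_pdivrMr ?normr_gt0 // -mulrA -expr2 -normrX [`|x ^+ 2|]ger0_norm ?sqr_ge0 //.
  exact: H.
- by rewrite F0 mul0r.
Qed.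

(** Twice the inverse hyperbolic tangent. *)
Definition artanh2 t : R := ln ((1 + t) / (1 - t)).

Lemma artanh2_0 : artanh2 0 = 0.
Proof. by rewrite /artanh2 addr0 subr0 divr1 ln1. Qed.

Lemma artanh2_arg t : - 1 < t < 1 -> 0 < (1 + t) / (1 - t).
Proof. by move=> /andP[t1 t2]; rewrite divr_gt0 ?subr_gt0 // -ltrBlDl sub0r. Qed.

Lemma one_sub_sqr t : - 1 < t < 1 -> 0 < 1 - t ^+ 2.
Proof.
move=> /andP[t1 t2]; rewrite (_ : 1 - t ^+ 2 = (1 - t) * (1 + t)); last by ring.
by rewrite mulr_gt0 ?subr_gt0 // -ltrBlDl sub0r.
Qed.

Lemma der_artanh2 t : - 1 < t < 1 -> is_derive t 1 artanh2 (2 / (1 - t ^+ 2)).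
Proof.
move=> ht; have A := artanh2_arg ht; have B := one_sub_sqr ht.
have t1 : 1 - t != 0 by case/andP: ht => _ ?; rewrite gt_eqF ?subr_gt0.
have t2 : 1 + t != 0 by case/andP: ht => ? _; rewrite gt_eqF // -ltrBlDl sub0r.
have t3 : 1 - t ^+ 2 != 0 by rewrite gt_eqF.
rewrite /artanh2; eapply is_derive_eq; first by der.
by rewrite /=; field; rewrite t1 t2 t3.
Qed.

Let rem t : R := artanh2 t - 2 * t - 2 / 3 * t ^+ 3.

Let der_rem t : - 1 < t < 1 -> is_derive t 1 rem (2 * t ^+ 4 / (1 - t ^+ 2)).
Proof.
move=> ht; have D := der_artanh2 ht; have B := one_sub_sqr ht.
have t3 : 1 - t ^+ 2 != 0 by rewrite gt_eqF.
rewrite /rem; eapply is_derive_eq; first by der.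
by rewrite /=; field.
Qed.

Let rem0 : rem 0 = 0.
Proof. by rewrite /rem artanh2_0 expr0n !mulr0 !subr0. Qed.

Let rem_bound t : - 2^-1 < t < 2^-1 -> `|rem t| <= 8 / 3 * `|t| ^+ 5.
Proof.
have H0 x y : `|x| < 2^-1 -> `|x| <= `|y| -> `|2 * x ^+ 4 / (1 - x ^+ 2)| <= 8 / 3 * `|y| ^+ 4.
  move=> x1 xy.
  have x2 : x ^+ 2 <= 4^-1.
    have -> : (4^-1 : R) = 2^-1 ^+ 2 by field.
    by rewrite -[x ^+ 2]ger0_norm ?sqr_ge0 // normrX lerXn2r ?nnegrE // ?invr_ge0 // ltW.
  have d0 : 0 < 1 - x ^+ 2 by lra.
  rewrite normrM normfV (gtr0_norm d0) normrM normrX (gtr0_norm (_ : 0 < 2 :> R)) //.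
  rewrite ler_pdivrMr // -!mulrA.
  have X4 : `|x| ^+ 4 <= `|y| ^+ 4 by rewrite lerXn2r ?nnegrE.
  have Y4 : 0 <= `|y| ^+ 4 by rewrite exprn_ge0.
  nra.
move=> ht; have t1 : `|t| < 2^-1 by rewrite ltr_norml.
have in1 x : `|x| <= `|t| -> - 1 < x < 1.
  by move=> xt; rewrite -ltr_norml (le_lt_trans xt) // (lt_trans t1) // invf_lt1 // ltr1n.
have D x : `|x| <= `|t| -> is_derive x 1 rem (2 * x ^+ 4 / (1 - x ^+ 2)).
  by move=> /in1; exact: der_rem.
case: (ltgtP t 0) => [tn|tp|->]; last by rewrite rem0 !normr0 expr0n mulr0.
- have [||x] := @MVT R rem (fun x => 2 * x ^+ 4 / (1 - x ^+ 2)) t 0 tn.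
  + move=> x; rewrite in_itv /= => /andP[x0 xs]; apply: D.
    by rewrite !ltr0_norm // lerN2 ltW.
  + apply: derivable_within_continuous => x; rewrite in_itv /= => /andP[x0 xs].
    have dx : `|x| <= `|t| by rewrite !ler0_norm ?(ltW tn) // lerN2.
    by have [] := D x dx.
  rewrite in_itv /= rem0 !sub0r => /andP[x0 xs] E.
  rewrite -normrN E normrM normrN [in leRHS]exprSr [leRHS]mulrA ler_wpM2r // H0 //.
    by rewrite !ltr0_norm // in t1 *; rewrite (lt_trans _ t1) // ltrN2.
  by rewrite !ltr0_norm // lerN2 ltW.
- have [||x] := @MVT R rem (fun x => 2 * x ^+ 4 / (1 - x ^+ 2)) 0 t tp.
  + move=> x; rewrite in_itv /= => /andP[x0 xs]; apply: D.
    by rewrite !gtr0_norm // ltW.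
  + apply: derivable_within_continuous => x; rewrite in_itv /= => /andP[x0 xs].
    have dx : `|x| <= `|t| by rewrite !ger0_norm ?(ltW tp).
    by have [] := D x dx.
  rewrite in_itv /= rem0 !subr0 => /andP[x0 xs] E.
  rewrite E normrM [in leRHS]exprSr [leRHS]mulrA ler_wpM2r // H0 //.
    by rewrite !gtr0_norm // in t1 *; rewrite (lt_trans _ t1).
  by rewrite !gtr0_norm // ltW.
Qed.

(** Division by zero being zero, all these quotients vanish at 0. *)
Let Wq j t : R := rem t / t ^+ j.

Let Wq_bound j t : (j <= 5)%N -> - 2^-1 < t < 2^-1 ->
  `|Wq j t| <= 8 / 3 * `|t| ^+ (5 - j).
Proof.
move=> j5 ht; have [->|t0] := eqVneq t 0.
  by rewrite /Wq rem0 mul0r normr0 mulr_ge0 ?divr_ge0 // exprn_ge0.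
rewrite /Wq normrM normfV normrX ler_pdivrMr ?exprn_gt0 ?normr_gt0 //.
by rewrite -(mulrA (8 / 3)) -exprD subnK // rem_bound.
Qed.

Let half0 : 0 < 2^-1 :> R. Proof. by rewrite invr_gt0. Qed.

Let der_Wq j t : (0 < j < 4)%N -> - 1 < t < 1 ->
  is_derive t 1 (Wq j) (2 * t ^+ (4 - j) / (1 - t ^+ 2) - j%:R * Wq j.+1 t).
Proof.
move=> /andP[j0 j4] ht; have [->|t0] := eqVneq t 0.
  rewrite /Wq rem0 mul0r mulr0 subr0 expr0n subn_eq0 leqNgt j4 mulr0 mul0r.
  apply: (@der0_quadratic _ (8 / 3) 2^-1 half0) => x hx.
  apply: le_trans (Wq_bound (ltnW (leqW j4)) hx) _.
  rewrite ler_wpM2l ?divr_ge0 // -[x ^+ 2]ger0_norm ?sqr_ge0 // normrX.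
  rewrite ler_wiXn2l //.
    by move: hx; rewrite -ltr_norml => /ltW /le_trans; apply; rewrite invf_le1 // ler1n.
  by move: j0 j4; case: j => [|[|[|[|j]]]].
have D := der_rem ht; have tj : t ^+ j != 0 by rewrite expf_neq0.
have B := one_sub_sqr ht; have t3 : 1 - t ^+ 2 != 0 by rewrite gt_eqF.
rewrite /Wq; eapply is_derive_eq; first by der.
move: j0 j4 {tj}; case: j => [|[|[|[|j]]]] //= _ _;
  rewrite ?subn1 ?subn2 ?subn3 /=; by field; rewrite t0 t3.
Qed.

Let cont_Wq4 t : - 1 < t < 1 -> {for t, continuous (Wq 4)}.
Proof.
move=> ht; have [->|t0] := eqVneq t 0.
  apply: (@cont0_linear _ (8 / 3) 2^-1 half0) => x hx.
  by have := Wq_bound (isT : (4 <= 5)%N) hx; rewrite subSnn expr1.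
have D := der_rem ht; have tj : t ^+ 4 != 0 by rewrite expf_neq0.
by eapply der_cont; rewrite /Wq; der.
Qed.

(** The function 2 artanh t / t, with the value 2 at 0. Its Taylor polynomial is
    split off so that the rest can be differentiated three times at 0 by hand. *)
Definition artanh_quot t : R := 2 + 2 / 3 * t ^+ 2 + Wq 1 t.

Lemma artanh_quotE t : artanh2 t = t * artanh_quot t.
Proof.
have [->|t0] := eqVneq t 0; first by rewrite artanh2_0 mul0r.
by rewrite /artanh_quot /Wq /rem; field.
Qed.

Lemma artanh_quot0 : artanh_quot 0 = 2.
Proof. by rewrite /artanh_quot /Wq rem0 mul0r expr0n mulr0 !addr0. Qed.

(** Each division by t costs one order of vanishing and one derivative: the rest
    of 2 artanh t after its cubic Taylor polynomial is of order t^5, so that its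
    quotient by t^4 is still continuous. *)
Lemma Ck_artanh_quot n (U : set 'rV[R]_n) (phi : 'rV[R]_n -> R) : open U ->
  (forall y, U y -> - 1 < phi y < 1) -> Ck 3 U phi ->
  Ck 3 U (fun y => artanh_quot (phi y)).
Proof.
move=> oU hphi C3; have C2 := CkW C3; have C1 := CkW C2.
have step k j : (0 < j < 4)%N -> Ck k.+1 U phi -> Ck k U (fun y => Wq j.+1 (phi y)) ->
    Ck k.+1 U (fun y => Wq j (phi y)).
  move=> j4 A B.
  pose dW t := 2 * t ^+ (4 - j) / (1 - t ^+ 2) - j%:R * Wq j.+1 t.
  apply: (@Ck_comp _ _ k U (Wq j) dW phi oU) => //.
    by move=> y Uy; apply: der_Wq => //; exact: hphi.
  have A' := CkW A; rewrite /dW; ck => y Uy.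
  by rewrite gt_eqF // one_sub_sqr // hphi.
have W4 : Ck 0 U (fun y => Wq 4 (phi y)).
  by apply: Ck_comp0; [move=> y Uy; apply: cont_Wq4; exact: hphi|exact: CkW].
have W3 : Ck 1 U (fun y => Wq 3 (phi y)) := step 0 3 isT C1 W4.
have W2 : Ck 2 U (fun y => Wq 2 (phi y)) := step 1 2 isT C2 W3.
have W1 : Ck 3 U (fun y => Wq 1 (phi y)) := step 2 1 isT C3 W2.
by rewrite /artanh_quot; ck.
Qed.

End Artanh.

(** * Orders of vanishing at the boundary *)

Section Antiderivative.
Context {R : realType}.
Implicit Types (g G : R -> R).

Lemma antiderivative g (e : R) : 0 < e ->
  (forall s, -e <= s <= e -> {for s, continuous g}) ->
  exists G, G 0 = 0 /\ forall s, - e < s < e -> is_derive s 1 G (g s).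
Proof.
move=> e0 cg.
pose F x : R := (\int[lebesgue_measure]_(t in [set` Interval (BLeft (- e)) (BRight x)]) g t)%R.
exists (fun x => F x - F 0); split; first by rewrite subrr.
move=> s /andP[es se].
have Ig : lebesgue_measure.-integrable [set` Interval (BLeft (- e)) (BRight e)] (EFin \o g).
  apply: continuous_compact_integrable; first exact: segment_compact.
  apply: continuous_in_subspaceT => x; rewrite inE /= in_itv /=; exact: cg.
have cs : {for s, continuous g} by apply: cg; rewrite !ltW.
have [d1 d2] := @continuous_FTC1 R g (BLeft (- e)) s e se Ig es cs.
have dF : is_derive s 1 F (g s).
  by split; [exact: d1|rewrite -derive1E; exact: d2].
eapply is_derive_eq; first (eapply derD; [exact: dF|eapply derN; eapply derC]).
by rewrite oppr0 addr0.
Qed.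

End Antiderivative.

Section RadialFunctions.
Context {R : realType}.
Implicit Types (F G : R -> R).

(** A function of one variable is handled through its lift to the slab. *)
Definition lift F : 'rV[R]_(1 + 2) -> R := fun x => F (x 0 0).

Lemma coord_delta (h : R) (x : 'rV[R]_(1 + 2)) :
  (h *: (delta_mx 0 0 : 'rV[R]_(1 + 2)) + x) 0 0 = h + x 0 0.
Proof. by rewrite !mxE /= mulr1. Qed.

Lemma partial_lift F x : partial 0 (lift F) x = 'D_1 F (x 0 0).
Proof.
rewrite /partial /derive; set u1 := fun h => _; set u2 := fun h => _.
suff -> : u1 = u2 by [].
by apply/funext => h; rewrite /u1 /u2 /lift /= coord_delta [h%:A]mulr1.
Qed.

Lemma derivable_lift F x :
  derivable (lift F) x (delta_mx 0 0) -> derivable F (x 0 0) 1.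
Proof.
rewrite /derivable; set u1 := fun h => _; set u2 := fun h => _.
suff -> : u1 = u2 by [].
by apply/funext => h; rewrite /u1 /u2 /lift /= coord_delta [h%:A]mulr1.
Qed.

Variable e : R.
Definition smooth1 F := smooth (slab (- e) e) (lift F).

(** The lift of a function depends on the first coordinate alone, so that its
    partial derivative is the lift of the derivative. *)
Lemma smooth1_der F : smooth1 F ->
  (forall s, - e < s < e -> is_derive s 1 F ('D_1 F s)) /\ smooth1 ('D_1 F).
Proof.
move=> sF; split.
  move=> s se; apply: derivableP.
  pose x : 'rV[R]_(1 + 2) := s *: delta_mx 0 0.
  have xs : x 0 0 = s by rewrite !mxE /= mulr1.
  rewrite -xs; apply: derivable_lift.
  by have [_ /(_ 0) [H _]] := sF 1%N; apply: H; rewrite /slab /= xs.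
move=> k; have [_ /(_ 0) [_ H]] := sF k.+1.
apply: Ck_eq H; first exact: open_slab.
by move=> x _; rewrite partial_lift.
Qed.

End RadialFunctions.

Lemma sum3_ge (R : numDomainType) (x y z : R) : 0 <= x -> 0 <= y -> 0 <= z ->
  let w := x + 1 + (y + 1) + (z + 1) in [/\ x + 1 <= w, y + 1 <= w & z + 1 <= w].
Proof.
move=> x0 y0 z0 w; have [x1 y1 z1] : [/\ 0 <= x + 1, 0 <= y + 1 & 0 <= z + 1].
  by rewrite !addr_ge0.
by rewrite /w -addrA lerDl addr_ge0 // addrCA lerDl addr_ge0 // addrA lerDr addr_ge0.
Qed.

Section VanishingOrder.
Context {R : realType}.
Implicit Types (F G : R -> R) (j k : nat).

(** F = O(s^k) as s tends to 0 from above, in a form that can be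
    differentiated twice. *)
Definition Ord k F := exists F1 F2 : R -> R, exists C d : R, 0 < d /\
  forall s, 0 < s < d -> [/\ is_derive s 1 F (F1 s), is_derive s 1 F1 (F2 s),
    `|F s| <= C * s ^+ k, s * `|F1 s| <= C * s ^+ k
    & s ^+ 2 * `|F2 s| <= C * s ^+ k].

Lemma open_Ioo (x y : R) : open [set s : R | x < s < y].
Proof.
rewrite (_ : [set s | _] = `]x, y[%classic); first exact: interval_open.
by apply/seteqP; split=> s /=; rewrite in_itv.
Qed.

Lemma near_Ioo (x y s : R) (P : R -> Prop) : x < s < y ->
  (forall t, x < t < y -> P t) -> \near s, P s.
Proof.
move=> xsy H; have := open_nbhs_nbhs (conj (@open_Ioo x y) (xsy : [set s : R | x < s < y] s)).
by apply: filterS => t; exact: H.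
Qed.

Lemma Ord_eq k F G (d : R) : 0 < d -> (forall s, 0 < s < d -> F s = G s) ->
  Ord k F -> Ord k G.
Proof.
move=> d0 FG [F1 [F2 [C [c [c0 H]]]]]; exists F1, F2, C, (Num.min c d).
rewrite lt_min c0; split=> // s; rewrite lt_min => /and3P[s0 sc sd].
have [h1 h2 h3 h4 h5] := H s (introT andP (conj s0 sc)); split=> //.
  apply: der_near h1; apply: (near_Ioo (introT andP (conj s0 sd))); exact: FG.
by rewrite -FG // s0.
Qed.

Lemma OrdD k F G : Ord k F -> Ord k G -> Ord k (fun s => F s + G s).
Proof.
move=> [F1 [F2 [C [c [c0 H]]]]] [G1 [G2 [B [d [d0 K]]]]].
exists (fun s => F1 s + G1 s), (fun s => F2 s + G2 s), (C + B), (Num.min c d).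
rewrite lt_min c0; split=> // s; rewrite lt_min => /and3P[s0 sc sd].
have [h1 h2 h3 h4 h5] := H s (introT andP (conj s0 sc)).
have [k1 k2 k3 k4 k5] := K s (introT andP (conj s0 sd)).
split; try exact: derD.
- by rewrite mulrDl (le_trans (ler_normD _ _)) // lerD.
- rewrite mulrDl (le_trans (ler_wpM2l (ltW s0) (ler_normD _ _))) // mulrDr lerD //.
- rewrite mulrDl (le_trans (ler_wpM2l (sqr_ge0 s) (ler_normD _ _))) // mulrDr lerD //.
Qed.

Lemma OrdM j k F G : Ord j F -> Ord k G -> Ord (j + k) (fun s => F s * G s).
Proof.
move=> [F1 [F2 [C [c [c0 H]]]]] [G1 [G2 [B [d [d0 K]]]]].
exists (fun s => F1 s * G s + F s * G1 s),
  (fun s => F2 s * G s + F1 s * G1 s + (F1 s * G1 s + F s * G2 s)), (4 * (C * B)), (Num.min c d).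
rewrite lt_min c0; split=> // s; rewrite lt_min => /and3P[s0 sc sd].
have [h1 h2 h3 h4 h5] := H s (introT andP (conj s0 sc)).
have [k1 k2 k3 k4 k5] := K s (introT andP (conj s0 sd)).
have M (x y : R) : `|x| <= C * s ^+ j -> `|y| <= B * s ^+ k ->
    `|x * y| <= C * B * s ^+ (j + k).
  by move=> hx hy; rewrite normrM exprD mulrACA ler_pM.
have N1 (x : R) : `|s * x| = s * `|x| by rewrite normrM gtr0_norm.
have N2 (x : R) : `|s ^+ 2 * x| = s ^+ 2 * `|x| by rewrite normrM ger0_norm ?sqr_ge0.
have P0 : 0 <= C * B * s ^+ (j + k).
  exact: le_trans (normr_ge0 _) (M _ _ h3 k3).
split; try (by eapply derM); first last.
- rewrite -N2 (_ : s ^+ 2 * _ = s ^+ 2 * F2 s * G s + s * F1 s * (s * G1 s)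
    + (s * F1 s * (s * G1 s) + F s * (s ^+ 2 * G2 s))); last by ring.
  have q1 : `|s ^+ 2 * F2 s * G s| <= C * B * s ^+ (j + k) by apply: M; rewrite ?N2.
  have q2 : `|s * F1 s * (s * G1 s)| <= C * B * s ^+ (j + k) by apply: M; rewrite ?N1.
  have q3 : `|F s * (s ^+ 2 * G2 s)| <= C * B * s ^+ (j + k) by apply: M; rewrite ?N2.
  rewrite (_ : 4 * (C * B) * _ = (C * B * s ^+ (j + k) + C * B * s ^+ (j + k))
     + (C * B * s ^+ (j + k) + C * B * s ^+ (j + k))); last by ring.
  by rewrite (le_trans (ler_normD _ _)) // lerD // (le_trans (ler_normD _ _)) // lerD.
- rewrite -N1 (_ : s * _ = s * F1 s * G s + F s * (s * G1 s)); last by ring.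
  have q2 : `|s * F1 s * G s| <= C * B * s ^+ (j + k) by apply: M; rewrite ?N1.
  have q3 : `|F s * (s * G1 s)| <= C * B * s ^+ (j + k) by apply: M; rewrite ?N1.
  have : C * B * s ^+ (j + k) + C * B * s ^+ (j + k) <= 4 * (C * B) * s ^+ (j + k) by lra.
  by apply: le_trans; rewrite (le_trans (ler_normD _ _)) // lerD.
- have := M _ _ h3 k3; lra.
- eapply is_derive_eq; first by der.
  ring.
Qed.

Lemma OrdW j k F : (k <= j)%N -> Ord j F -> Ord k F.
Proof.
move=> kj [F1 [F2 [C [c [c0 H]]]]]; exists F1, F2, C, (Num.min c 1).
rewrite lt_min c0 ltr01; split=> // s; rewrite lt_min => /and3P[s0 sc s1].
have [h1 h2 h3 h4 h5] := H s (introT andP (conj s0 sc)).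
have C0 : 0 <= C.
  have := le_trans (normr_ge0 _) h3; rewrite pmulr_lge0 // exprn_gt0 //.
have L : C * s ^+ j <= C * s ^+ k by rewrite ler_wpM2l // ler_wiXn2l // ltW.
by split=> //; exact: le_trans L.
Qed.

Lemma Ord_cst (c : R) : Ord 0 (fun=> c).
Proof.
exists (fun=> 0), (fun=> 0), `|c|, 1; split=> // s _.
by split; try exact: derC; rewrite ?normr0 ?mulr0 ?mulr1.
Qed.

Lemma OrdZ k (c : R) F : Ord k F -> Ord k (fun s => c * F s).
Proof. exact: (OrdM (Ord_cst c)). Qed.

Lemma Ord_id : Ord 1 (fun s => s).
Proof.
exists (fun=> 1), (fun=> 0), 1, 1; split=> // s /andP[s0 _].
split; [exact: der_id|exact: derC| | |].
- by rewrite mul1r expr1 gtr0_norm.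
- by rewrite normr1 mulr1 mul1r expr1.
- by rewrite normr0 mulr0 mul1r expr1 ltW.
Qed.

Lemma OrdX k : Ord k (fun s => s ^+ k).
Proof.
elim: k => [|k IH]; first exact: Ord_cst.
by apply: Ord_eq (OrdM Ord_id IH) => // s _; rewrite exprS.
Qed.

(** The bound on F itself is the mean value theorem on [0, s]. *)
Lemma Ord_int k F G (d : R) : 0 < d -> F 0 = 0 ->
  (forall s, - d < s < d -> is_derive s 1 F (G s)) -> Ord k G -> Ord k.+1 F.
Proof.
move=> d0 F0 dF [G1 [G2 [C [c [c0 H]]]]].
exists G, G1, C, (Num.min c d); rewrite lt_min c0; split=> // s.
rewrite lt_min => /and3P[s0 sc sd].
have [h1 h2 h3 h4 h5] := H s (introT andP (conj s0 sc)).
have md : - d < 0 by rewrite oppr_lt0.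
have C0 : 0 <= C.
  have := le_trans (normr_ge0 _) h3; rewrite pmulr_lge0 // exprn_gt0 //.
split=> //.
- by apply: dF; rewrite sd (lt_trans md).
- have [||x] := @MVT R F G 0 s s0.
  + by move=> x; rewrite in_itv /= => /andP[x0 xs]; apply: dF; rewrite (lt_trans md) ?(lt_trans xs).
  + apply: derivable_within_continuous => x; rewrite in_itv /= => /andP[x0 xs].
    by have [] := dF x; rewrite ?(lt_le_trans md) ?(le_lt_trans xs).
  rewrite in_itv /= F0 !subr0 => /andP[x0 xs] ->.
  have [_ _ g _ _] := H x (introT andP (conj x0 (lt_trans xs sc))).
  rewrite normrM (gtr0_norm s0) exprSr mulrA ler_wpM2r ?(ltW s0) //.
  apply: le_trans g _; rewrite ler_wpM2l // lerXn2r ?nnegrE ?ltW //.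
- by rewrite exprS mulrCA ler_wpM2l // ltW.
- by rewrite [in leRHS]exprS [leRHS]mulrCA expr2 -mulrA ler_wpM2l // ltW.
Qed.

Lemma cont_bounded F (e : R) : {for 0, continuous F} ->
  exists d, 0 < d /\ forall s, - d < s < d -> `|F s| <= `|F 0| + 1.
Proof.
move=> cF.
have : \forall s \near 0, `|F s| <= `|F 0| + 1.
  have /cvgrPdist_lt/(_ 1 ltr01) := cF; apply: filterS => s hs.
  have := ler_normB (F 0) (F 0 - F s); rewrite subKr => /le_trans; apply.
  by rewrite lerD2l ltW.
move=> /nbhs_ballP[d d0 H]; exists d; split=> // s sd.
by apply: H; rewrite /ball /= sub0r normrN ltr_norml.
Qed.

Lemma smooth1_Ord0 (e : R) F : 0 < e -> smooth1 e F -> Ord 0 F.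
Proof.
move=> e0 sF.
have [d1 s1] := smooth1_der sF; have [d2 s2] := smooth1_der s1.
have [d3 _] := smooth1_der s2.
have z : - e < 0 < e by rewrite oppr_lt0 e0.
have [a [a0 A]] := cont_bounded 0 (der_cont (d1 0 z)).
have [b [b0 B]] := cont_bounded 0 (der_cont (d2 0 z)).
have [c [c0 C]] := cont_bounded 0 (der_cont (d3 0 z)).
pose M := (`|F 0| + 1) + (`|'D_1 F 0| + 1) + (`|'D_1 ('D_1 F) 0| + 1).
exists ('D_1 F), ('D_1 ('D_1 F)), M, (Num.min (Num.min e 1) (Num.min a (Num.min b c))).
rewrite !lt_min e0 ltr01 a0 b0 c0; split=> // s.
rewrite !lt_min => /andP[s0 /and3P[/andP[se s1'] sa /andP[sb sc]]].
have ms (x : R) : 0 < x -> - x < s by move=> x0; rewrite (lt_trans _ s0) // oppr_lt0.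
have hA := A s (introT andP (conj (ms _ a0) sa)).
have hB := B s (introT andP (conj (ms _ b0) sb)).
have hC := C s (introT andP (conj (ms _ c0) sc)).
have n0 := normr_ge0 (F 0); have n1 := normr_ge0 ('D_1 F 0).
have n2 := normr_ge0 ('D_1 ('D_1 F) 0).
have [M0 M1 M2] := sum3_ge n0 n1 n2.
split; rewrite ?expr0 ?mulr1.
- by apply: d1; rewrite ms.
- by apply: d2; rewrite ms.
- exact: le_trans hA M0.
- apply: (@le_trans _ _ `|'D_1 F s|); last exact: le_trans hB M1.
  by rewrite ler_piMl ?normr_ge0 ?ltW.
- apply: (@le_trans _ _ `|'D_1 ('D_1 F) s|); last exact: le_trans hC M2.
  by rewrite ler_piMl ?normr_ge0 // expr_le1 ?ltW.
Qed.

Lemma smooth1_Ord1 (e : R) F : 0 < e -> smooth1 e F -> F 0 = 0 -> Ord 1 F.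
Proof.
move=> e0 sF F0; have [d1 s1] := smooth1_der sF.
exact: Ord_int e0 F0 d1 (smooth1_Ord0 e0 s1).
Qed.

End VanishingOrder.

(** * The geodesic boundary coordinate *)

Section SmoothComposition.
Context {R : realType}.

(** Induction on k: the derivative of F is again smooth. *)
Lemma Ck_smooth1 (e : R) k n (U : set 'rV[R]_n) (F : R -> R) (phi : 'rV[R]_n -> R) :
  open U -> smooth1 e F -> (forall x, U x -> - e < phi x < e) ->
  Ck k U phi -> Ck k U (fun x => F (phi x)).
Proof.
move=> oU + hphi; elim: k F => [|k IH] F sF A; have [dF sF'] := smooth1_der sF.
  by apply: Ck_comp0 A => x Ux; apply: der_cont (dF _ (hphi x Ux)).
apply: (@Ck_comp _ _ k U F ('D_1 F) phi oU) => //.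
  by move=> x Ux; exact: dF (hphi x Ux).
exact: (IH ('D_1 F) sF' (CkW A)).
Qed.

End SmoothComposition.

(** Here u, u1, u2 are a function of order s^4 and its derivatives in s, and
    v = ds/dt, v1 = dv/ds: the conclusion bounds its derivatives in t. *)
Lemma transfer_bounds (R : realFieldType) (s t M C u u1 u2 v v1 : R) :
  0 < s -> s <= 1 -> 0 < t -> 0 < M -> s <= M * t ->
  `|u| <= C * s ^+ 4 -> s * `|u1| <= C * s ^+ 4 -> s ^+ 2 * `|u2| <= C * s ^+ 4 ->
  `|v| <= M -> `|v1| <= M ->
  [/\ `|u| <= 2 * `|C| * M ^+ 4 * t ^+ 4, `|u1 * v| <= 2 * `|C| * M ^+ 4 * t ^+ 3
    & `|(u2 * v + u1 * v1) * v| <= 2 * `|C| * M ^+ 4 * t ^+ 2].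
Proof.
move=> s0 s1 t0 M0 sM hu hu1 hu2 hv hv1.
have Cs k : C * s ^+ k <= `|C| * s ^+ k by rewrite ler_wpM2r ?ler_norm // exprn_ge0 // ltW.
have k1 : `|u1| <= `|C| * s ^+ 3.
  rewrite -(ler_pM2l s0) (le_trans hu1) // (le_trans (Cs 4%N)) // [leRHS]mulrCA -exprS lexx //.
have k2 : `|u2| <= `|C| * s ^+ 2.
  rewrite -(ler_pM2l (exprn_gt0 2 s0)) (le_trans hu2) // (le_trans (Cs 4%N)) // [leRHS]mulrCA -exprD lexx //.
have sk k : s ^+ k <= M ^+ k * t ^+ k.
  by rewrite -exprMn lerXn2r // nnegrE ?mulr_ge0 // ltW.
have C0 : 0 <= `|C| by [].
have P k : 0 <= `|C| * (M ^+ 4 * t ^+ k).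
  by apply: mulr_ge0 => //; apply: mulr_ge0; apply: exprn_ge0; exact: ltW.
have dbl x k : x <= `|C| * (M ^+ 4 * t ^+ k) -> x <= 2 * `|C| * M ^+ 4 * t ^+ k.
  by move=> hx; have := P k; rewrite -!mulrA; lra.
have v0 : 0 <= `|v| by []. have v10 : 0 <= `|v1| by [].
split.
- by apply: dbl; rewrite (le_trans hu) // (le_trans (Cs 4%N)) // ler_wpM2l.
- apply: dbl; rewrite normrM (le_trans (ler_pM _ _ k1 hv)) //.
  rewrite -mulrA ler_wpM2l // (_ : M ^+ 4 * t ^+ 3 = M ^+ 3 * t ^+ 3 * M); last by ring.
  by rewrite ler_wpM2r // ltW.
have k3 : `|u1| <= `|C| * s ^+ 2.
  by rewrite (le_trans k1) // ler_wpM2l // exprSr ler_piMr // exprn_ge0 // ltW.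
have X : `|C| * s ^+ 2 * M * M <= `|C| * (M ^+ 4 * t ^+ 2).
  rewrite (_ : `|C| * s ^+ 2 * M * M = `|C| * (s ^+ 2 * (M * M))); last by ring.
  rewrite (_ : `|C| * (M ^+ 4 * t ^+ 2) = `|C| * (M ^+ 2 * t ^+ 2 * (M * M))); last by ring.
  rewrite ler_wpM2l //.
  by rewrite ler_wpM2r // mulr_ge0 // ltW.
have a1 : `|u2 * v * v| <= `|C| * s ^+ 2 * M * M.
  rewrite !normrM; apply: ler_pM => //; first exact: ler_pM.
have a2 : `|u1 * v1 * v| <= `|C| * s ^+ 2 * M * M.
  rewrite !normrM; apply: ler_pM => //; exact: ler_pM.
rewrite mulrDl (le_trans (ler_normD _ _)) //.
rewrite (_ : 2 * `|C| * M ^+ 4 * t ^+ 2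
  = `|C| * (M ^+ 4 * t ^+ 2) + `|C| * (M ^+ 4 * t ^+ 2)); last by ring.
by rewrite lerD // (le_trans _ X).
Qed.

Section Profile.
Context {R : realType}.
Variables (a b : R).
Hypothesis b0 : 0 <= b.

(** In the coordinate s = 1/r the metric of the surface is
    (ds^2/P + sigma)/s^2 with P = prof s. *)
Definition prof s : R := 1 + s ^+ 2 + a * s ^+ 3 + b * s ^+ 6.
Definition rprof s : R := Num.sqrt (prof s).
Definition rprof0 s : R := Num.sqrt (1 + s ^+ 2).
Definition kern s : R :=
  - ((a + b * s ^+ 3) / (rprof s * rprof0 s * (rprof s + rprof0 s))).

(** On this interval |a s| <= 1, so that s^2 + a s^3 >= 0. *)
Lemma prof_ge1 s : - (1 + `|a|)^-1 < s < (1 + `|a|)^-1 -> 1 <= prof s.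
Proof.
rewrite -ltr_norml => hs; have A1 : 0 < 1 + `|a| by rewrite ltr_pwDl.
have as1 : `|a * s| <= 1.
  rewrite normrM; apply: (@le_trans _ _ ((1 + `|a|) * `|s|)).
    by rewrite ler_wpM2r // lerDr.
  by rewrite -ler_pdivlMl // mulr1 ltW.
have : 0 <= 1 + a * s by rewrite -lerBlDl sub0r; have := lerNnormlW as1.
have s2 : 0 <= s ^+ 2 by rewrite sqr_ge0.
have s6 : 0 <= b * s ^+ 6 by rewrite mulr_ge0 // exprn_even_ge0.
move=> k1; rewrite (_ : prof s = 1 + (s ^+ 2 * (1 + a * s) + b * s ^+ 6)).
  by rewrite lerDl addr_ge0 // mulr_ge0.
by rewrite /prof; ring.
Qed.

Section OnInterval.
Variable e : R.
Hypothesis e0 : 0 < e.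
Hypothesis prof1 : forall s, - e < s < e -> 1 <= prof s.

Let U : set 'rV[R]_(1 + 2) := slab (- e) e.
Let oU : open U. Proof. exact: open_slab. Qed.

Lemma rprof_gt0 s : - e < s < e -> 0 < rprof s.
Proof. by move=> /prof1 h; rewrite sqrtr_gt0 (lt_le_trans ltr01). Qed.

Lemma rprof_sqr s : - e < s < e -> rprof s ^+ 2 = prof s.
Proof. by move=> /prof1 h; rewrite sqr_sqrtr // (le_trans ler01). Qed.

Lemma rprof0_gt0 s : 0 < rprof0 s.
Proof. by rewrite sqrtr_gt0 ltr_pwDl ?sqr_ge0. Qed.

Lemma rprof0_sqr s : rprof0 s ^+ 2 = 1 + s ^+ 2.
Proof. by rewrite sqr_sqrtr // addr_ge0 ?sqr_ge0. Qed.

Lemma rprof0_ge1 s : 1 <= rprof0 s.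
Proof. by rewrite -[leLHS]sqrtr1; apply: ler_wsqrtr; rewrite lerDl sqr_ge0. Qed.

Lemma Ck_prof k : Ck k U (fun x => prof (x 0 0)).
Proof. by rewrite /prof; ck. Qed.

Lemma Ck_rprof k : Ck k U (fun x => rprof (x 0 0)).
Proof.
have A := Ck_prof k; rewrite /rprof; ck => x Ux.
by rewrite (lt_le_trans ltr01) ?prof1.
Qed.

Lemma Ck_rprof0 k : Ck k U (fun x => rprof0 (x 0 0)).
Proof. by rewrite /rprof0; ck => x _; rewrite ltr_pwDl ?sqr_ge0. Qed.

Lemma kern_den s : - e < s < e -> rprof s * rprof0 s * (rprof s + rprof0 s) != 0.
Proof.
move=> hs; have := rprof_gt0 hs; have := rprof0_gt0 s => A B.
by rewrite gt_eqF // !mulr_gt0 // addr_gt0.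
Qed.

Lemma Ck_kern k : Ck k U (fun x => kern (x 0 0)).
Proof.
have A := Ck_rprof k; have B := Ck_rprof0 k; rewrite /kern; ck => x Ux.
exact: kern_den.
Qed.

Lemma smooth1_kern : smooth1 e kern. Proof. by move=> k; exact: Ck_kern. Qed.

End OnInterval.

(** The equation d(log tanh (tau / 2)) = ds/(s sqrt P) has the explicit solution
    tanh (tau / 2) = s/(1 + sqrt (1 + s^2)) when P = 1 + s^2. In general this is
    multiplied by exp D with D' = (1/sqrt P - 1/sqrt (1 + s^2))/s, and clearing
    the radicals shows that D' = s^2 kern s is smooth at s = 0. The interval is
    shrunk so that tanh (tau / 2) stays below 1. *)
Lemma exponent_exists (emax : R) : 0 < emax -> exists (e : R) (D : R -> R),
  [/\ 0 < e, e <= emax & e <= 1] /\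
  [/\ forall s, - e < s < e -> 1 <= prof s, D 0 = 0,
      forall s, - e < s < e -> is_derive s 1 D (s ^+ 2 * kern s) &
      forall s, - e < s < e -> expR (D s) < 2].
Proof.
move=> em0; pose e1 := (1 + `|a|)^-1.
have e10 : 0 < e1 by rewrite invr_gt0 ltr_pwDl.
have prof1 : forall s, - e1 < s < e1 -> 1 <= prof s by exact: prof_ge1.
have [dK _] := smooth1_der (smooth1_kern prof1).
have e2 : 0 < e1 / 2 by rewrite divr_gt0.
have e21 : e1 / 2 < e1 by rewrite ltr_pdivrMr // ltr_pMr // ltr1n.
have [|D [D0 dD]] := @antiderivative R (fun s => s ^+ 2 * kern s) _ e2.
  move=> s /andP[s1 s2].
  have hs : - e1 < s < e1 by rewrite (le_lt_trans s2) // andbT (lt_le_trans _ s1) // ltrN2.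
  have K := dK s hs.
  by eapply der_cont; der.
have z : - (e1 / 2) < 0 < e1 / 2 by rewrite oppr_lt0 e2.
have cE : {for 0, continuous (fun s => expR (D s))}.
  by have H := dD 0 z; eapply der_cont; der.
have : \forall s \near 0, expR (D s) < 2.
  have /cvgrPdist_lt/(_ 1 ltr01) := cE; apply: filterS => s.
  rewrite D0 expR0 => hs; have := ler_norm (expR (D s) - 1).
  by rewrite distrC => /le_lt_trans/(_ hs); rewrite ltrBlDr.
move=> /nbhs_ballP[d d0 H].
pose e := Num.min (Num.min (e1 / 2) d) (Num.min emax 1).
have ee1 : e <= e1 / 2 by rewrite /e !ge_min lexx.
have ed : e <= d by rewrite /e !ge_min lexx !orbT.
exists e, D; split; first by split; rewrite /e ?lt_min ?e2 ?em0 ?ltr01 ?d0 ?ge_min ?lexx ?orbT.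
have W (x s : R) : e <= x -> - e < s < e -> - x < s < x.
  move=> ex /andP[s1 s2]; rewrite (lt_le_trans s2) // andbT (le_lt_trans _ s1) //.
  by rewrite lerN2.
split=> // s hs.
- by apply: prof1; apply: W hs; rewrite (le_trans ee1) // ltW.
- by apply: dD; exact: W hs.
- by apply: H; rewrite /ball /= sub0r normrN ltr_norml; exact: W hs.
Qed.

Section GeodesicCoordinate.
Variables (e : R) (D : R -> R).
Hypothesis e0 : 0 < e.
Hypothesis e1 : e <= 1.
Hypothesis prof1 : forall s, - e < s < e -> 1 <= prof s.
Hypothesis D0 : D 0 = 0.
Hypothesis dD : forall s, - e < s < e -> is_derive s 1 D (s ^+ 2 * kern s).
Hypothesis D2 : forall s, - e < s < e -> expR (D s) < 2.

Let U : set 'rV[R]_(1 + 2) := slab (- e) e.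
Let oU : open U. Proof. exact: open_slab. Qed.
Let z0 : - e < 0 < e. Proof. by rewrite oppr_lt0 e0. Qed.

Lemma Ck_expo k : Ck k U (fun x => D (x 0 0)).
Proof.
apply: CkW; apply: (@Ck_comp _ _ k U D (fun s => s ^+ 2 * kern s)) => //.
- exact: (@Ck_coord _ _ k.+1 U 0 oU).
- by have K := Ck_kern prof1 k; ck.
Qed.

Definition wfun s : R := expR (D s) / (1 + rprof0 s).
(** T = tanh (tau / 2). *)
Definition Tfun s : R := s * wfun s.
Definition tau s : R := artanh2 (Tfun s).
(** Y = sinh tau / s. *)
Definition Yfun s : R := 2 * wfun s / (1 - Tfun s ^+ 2).

Let q0 s : 1 + rprof0 s != 0.
Proof. by rewrite gt_eqF // addr_gt0 // rprof0_gt0. Qed.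

Lemma wfun_gt0 s : 0 < wfun s.
Proof. by rewrite divr_gt0 ?expR_gt0 // addr_gt0 // rprof0_gt0. Qed.

Lemma wfun_lt1 s : - e < s < e -> wfun s < 1.
Proof.
move=> hs; rewrite ltr_pdivrMr ?mul1r ?addr_gt0 ?rprof0_gt0 //.
by apply: lt_le_trans (D2 hs) _; have := rprof0_ge1 s; lra.
Qed.

Lemma Tfun_bound s : - e < s < e -> - 1 < Tfun s < 1.
Proof.
move=> hs; rewrite -ltr_norml normrM (gtr0_norm (wfun_gt0 s)).
have s1 : `|s| <= 1 by rewrite (le_trans _ e1) // ltW // ltr_norml.
by rewrite (le_lt_trans (ler_wpM2r (ltW (wfun_gt0 s)) s1)) // mul1r wfun_lt1.
Qed.

Lemma Tfun_den s : - e < s < e -> 0 < 1 - Tfun s ^+ 2.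
Proof. by move=> /Tfun_bound; exact: one_sub_sqr. Qed.

Lemma Yfun_gt0 s : - e < s < e -> 0 < Yfun s.
Proof. by move=> hs; rewrite divr_gt0 ?Tfun_den // mulr_gt0 ?wfun_gt0. Qed.

Lemma Ck_wfun k : Ck k U (fun x => wfun (x 0 0)).
Proof. by have A := Ck_expo k; have B := Ck_rprof0 e k; rewrite /wfun; ck. Qed.

Lemma Ck_Tfun k : Ck k U (fun x => Tfun (x 0 0)).
Proof. by have A := Ck_wfun k; rewrite /Tfun; ck. Qed.

Lemma Ck_Yfun k : Ck k U (fun x => Yfun (x 0 0)).
Proof.
have A := Ck_wfun k; have B := Ck_Tfun k; rewrite /Yfun; ck => x Ux.
by rewrite gt_eqF // Tfun_den.
Qed.

Lemma Ck_tau k : Ck k U (fun x => tau (x 0 0)).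
Proof.
have B := Ck_Tfun k; rewrite /tau /artanh2; ck => x /Tfun_bound T1.
  exact: artanh2_arg.
by rewrite gt_eqF // subr_gt0; case/andP: T1.
Qed.

Lemma der_Tfun s : - e < s < e -> is_derive s 1 Tfun (wfun s / rprof s).
Proof.
move=> hs; have H := dD hs; have Q := q0 s.
have p0 := rprof_gt0 prof1 hs; have p00 := rprof0_gt0 s.
have P2 := rprof_sqr prof1 hs; have P02 := rprof0_sqr s.
have pz : rprof s != 0 by rewrite gt_eqF.
have pz0 : rprof0 s != 0 by rewrite gt_eqF.
have pp : rprof s + rprof0 s != 0 by rewrite gt_eqF // addr_gt0.
have dp0 : is_derive s 1 rprof0 (s / rprof0 s).
  have pos : 0 < 1 + s ^+ 2 by rewrite ltr_pwDl ?sqr_ge0.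
  rewrite /rprof0; eapply is_derive_eq; first by der.
  by rewrite /= -/(rprof0 s); field.
rewrite /Tfun /wfun; eapply is_derive_eq; first by der.
(* Both sides are multiples of exp D; the bracket vanishes because of
   P - (1 + s^2) = s^3 (a + b s^3). *)
have PK : s ^+ 3 * kern s = (rprof s)^-1 - (rprof0 s)^-1.
  have E : s ^+ 3 * (a + b * s ^+ 3) = rprof s ^+ 2 - rprof0 s ^+ 2.
    by rewrite P2 P02 /prof; ring.
  rewrite /kern mulrN mulrA E; field.
  by rewrite pz pz0 pp.
have E2 : s ^+ 2 = rprof0 s ^+ 2 - 1 by rewrite P02; ring.
transitivity (expR (D s) / (1 + rprof0 s) * (1 + s ^+ 3 * kern s
   - s ^+ 2 / (rprof0 s * (1 + rprof0 s)))).
  by rewrite /=; field; rewrite Q pz0.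
by rewrite PK E2; field; rewrite Q pz0 pz.
Qed.

Lemma der_tau s : - e < s < e -> is_derive s 1 tau (Yfun s / rprof s).
Proof.
move=> hs; have H := der_Tfun hs; have A := der_artanh2 (Tfun_bound hs).
rewrite /tau; eapply is_derive_eq; first exact: (der_comp A H).
by rewrite /Yfun; ring.
Qed.

Lemma tau0 : tau 0 = 0.
Proof. by rewrite /tau /Tfun mul0r artanh2_0. Qed.

Lemma tau_lt s t : - e < s -> s < t -> t < e -> tau s < tau t.
Proof.
move=> es st te.
have [||x] := @MVT R tau (fun s => Yfun s / rprof s) s t st.
- by move=> x; rewrite in_itv /= => /andP[x0 xs]; apply: der_tau; rewrite (lt_trans es) ?(lt_trans xs).
- apply: derivable_within_continuous => x; rewrite in_itv /= => /andP[x0 xs].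
  have hx : - e < x < e by rewrite (lt_le_trans es) ?(le_lt_trans xs).
  by have [] := der_tau hx.
rewrite in_itv /= => /andP[x0 xs] E.
have hx : - e < x < e by rewrite (lt_trans es) ?(lt_trans xs).
by rewrite -subr_gt0 E mulr_gt0 ?subr_gt0 // divr_gt0 ?Yfun_gt0 // (rprof_gt0 prof1).
Qed.

Lemma sinh_tau s : - e < s < e -> Defs.sinh (tau s) = s * Yfun s.
Proof.
move=> hs; have T1 := Tfun_bound hs; have A := artanh2_arg T1.
have d0 : 1 - Tfun s ^+ 2 != 0 by rewrite gt_eqF ?Tfun_den.
have t1 : 1 - Tfun s != 0 by case/andP: T1 => _ ?; rewrite gt_eqF ?subr_gt0.
have t2 : 1 + Tfun s != 0 by case/andP: T1 => ? _; rewrite gt_eqF // -ltrBlDl sub0r.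
rewrite /Defs.sinh /tau expRN /artanh2 lnK ?posrE // /Yfun.
rewrite (_ : s * (2 * wfun s / (1 - Tfun s ^+ 2)) = 2 * Tfun s / (1 - Tfun s ^+ 2)).
  by field; rewrite d0 t1 t2.
by rewrite /Tfun; ring.
Qed.

(** This form of tau / s makes sense at s = 0, where the compactified metric needs
    it. *)
Lemma tau_quot s : tau s = s * (wfun s * artanh_quot (Tfun s)).
Proof. by rewrite /tau artanh_quotE /Tfun mulrA. Qed.

Lemma Ck_tau_quot : Ck 3 U (fun x => wfun (x 0 0) * artanh_quot (Tfun (x 0 0))).
Proof.
have A := Ck_wfun 3; have B := Ck_Tfun 3.
have C : Ck 3 U (fun x => artanh_quot (Tfun (x 0 0))).
  by apply: Ck_artanh_quot => // y Uy; exact: Tfun_bound.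
by ck.
Qed.

(** The conformal factor (sinh tau / s)^2 = Y^2 minus 1 - a tau^3/3, as a
    function of s. *)
Definition remainder s : R := Yfun s ^+ 2 - 1 + a / 3 * tau s ^+ 3.

Let excess s : R := expR (D s) ^+ 2 - 1.

Let der_excess s : - e < s < e ->
  is_derive s 1 excess (s ^+ 2 * (2 * expR (D s) ^+ 2 * kern s)).
Proof.
move=> hs; have H := dD hs; rewrite /excess; eapply is_derive_eq; first by der.
by rewrite /=; ring.
Qed.

Let excess0 : excess 0 = 0.
Proof. by rewrite /excess D0 expR0 expr1n subrr. Qed.

Let Ord_excess : Ord 3 excess.
Proof.
apply: (Ord_int e0 excess0 der_excess); apply: (OrdM (OrdX 2) (k := 0)).
apply: (smooth1_Ord0 e0) => k; have A := Ck_expo k; have B := Ck_kern prof1 k.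
by rewrite /lift; ck.
Qed.

Let Ord_excess4 : Ord 4 (fun s => excess s + a / 3 * s ^+ 3).
Proof.
apply: (@Ord_int _ 3 _ (fun s => s ^+ 2 * (2 * expR (D s) ^+ 2 * kern s + a)) e e0).
- by rewrite excess0 expr0n mulr0 addr0.
- move=> s hs; have H := der_excess hs; eapply is_derive_eq; first by der.
  by rewrite /=; field.
apply: (OrdM (OrdX 2) (k := 1)); apply: (smooth1_Ord1 e0).
  move=> k; have A := Ck_expo k; have B := Ck_kern prof1 k.
  by rewrite /lift; ck.
rewrite D0 expR0 /kern /rprof /rprof0 /prof !expr0n /= !mulr0 !addr0 sqrtr1.
by field.
Qed.

Let Ord_tau : Ord 2 (fun s => tau s - s).
Proof.
apply: (@Ord_int _ 1 _ (fun s => Yfun s / rprof s - 1) e e0).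
- by rewrite tau0 subr0.
- by move=> s hs; have H := der_tau hs; der.
apply: (smooth1_Ord1 e0).
  move=> k; have A := Ck_Yfun k; have B := Ck_rprof prof1 k; rewrite /lift; ck => x Ux.
  by rewrite gt_eqF // (rprof_gt0 prof1).
rewrite /Yfun /Tfun /wfun D0 expR0 /rprof /rprof0 /prof !expr0n /= !mulr0 !mul0r !addr0.
by rewrite sqrtr1 expr0n subr0; field.
Qed.

Let Yfun_expand s : - e < s < e -> Yfun s = expR (D s)
  + s ^+ 2 * (excess s * (expR (D s) / (1 + rprof0 s) ^+ 2 / (1 - Tfun s ^+ 2))).
Proof.
move=> hs; have d0 : 1 - Tfun s ^+ 2 != 0 by rewrite gt_eqF ?Tfun_den.
have E2 : s ^+ 2 = rprof0 s ^+ 2 - 1 by rewrite rprof0_sqr; ring.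
have Q := q0 s; move: d0.
rewrite /Yfun (_ : Tfun s ^+ 2 = s ^+ 2 * wfun s ^+ 2); last by rewrite /Tfun exprMn.
rewrite E2 /excess /wfun => d0.
have d1 : (1 + rprof0 s) ^+ 2 - (rprof0 s ^+ 2 - 1) * expR (D s) ^+ 2 != 0.
  rewrite (_ : _ - _ = (1 + rprof0 s) ^+ 2
    * (1 - (rprof0 s ^+ 2 - 1) * (expR (D s) / (1 + rprof0 s)) ^+ 2)); last by field.
  by rewrite mulf_neq0 // expf_neq0.
by field; rewrite Q d1.
Qed.

(** With E = exp (2 D) - 1 one has Y = exp D + s^2 E N, N smooth; since E is of
    order s^3 this gives Y^2 = 1 + E + O(s^5). Moreover E = - a s^3/3 + O(s^4)
    because E' = s^2 (- a + O(s)), and tau = s + O(s^2) allows s^3 to be replaced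
    by tau^3. *)
Lemma Ord_remainder : Ord 4 remainder.
Proof.
pose N s := expR (D s) / (1 + rprof0 s) ^+ 2 / (1 - Tfun s ^+ 2) * (Yfun s + expR (D s)).
have O1 : Ord 4 (fun s => s ^+ 2 * (excess s * N s)).
  apply: (@OrdW _ 5) => //; apply: (OrdM (OrdX 2) (k := 3)).
  apply: (OrdM Ord_excess (k := 0)); apply: (smooth1_Ord0 e0) => k.
  have A1 := Ck_expo k; have A2 := Ck_rprof0 e k; have A3 := Ck_Tfun k.
  have A4 := Ck_Yfun k; rewrite /lift /N; ck => x Ux.
    by rewrite expf_neq0.
  by rewrite gt_eqF ?Tfun_den.
have O2 : Ord 4 (fun s => (tau s - s) * (tau s ^+ 2 + tau s * s + s ^+ 2)).
  have t1 : Ord 1 tau by apply: (smooth1_Ord1 e0); [exact: Ck_tau|exact: tau0].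
  apply: (OrdM Ord_tau (k := 2)); apply: OrdD (OrdX 2); apply: OrdD.
    exact: (OrdM t1 t1).
  exact: (OrdM t1 (@Ord_id R)).
apply: Ord_eq (OrdD (OrdD O1 Ord_excess4) (OrdZ (a / 3) O2)); first exact: e0.
move=> s /andP[s0 se]; have hs : - e < s < e by rewrite se (lt_trans _ s0) // oppr_lt0.
have E := Yfun_expand hs.
have -> : s ^+ 2 * (excess s * N s)
    = (Yfun s - expR (D s)) * (Yfun s + expR (D s)) by rewrite {1}E /N; ring.
by rewrite /remainder /excess; ring.
Qed.

Let sg t : R := xget 0 [set s | 0 < s < e /\ tau s = t].

Let sg_tau s : 0 < s < e -> sg (tau s) = s.
Proof.
move=> /andP[s0 se]; rewrite /sg.
case: (xgetP 0 [set s' | 0 < s' < e /\ tau s' = tau s]) => [x _|/(_ s) H]; last first.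
  by case: H; split=> //; rewrite s0 se.
move=> [/andP[x0 xe] E].
have me : - e < 0 by rewrite oppr_lt0.
case: (ltgtP x s) => // xs.
  by have := tau_lt (lt_trans me x0) xs se; rewrite E ltxx.
by have := tau_lt (lt_trans me s0) xs xe; rewrite E ltxx.
Qed.

(** tau increases strictly from 0, so that it has a differentiable inverse on
    an initial interval; d allows the values of the inverse to be kept where a
    bound valid only for small s applies. *)
Lemma inverse_exists (d : R) : 0 < d -> exists (t0 : R) (sig : R -> R),
  [/\ 0 < t0,
    forall t, 0 < t < t0 -> [/\ 0 < sig t < e, sig t < d & tau (sig t) = t],
    forall s, 0 < s < e -> sig (tau s) = s &
    forall t, 0 < t < t0 -> is_derive t 1 sig (rprof (sig t) / Yfun (sig t))].
Proof.
move=> d0; pose m := Num.min d e / 2.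
have m0 : 0 < m by rewrite divr_gt0 // lt_min d0.
have mm : m < Num.min d e by rewrite /m ltr_pdivrMr // ltr_pMr ?ltr1n // lt_min d0.
have [md me] : m < d /\ m < e by move: mm; rewrite lt_min => /andP[].
have ne : - e < 0 by rewrite oppr_lt0.
have P t : 0 < t < tau m -> exists s, [/\ 0 < s < e, s < d & tau s = t].
  move=> /andP[t0 tm].
  have [||s] := @IVT R tau 0 m t (ltW m0).
  - apply: derivable_within_continuous => x; rewrite in_itv /= => /andP[x0 xs].
    have hx : - e < x < e by rewrite (lt_le_trans ne) ?(le_lt_trans xs).
    by have [] := der_tau hx.
  - by rewrite tau0 ge_min (ltW t0) /= le_max (ltW tm) orbT.
  rewrite in_itv /= => /andP[s0 sm] E.
  exists s; split=> //; last exact: le_lt_trans md.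
  rewrite (le_lt_trans sm me) andbT lt_neqAle s0 andbT.
  by apply/eqP => s00; move: t0; rewrite -E -s00 tau0 ltxx.
exists (tau m), sg; split=> //.
- by rewrite -tau0; apply: tau_lt.
- by move=> t /P [s [s1 s2 <-]]; rewrite sg_tau.
move=> t /P [s [s1 s2 <-]]; rewrite sg_tau //.
have hs : - e < s < e by case/andP: s1 => s0 se; rewrite se andbT (lt_trans ne).
rewrite (_ : rprof s / Yfun s = (Yfun s / rprof s)^-1); last exact: esym (invf_div _ _).
apply: (@is_derive_inverse R tau sg).
- by apply: (near_Ioo s1) => x hx; exact: sg_tau.
- apply: (near_Ioo hs) => x hx; exact: der_cont (der_tau hx).
- exact: der_tau.
by rewrite mulf_neq0 ?invr_eq0 ?gt_eqF ?Yfun_gt0 ?(rprof_gt0 prof1).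
Qed.

Lemma smooth1_speed : smooth1 e (fun s => rprof s / Yfun s).
Proof.
move=> k; have A := Ck_Yfun k; have B := Ck_rprof prof1 k; rewrite /lift; ck => x Ux.
by rewrite gt_eqF // Yfun_gt0.
Qed.

(** Substituting the inverse function into the remainder preserves its order,
    because ds/dtau = sqrt P / Y is smooth and positive up to the boundary. *)
Lemma expansion_in_tau : exists (t0 : R) (sig : R -> R) (C : R) (q1 q2 : R -> R),
  [/\ 0 < t0 <= 1,
    forall t, 0 < t < t0 -> 0 < sig t < e /\ tau (sig t) = t,
    forall s, 0 < s < e -> sig (tau s) = s,
    forall k, Ck k (slab 0 t0) (fun x : 'rV[R]_(1 + 2) => sig (x 0 0)) &
    let q t := (Defs.sinh t / sig t) ^+ 2 - 1 + a / 3 * t ^+ 3 in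
    [/\ forall k, Ck k (slab 0 t0) (fun x : 'rV[R]_(1 + 2) => q (x 0 0)),
        forall t, 0 < t < t0 -> is_derive t 1 q (q1 t) /\ is_derive t 1 q1 (q2 t) &
        forall t, 0 < t < t0 ->
          [/\ `|q t| <= C * t ^+ 4, `|q1 t| <= C * t ^+ 3 & `|q2 t| <= C * t ^+ 2]]].
Proof.
have [dg sg'] := smooth1_der smooth1_speed; pose g s := rprof s / Yfun s.
have [Q1 [Q2 [C [d1 [d10 H]]]]] := Ord_remainder.
have [d2 [d20 B1]] := cont_bounded 0 (der_cont (dg 0 z0)).
have [dg' _] := smooth1_der sg'.
have [d3 [d30 B2]] := cont_bounded 0 (der_cont (dg' 0 z0)).
pose M : R := (`|g 0| + 1) + (`|'D_1 g 0| + 1).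
have M0 : 0 < M by rewrite addr_gt0 // ltr_wpDl.
pose d := Num.min (Num.min d1 d2) (Num.min d3 1).
have d0 : 0 < d by rewrite !lt_min d10 d20 d30 ltr01.
have [t1 [sig [t10 sigP sigK dsig]]] := inverse_exists d0.
have ne : - e < 0 by rewrite oppr_lt0.
have in_e s : 0 < s < e -> - e < s < e by case/andP=> s0 se; rewrite se andbT (lt_trans ne).
have gM s : 0 < s < d -> `|g s| <= M /\ `|'D_1 g s| <= M.
  rewrite !lt_min => /andP[s0 /andP[/andP[_ s2] /andP[s3 _]]].
  split; [apply: le_trans (B1 s _) _|apply: le_trans (B2 s _) _].
  - by rewrite s2 (lt_trans _ s0) ?oppr_lt0.
  - by rewrite /M lerDl addr_ge0.
  - by rewrite s3 (lt_trans _ s0) ?oppr_lt0.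
  - by rewrite /M lerDr addr_ge0.
(* sig t <= M t, by the mean value theorem applied to tau on [0, sig t]. *)
have sig_le t : 0 < t < t1 -> sig t <= M * t.
  move=> ht; have [se sd E] := sigP t ht; have /andP[s0 s1] := se.
  have [||x] := @MVT R tau (fun s => Yfun s / rprof s) 0 (sig t) s0.
  - move=> x; rewrite in_itv /= => /andP[x0 xs]; apply: der_tau; apply: in_e.
    by rewrite x0 (lt_trans xs).
  - apply: derivable_within_continuous => x; rewrite in_itv /= => /andP[x0 xs].
    have hx : - e < x < e by rewrite (lt_le_trans ne) ?(le_lt_trans xs).
    by have [] := der_tau hx.
  rewrite in_itv /= tau0 !subr0 E => /andP[x0 xs] tE.
  have hx : - e < x < e by apply: in_e; rewrite x0 (lt_trans xs).
  have Y0 := Yfun_gt0 hx; have p0 := rprof_gt0 prof1 hx.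
  have [gx _] := gM x (introT andP (conj x0 (lt_trans xs sd))).
  rewrite [X in M * X]tE mulrA ler_peMl ?(ltW s0) //.
  have : g x * (Yfun x / rprof x) = 1 by rewrite /g; field; rewrite !gt_eqF.
  have c0 : 0 <= Yfun x / rprof x by exact: ltW (divr_gt0 Y0 p0).
  move=> <-; rewrite ler_wpM2r //.
  exact: le_trans (ler_norm _) gx.
pose q t := (Defs.sinh t / sig t) ^+ 2 - 1 + a / 3 * t ^+ 3.
have qE t : 0 < t < t1 -> q t = remainder (sig t).
  move=> ht; have [se sd E] := sigP t ht; have /andP[s0 s1] := se.
  rewrite /q /remainder -{1}E sinh_tau ?in_e // mulrC mulKf ?gt_eqF //.
  by rewrite E.
pose t0 := Num.min t1 1.
have t01 t : 0 < t < t0 -> 0 < t < t1.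
  by rewrite lt_min => /and3P[-> ->].
have Sg k : Ck k (slab 0 t0) (fun x : 'rV[R]_(1 + 2) => sig (x 0 0)).
  have oS := @open_slab R 0 t0.
  elim: k => [|k IH].
    apply: (@Ck_comp0 _ _ _ sig (fun x => x 0 0)); last exact: Ck_coord.
    by move=> x /t01 ht; exact: der_cont (dsig _ ht).
  apply: (@Ck_comp _ _ k _ sig (fun t => g (sig t)) (fun x => x 0 0)) => //.
  - by move=> x /t01 ht; exact: dsig.
  - exact: (@Ck_coord _ _ k.+1 _ 0 oS).
  apply: (Ck_smooth1 oS smooth1_speed _ IH) => x /t01 ht.
  by apply: in_e; have [] := sigP _ ht.
have Sq k : Ck k (slab 0 t0) (fun x : 'rV[R]_(1 + 2) => q (x 0 0)).
  have oS := @open_slab R 0 t0; have A := Sg k.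
  rewrite /q /Defs.sinh; ck => x /t01 ht.
  by have [/andP[s0 _] _ _] := sigP _ ht; rewrite gt_eqF.
pose q1 t := Q1 (sig t) * g (sig t).
pose q2 t := (Q2 (sig t) * g (sig t) + Q1 (sig t) * 'D_1 g (sig t)) * g (sig t).
have s_d t : 0 < t < t1 -> 0 < sig t < d1.
  by move=> ht; have [/andP[s0 _] sd _] := sigP t ht; move: sd;
    rewrite s0 !lt_min => /andP[/andP[-> _] _].
have Dq t : 0 < t < t1 -> is_derive t 1 q (q1 t) /\ is_derive t 1 q1 (q2 t).
  move=> ht1; have [se sd E] := sigP t ht1.
  have [h1 h2 _ _ _] := H _ (s_d t ht1).
  have ds : is_derive t 1 sig (g (sig t)) := dsig t ht1.
  split.
    have e0' : is_derive t 1 (fun t => remainder (sig t)) (q1 t) := der_comp h1 ds.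
    apply: der_near e0'.
    by apply: (near_Ioo ht1) => y hy; rewrite qE.
  have dgs := dg _ (in_e _ se).
  have e1' : is_derive t 1 (fun t => Q1 (sig t)) (Q2 (sig t) * g (sig t)) := der_comp h2 ds.
  have e2' : is_derive t 1 (fun t => g (sig t)) ('D_1 g (sig t) * g (sig t)) := der_comp dgs ds.
  have e3' := derM e1' e2'.
  by eapply is_derive_eq; [exact: e3'|rewrite /q2; ring].
have Bq t : 0 < t < t0 -> [/\ `|q t| <= 2 * `|C| * M ^+ 4 * t ^+ 4,
    `|q1 t| <= 2 * `|C| * M ^+ 4 * t ^+ 3 & `|q2 t| <= 2 * `|C| * M ^+ 4 * t ^+ 2].
  move=> ht; have ht1 := t01 _ ht; have [se sd E] := sigP t ht1; have /andP[s0 s1] := se.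
  have [_ _ h3 h4 h5] := H _ (s_d t ht1).
  have [G1 G2] := gM (sig t) (introT andP (conj s0 sd)); have sM := sig_le t ht1.
  rewrite qE // /q1 /q2.
  have sl : sig t <= 1 by rewrite (le_trans (ltW s1)).
  have t_0 : 0 < t by case/andP: ht.
  move: (sig t) (remainder (sig t)) (Q1 (sig t)) (Q2 (sig t)) (g (sig t)) ('D_1 g (sig t))
    s0 sl sM h3 h4 h5 G1 G2.
  move=> s u u1 u2 v v1 s0 sl sM h3 h4 h5 G1 G2.
  exact: (transfer_bounds s0 sl t_0 M0 sM h3 h4 h5 G1 G2).
exists t0, sig, (2 * `|C| * M ^+ 4), q1, q2; split.
- by rewrite lt_min t10 ltr01 ge_min lexx orbT.
- by move=> t /t01 ht; have [] := sigP _ ht.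
- exact: sigK.
- exact: Sg.
split; [exact: Sq| |exact: Bq].
by move=> t /t01; exact: Dq.
Qed.

End GeodesicCoordinate.
End Profile.

(** * Curvature and normal form of the surface *)

Section InducedMetric.
Context {R : realType}.
Variables (m : R) (f : R -> R).
Hypothesis m0 : 0 <= m.
Variable c : R.

Let V r : R := h m r + (r + c / r ^+ 2) ^+ 2.
Let V1 r : R := 2 * m / r ^+ 2 + 2 * (r + c / r ^+ 2) * (1 - 2 * c / r ^+ 3).

Hypothesis fc : forall r, 2 * m < r -> [/\ derivable f r 1, 0 < V r &
  (h m r)^-1 + - h m r * f^`()%classic r ^+ 2 = (V r)^-1].

Lemma induced_metricE (q : 'rV[R]_(1 + 3)) : 2 * m < q 0 0 ->
  induced_metric m f q = block_mx (V (q 0 0))^-1%:M 0 0 (q 0 0 ^+ 2)%:M.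
Proof.
move=> mr; have [df V0 VE] := fc mr.
have E : gSch m (@graph R f 3 q) = block_mx (- h m (q 0 0))%:M 0 0
    (block_mx (h m (q 0 0))^-1%:M 0 0 (q 0 0 ^+ 2)%:M).
  by rewrite /gSch /graph row_mxKr.
by rewrite /induced_metric (pullback_graph df E) VE.
Qed.

Lemma cyl00 b (x : 'rV[R]_(1 + 2)) : @cyl R 1 b x 0 0 = x 0 0.
Proof.
rewrite /cyl (_ : (0 : 'I_(1 + 3)) = lshift 3 0); last exact/val_inj.
by rewrite row_mxEl mxE; congr (x 0 _); exact/val_inj.
Qed.

(** In 2 (1 - V)/r^2 - 2 V'/r the term 1 + r^2 of V contributes - 6, the multiples
    of 1/r cancel, and c^2/r^4 contributes 6 c^2/r^6. *)
Lemma scalar_curvature_SSCMC b (x : 'rV[R]_(1 + 2)) : 2 * m < x 0 0 ->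
  scalar_curvature (pullback (cyl b) (induced_metric m f)) x + 6
    = 6 * c ^+ 2 * (x 0 0)^-1 ^+ 6.
Proof.
move=> mr.
have m2 : 0 <= 2 * m by rewrite mulr_ge0.
have r0 : x 0 0 != 0 by rewrite gt_eqF // (le_lt_trans m2).
have dV r : 2 * m < r -> is_derive r 1 V (V1 r).
  move=> hr; have rz : r != 0 by rewrite gt_eqF // (le_lt_trans m2).
  have rz2 : r ^+ 2 != 0 by rewrite expf_neq0.
  have H := der_lapse m rz; rewrite /V; eapply is_derive_eq; first by der.
  by rewrite /V1 /=; field.
rewrite (@scalar_curvature_warped R (2 * m) V V1 m2 _ dV) //; first last.
- move=> y my; have cy : 2 * m < cyl b y 0 0 by rewrite cyl00.
  rewrite (pullback_cyl (induced_metricE cy)) cyl00 /warped -diag_block !diag_const_mx //.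
- by move=> r /fc [].
by rewrite /V /V1 /h; field.
Qed.

End InducedMetric.

Section StereographicBounds.
Context {R : realType}.
Implicit Types x : 'rV[R]_(1 + 2).

Let N x : R := 1 + (x 0 crd1 ^+ 2 + x 0 crd2 ^+ 2).

Definition confx x : R := conf (rsubmx x).
Definition dconf (i : 'I_(1 + 2)) x : R :=
  if i == ord0 then 0 else - 16 * x 0 i * N x ^- 3.
Definition ddconf (j i : 'I_(1 + 2)) x : R :=
  if (i == ord0) || (j == ord0) then 0 else
  - 16 * (i == j)%:R * N x ^- 3 + 96 * x 0 i * x 0 j * N x ^- 4.

Let N_ge1 x : 1 <= N x. Proof. by rewrite lerDl addr_ge0 ?sqr_ge0. Qed.
Let N0 x : N x != 0. Proof. by rewrite gt_eqF // (lt_le_trans ltr01). Qed.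

Let confxE : confx = fun x => 4 * (1 + (x 0 crd1 ^+ 2 + x 0 crd2 ^+ 2)) ^- 2.
Proof. by apply/funext => x; rewrite /confx conf_coord. Qed.

Lemma Ck_confx k (U : set 'rV[R]_(1 + 2)) : open U -> Ck k U confx.
Proof. by move=> oU; rewrite confxE; ck => x _; apply: expf_neq0; exact: N0. Qed.

Lemma der_confx i x : is_derive x (delta_mx 0 i) confx (dconf i x).
Proof.
rewrite confxE; have N1 := N0 x; have N2 : N x ^+ 2 != 0 by rewrite expf_neq0.
rewrite /N in N1 N2; eapply is_derive_eq; first by der.
by rewrite /dconf /N; elim/ord3P: i; rewrite !mxE /=; field.
Qed.

Lemma der_dconf j i x : is_derive x (delta_mx 0 j) (dconf i) (ddconf j i x).
Proof.
have N1 := N0 x; have N3 : N x ^+ 3 != 0 by rewrite expf_neq0.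
rewrite /N in N1 N3; rewrite /dconf /ddconf /N; case: (i =P ord0) => [_|i0] /=.
  exact: derC.
eapply is_derive_eq; first by der.
move: i0; elim/ord3P: i => [[]|_|_]; first exact/val_inj.
  by elim/ord3P: j; rewrite !mxE /crd0 /crd1 /crd2 /=; field.
by elim/ord3P: j; rewrite !mxE /crd0 /crd1 /crd2 /=; field.
Qed.

Let NV x k : 0 <= N x ^- k <= 1.
Proof.
have N1 := N_ge1 x; rewrite invr_ge0 exprn_ge0 ?(le_trans ler01 N1) //=.
by rewrite invf_le1 ?exprn_gt0 ?(lt_le_trans ltr01 N1) // exprn_ege1.
Qed.

Let coord_le1 x i : normsq (rsubmx x) <= 1 -> i != ord0 -> `|x 0 i| <= 1.
Proof.
have E1 : rshift 1 (0 : 'I_2) = crd1 by exact/val_inj.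
have E2 : rshift 1 (1 : 'I_2) = crd2 by exact/val_inj.
rewrite normsqE !mxE E1 E2.
move=> h; have s1 := sqr_ge0 (x 0 crd1); have s2 := sqr_ge0 (x 0 crd2).
have K (y : R) : y ^+ 2 <= 1 -> `|y| <= 1.
  by rewrite -[y ^+ 2]ger0_norm ?sqr_ge0 // normrX expr_le1.
elim/ord3P: i => [/negP[]|_|_]; first exact/eqP/val_inj.
  by apply: K; apply: le_trans h; rewrite lerDl.
by apply: K; apply: le_trans h; rewrite lerDr.
Qed.

Lemma conf_bounds x : normsq (rsubmx x) <= 1 ->
  [/\ `|confx x| <= 112, forall i, `|dconf i x| <= 112
    & forall j i, `|ddconf j i x| <= 112].
Proof.
move=> h; have c1 := coord_le1 h.
have nv k : `|N x ^- k| <= 1 by have /andP[v0 v1] := NV x k; rewrite ger0_norm.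
have D1 i : i != ord0 -> `|x 0 i * N x ^- 3| <= 1.
  by move=> i0; rewrite normrM mulr_ile1 ?c1.
have D2 i j : i != ord0 -> j != ord0 -> `|x 0 i * x 0 j * N x ^- 4| <= 1.
  by move=> i0 j0; rewrite !normrM mulr_ile1 ?mulr_ge0 ?mulr_ile1 ?c1.
split=> [|i|j i].
- rewrite confxE -/(N x) normrM (gtr0_norm (_ : 0 < 4 :> R)) //.
  by apply: le_trans (ler_wpM2l _ (nv 2%N)) _; rewrite // mulr1 ler_nat.
- rewrite /dconf; case: ifPn => [_|i0]; first by rewrite normr0.
  rewrite -mulrA normrM normrN (gtr0_norm (_ : 0 < 16 :> R)) //.
  by apply: le_trans (ler_wpM2l _ (D1 i i0)) _; rewrite // mulr1 ler_nat.
rewrite /ddconf; case: ifPn => [_|]; first by rewrite normr0.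
rewrite negb_or => /andP[i0 j0].
rewrite (le_trans (ler_normD _ _)) // (_ : (112 : R) = 16 + 96); last by rewrite -natrD.
apply: lerD.
- rewrite -mulrA normrM normrN (gtr0_norm (_ : 0 < 16 :> R)) // ler_piMr //.
  by rewrite normrM mulr_ile1 //; case: (i == j); rewrite ?normr1 ?normr0.
- by rewrite -!(mulrA 96) normrM (gtr0_norm (_ : 0 < 96 :> R)) // ler_piMr // D2.
Qed.

(** Each radial derivative costs one power of t, and the derivatives of the
    conformal factor in the directions of the sphere are bounded on the disc;
    112 = 16 + 96 bounds all of them up to second order. *)
Lemma separated_bounds (q q1 q2 : R -> R) (C t0 : R) :
  (forall t, 0 < t < t0 -> is_derive t 1 q (q1 t) /\ is_derive t 1 q1 (q2 t)) ->
  (forall t, 0 < t < t0 ->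
    [/\ `|q t| <= C * t ^+ 4, `|q1 t| <= C * t ^+ 3 & `|q2 t| <= C * t ^+ 2]) ->
  forall (l : seq 'I_(1 + 2)) z, (size l <= 2)%N -> slab 0 t0 z ->
    normsq (rsubmx z) <= 1 ->
    `|partials l (fun x => q (x 0 0) * confx x) z|
      <= 112 * C * z 0 0 ^+ (4 - count_mem ord0 l).
Proof.
move=> dq Bq l z l2 zt zn; have oS := @open_slab R 0 t0.
have [k0 k1 k2] := conf_bounds zn; have [b0 b1 b2] := Bq _ zt.
have M (u v c : R) : `|u| <= c -> `|v| <= 112 -> `|u * v| <= 112 * c.
  by move=> hu hv; rewrite normrM mulrC ler_pM.
have dcoord (F F' : R -> R) j (x : 'rV[R]_(1 + 2)) : is_derive (x 0 0) 1 F (F' (x 0 0)) ->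
    is_derive x (delta_mx 0 j) (fun x => F (x 0 0)) ((j == ord0)%:R * F' (x 0 0)).
  move=> dF; eapply is_derive_eq; first exact: der_comp dF (der_coord _ _ _).
  by rewrite mxE mulrC eq_sym.
have dS (F F' : R -> R) K K' j (x : 'rV[R]_(1 + 2)) : is_derive (x 0 0) 1 F (F' (x 0 0)) ->
    is_derive x (delta_mx 0 j) K (K' x) ->
    partial j (fun x => F (x 0 0) * K x) x
      = (j == ord0)%:R * (F' (x 0 0) * K x) + F (x 0 0) * K' x.
  move=> dF dK; apply: der_partial; eapply is_derive_eq.
    exact: derM (dcoord F F' j x dF) dK.
  by rewrite mulrA.
have S1 j x : slab 0 t0 x -> partial j (fun x => q (x 0 0) * confx x) x
    = (if j == ord0 then q1 (x 0 0) * confx x else q (x 0 0) * dconf j x).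
  move=> hx; rewrite (dS q q1 confx (dconf j) j x (dq _ hx).1 (der_confx j x)).
  case: (j =P ord0) => [->|_]; last by rewrite mul0r add0r.
  by rewrite /dconf eqxx mulr0 addr0 mul1r.
case: l l2 => [|j [|i [|//]]] _; rewrite [count_mem _ _]/=.
- by rewrite -mulrA; exact: M.
- rewrite /partials /= S1 //; case: (j == ord0) => /=; rewrite -mulrA; exact: M.
have -> : partials [:: j; i] (fun x => q (x 0 0) * confx x) z
    = partial j (fun x => if i == ord0 then q1 (x 0 0) * confx x else q (x 0 0) * dconf i x) z.
  by apply: near_eq_derive; apply: (near_open oS zt) => y hy; rewrite S1.
case: (i =P ord0) => [i0|/eqP i0].
  rewrite (dS q1 q2 confx (dconf j) j z (dq _ zt).2 (der_confx j z)).
  case: (j =P ord0) => [j0|_] /=; rewrite -mulrA.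
    by rewrite /dconf j0 eqxx mulr0 addr0 mul1r; exact: M.
  by rewrite mul0r add0r; exact: M.
rewrite (dS q q1 (dconf i) (ddconf j i) j z (dq _ zt).1 (der_dconf j i z)).
case: (j =P ord0) => [j0|_] /=; rewrite -mulrA.
  by rewrite /ddconf j0 eqxx orbT mulr0 addr0 mul1r; exact: M.
by rewrite mul0r add0r; exact: M.
Qed.

End StereographicBounds.

Section RadialCollar.
Context {R : realType}.

Lemma pullback_stereo b (T : 'rV[R]_3 -> 'M[R]_3) u (c : R) :
  T (stereo b u) = c%:M -> pullback (stereo b) T u = (c * conf u)%:M.
Proof.
move=> E; rewrite /pullback E mul_mx_scalar -scalemxAl stereo_conformal.
by rewrite scale_scalar_mx.
Qed.

Definition radial_metric (A B : R -> R) (q : 'rV[R]_(1 + 3)) : 'M[R]_(1 + 3) :=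
  block_mx (A (q 0 0))%:M 0 0 (B (q 0 0))%:M.

Lemma pullback_radial b (g : 'rV[R]_(1 + 3) -> 'M[R]_(1 + 3)) (x : 'rV[R]_(1 + 2)) (al be : R) :
  g (cyl b x) = block_mx al%:M 0 0 be%:M ->
  pullback (cyl b) g x = diag_mx (row_mx (const_mx al) (const_mx (be * confx x))).
Proof.
move=> E; rewrite (pullback_cyl E) -diag_block !diag_const_mx.
by [].
Qed.

Lemma rsub_cyl b (x : 'rV[R]_(1 + 2)) : rsubmx (@cyl R 1 b x) = stereo b (rsubmx x).
Proof. by rewrite /cyl row_mxKr. Qed.

Lemma pullback_proj b (T : 'rV[R]_3 -> 'M[R]_3) (x : 'rV[R]_(1 + 2)) (c : R) :
  (forall p, T p = c%:M) ->
  pullback ((fun q : 'rV[R]_(1 + 3) => rsubmx q) \o cyl b) T x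
    = diag_mx (row_mx (const_mx 0) (const_mx (c * confx x))).
Proof.
move=> E; have -> : (fun q : 'rV[R]_(1 + 3) => rsubmx q) \o cyl b
    = fun x : 'rV[R]_(1 + 2) => stereo b (rsubmx x).
  by apply/funext => y; rewrite /= rsub_cyl.
have J : jac (fun x : 'rV[R]_(1 + 2) => stereo b (rsubmx x)) x
    = col_mx 0 (jac (stereo b) (rsubmx x)).
  apply/matrixP => i a; rewrite [LHS]mxE.
  case: (split_ordP i) => i' ->; rewrite ?col_mxEu ?col_mxEd !mxE.
    by rewrite (partial_rsubmx_l (fun u => stereo b u 0 a)).
  by rewrite (partial_rsubmx_r (fun u => stereo b u 0 a)).
rewrite /pullback E J tr_col_mx trmx0 mul_mx_scalar -scalemxAl mul_col_row.
rewrite !mul0mx mulmx0 stereo_conformal scale_block_mx !scaler0 scale_scalar_mx.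
by rewrite -diag_block !diag_const_mx raddf0.
Qed.

Lemma Ck_diag (U : set 'rV[R]_(1 + 2)) k (al be : 'rV[R]_(1 + 2) -> R) i j :
  open U -> Ck k U al -> Ck k U be ->
  Ck k U (fun x => diag_mx (row_mx (const_mx (al x)) (const_mx (be x)) : 'rV_(1 + 2)) i j).
Proof.
move=> oU Ca Cb.
have [<-|ij] := eqVneq i j; last first.
  apply: (@Ck_eq _ _ _ _ (fun=> 0)) (CkC _ _ oU) => // x _.
  by rewrite mxE (negbTE ij) mulr0n.
case: (split_ordP i) => i' ->.
  apply: Ck_eq Ca => // x _.
  by rewrite mxE eqxx mulr1n row_mxEl mxE.
apply: Ck_eq Cb => // x _.
by rewrite mxE eqxx mulr1n row_mxEr mxE.
Qed.

Lemma Ck_stereo k (U : set 'rV[R]_(1 + 2)) b a : open U ->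
  Ck k U (fun x => stereo b (rsubmx x) 0 a).
Proof.
move=> oU.
have n0 (x : 'rV[R]_(1 + 2)) : 1 + (x 0 (rshift 1 0) ^+ 2 + x 0 (rshift 1 1) ^+ 2) != 0.
  by rewrite gt_eqF // ltr_pwDl // addr_ge0 ?sqr_ge0.
case: (split_ordP a) => a' ->.
  apply: (@Ck_eq _ _ _ _ (fun x : 'rV[R]_(1 + 2) =>
    2 * (1 + (x 0 (rshift 1 0) ^+ 2 + x 0 (rshift 1 1) ^+ 2))^-1 * x 0 (rshift 1 a'))) => //.
    by move=> x _; rewrite /stereo row_mxEl !mxE normsqE !mxE.
  by ck.
apply: (@Ck_eq _ _ _ _ (fun x : 'rV[R]_(1 + 2) =>
  (-1) ^+ b * (x 0 (rshift 1 0) ^+ 2 + x 0 (rshift 1 1) ^+ 2 - 1)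
   * (1 + (x 0 (rshift 1 0) ^+ 2 + x 0 (rshift 1 1) ^+ 2))^-1)) => //.
  by move=> x _; rewrite /stereo row_mxEr !mxE !ord1 eqxx mulr1n normsqE !mxE.
by ck.
Qed.

Variables (a b e : R) (D : R -> R).
Hypothesis e0 : 0 < e.
Hypothesis e1 : e <= 1.
Hypothesis prof1 : forall s, - e < s < e -> 1 <= prof a b s.
Hypothesis D0 : D 0 = 0.
Hypothesis dD : forall s, - e < s < e -> is_derive s 1 D (s ^+ 2 * kern a b s).
Hypothesis D2 : forall s, - e < s < e -> expR (D s) < 2.

Variable g : 'rV[R]_(1 + 3) -> 'M[R]_(1 + 3).
Hypothesis gE : forall q : 'rV[R]_(1 + 3), 0 < q 0 0 < e ->
  g q = block_mx ((q 0 0 ^+ 2 * prof a b (q 0 0))^-1)%:M 0 0 (q 0 0 ^- 2)%:M.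

Let tauq (q : 'rV[R]_(1 + 3)) : R := tau D (q 0 0).
Let oU : open (slab (- e) e : set 'rV[R]_(1 + 2)). Proof. exact: open_slab. Qed.
Let ne : - e < 0. Proof. by rewrite oppr_lt0. Qed.
Let in_e s : 0 <= s < e -> - e < s < e.
Proof. by case/andP=> s0 ->; rewrite (lt_le_trans ne). Qed.
Let in_e' s : 0 < s < e -> - e < s < e.
Proof. by case/andP=> s0 ->; rewrite (lt_trans ne). Qed.

Let tauE bb : tauq \o cyl bb = fun x : 'rV[R]_(1 + 2) => tau D (x 0 0).
Proof. by apply/funext => x; rewrite /tauq /= cyl00. Qed.

Let differential_tau bb (x : 'rV[R]_(1 + 2)) : - e < x 0 0 < e ->
  differential (tauq \o cyl bb) x
    = row_mx (Yfun D (x 0 0) / rprof a b (x 0 0))%:M 0.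
Proof.
move=> hx; rewrite tauE; apply/rowP => i; rewrite mxE.
have P : partial i (fun x : 'rV[R]_(1 + 2) => tau D (x 0 0)) x
    = Yfun D (x 0 0) / rprof a b (x 0 0) * (delta_mx 0 i : 'rV[R]_(1 + 2)) 0 0.
  by apply: der_partial; exact: der_comp (der_tau e1 prof1 dD D2 hx) (der_coord _ _ _).
rewrite P mxE eqxx /=; case: (split_ordP i) => j ->; rewrite ?row_mxEl ?row_mxEr mxE.
  by rewrite !ord1 (_ : ((0 : 'I_(1 + 2)) == lshift 2 0) = true) // eqxx mulr1n mulr1.
by rewrite (_ : ((0 : 'I_(1 + 2)) == rshift 1 j) = false) ?mulr0.
Qed.

(** tau / s, continued through s = 0. *)
Let Bq s : R := wfun D s * artanh_quot (Tfun D s).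

Let Bq_neq0 s : 0 <= s < e -> Bq s != 0.
Proof.
move=> hs; have [s0|s0] := eqVneq s 0.
  by rewrite s0 /Bq /Tfun mul0r artanh_quot0 mulf_neq0 // gt_eqF // wfun_gt0.
have sp : 0 < s by rewrite lt_neqAle eq_sym s0; case/andP: hs.
have : tau D s != 0.
  rewrite gt_eqF // -(tau0 D); apply: (tau_lt e1 prof1 dD D2) => //.
  by case/andP: hs.
by rewrite tau_quot mulf_eq0 negb_or => /andP[].
Qed.

Let prof_gt0 s : - e < s < e -> 0 < prof a b s.
Proof. by move=> /prof1; exact: lt_le_trans. Qed.

Let gbar : 'rV[R]_(1 + 3) -> 'M[R]_(1 + 3) :=
  radial_metric (fun s => Bq s ^+ 2 / prof a b s) (fun s => Bq s ^+ 2).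

Let gbarE bb (x : 'rV[R]_(1 + 2)) : pullback (cyl bb) gbar x = diag_mx (row_mx
  (const_mx (Bq (x 0 0) ^+ 2 / prof a b (x 0 0))) (const_mx (Bq (x 0 0) ^+ 2 * confx x))).
Proof. by apply: pullback_radial; rewrite /gbar /radial_metric cyl00. Qed.

Let gE' bb (x : 'rV[R]_(1 + 2)) : 0 < x 0 0 < e -> pullback (cyl bb) g x = diag_mx (row_mx
  (const_mx (x 0 0 ^+ 2 * prof a b (x 0 0))^-1) (const_mx (x 0 0 ^- 2 * confx x))).
Proof. by move=> hx; apply: pullback_radial; rewrite gE cyl00. Qed.

(** tau^2 g is (tau / s)^2 (ds^2/P + sigma), which is defined for s <= 0 as well. *)
Lemma conformally_compact_radial : conformally_compact g tauq e.
Proof.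
have CB := Ck_tau_quot e1 prof1 dD D2.
exists gbar => bb; split.
- rewrite tauE => k; exact: (Ck_tau e1 prof1 dD D2 k).
- move=> i j.
  have -> : (fun x => pullback (cyl bb) gbar x i j) = (fun x : 'rV[R]_(1 + 2) => diag_mx (row_mx
     (const_mx (Bq (x 0 0) ^+ 2 / prof a b (x 0 0))) (const_mx (Bq (x 0 0) ^+ 2 * confx x))) i j).
    by apply/funext => x; rewrite gbarE.
  have Cc := Ck_confx 3 oU; have Cp := Ck_prof a b e 3.
  have CB' : Ck 3 (slab (- e) e) (fun x : 'rV[R]_(1 + 2) => Bq (x 0 0)) := CB.
  apply: (Ck_diag i j oU); ck => x /prof_gt0 hx; by rewrite gt_eqF.
- move=> x hx; rewrite gbarE; apply: posdef_diag => i.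
  have B0 : 0 < Bq (x 0 0) ^+ 2 by rewrite exprn_even_gt0 // Bq_neq0.
  case: (split_ordP i) => j ->; rewrite ?row_mxEl ?row_mxEr mxE.
    by rewrite divr_gt0 // prof_gt0 // in_e.
  by rewrite mulr_gt0 // conf_gt0.
- move=> x hx; have /andP[s0 s1] := hx; split.
    rewrite /tauq cyl00 -(tau0 D); apply: (tau_lt e1 prof1 dD D2) => //.
  have P0 := prof_gt0 (in_e' hx).
  have Pz : prof a b (x 0 0) != 0 by rewrite gt_eqF.
  have sz : x 0 0 != 0 by rewrite gt_eqF.
  rewrite gbarE gE' // /tauq cyl00 tau_quot -/(Bq _) -!diag_block !diag_const_mx.
  rewrite scale_block_mx !scaler0 !scale_scalar_mx.
  by congr (block_mx _%:M 0 0 _%:M); field; rewrite ?sz ?Pz.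
move=> x x0; split; first by rewrite /tauq cyl00 x0 tau0.
have hz : - e < x 0 0 < e by rewrite x0 ne e0.
have hz' : 0 <= x 0 0 < e by rewrite x0 lexx e0.
have B0 : 0 < Bq (x 0 0) ^+ 2 by rewrite exprn_even_gt0 // Bq_neq0.
have gp i : 0 < (row_mx (const_mx (Bq (x 0 0) ^+ 2 / prof a b (x 0 0)))
    (const_mx (Bq (x 0 0) ^+ 2 * confx x)) : 'rV[R]_(1 + 2)) 0 i.
  case: (split_ordP i) => j ->; rewrite ?row_mxEl ?row_mxEr mxE.
    by rewrite divr_gt0 // prof_gt0.
  by rewrite mulr_gt0 // conf_gt0.
move=> dtau; rewrite sqrtr_gt0 gbarE invmx_diag => [|i]; last by rewrite gt_eqF.
have [_ pd] := @posdef_diag R _ (map_mx GRing.inv (row_mx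
    (const_mx (Bq (x 0 0) ^+ 2 / prof a b (x 0 0)))
    (const_mx (Bq (x 0 0) ^+ 2 * confx x)) : 'rV[R]_(1 + 2)))
    (fun i => ltac:(by rewrite mxE invr_gt0)).
apply: pd; rewrite /dtau differential_tau //; apply/eqP => /rowP /(_ (lshift 2 0)).
rewrite row_mxEl !mxE eqxx mulr1n => /eqP; rewrite mulf_eq0 invr_eq0.
by rewrite !gt_eqF ?(Yfun_gt0 e1 D2) ?(rprof_gt0 prof1).
Qed.

(** The equation of tau makes the radial part of sinh(tau)^2 g equal to dtau^2,
    and the rest is (sinh tau / s)^2 sigma: the expansion of this factor gives
    zeta = - a sigma. *)
Lemma strongly_AH_radial : strongly_AH g.
Proof.
have [t0 [sig [C [q1 [q2 [/andP[t00 t01] sigP sigK Sg [Sq dq Bq']]]]]]] :=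
  expansion_in_tau e0 e1 prof1 D0 dD D2.
exists tauq, e; split=> //; first exact: conformally_compact_radial.
pose gt (t : R) (p : 'rV[R]_3) : 'M[R]_3 := ((Defs.sinh t / sig t) ^+ 2)%:M.
exists t0, (fun q : 'rV[R]_(1 + 3) => rsubmx q), gt, (fun=> (- a)%:M).
have oT : open (slab 0 t0 : set 'rV[R]_(1 + 2)) by exact: open_slab.
have oE : open (slab 0 e : set 'rV[R]_(1 + 2)) by exact: open_slab.
pose q t := (Defs.sinh t / sig t) ^+ 2 - 1 + a / 3 * t ^+ 3.
split=> //.
- split.
  + by move=> p [].
  + move=> bb i k; under eq_fun do rewrite rsub_cyl.
    exact: Ck_stereo.
  + move=> t p ht sp; have [s01 tE] := sigP t ht.
    have row0 : (row_mx (sig t)%:M p : 'rV[R]_(1 + 3)) 0 0 = sig t.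
      rewrite (_ : (0 : 'I_(1 + 3)) = lshift 3 0); last exact/val_inj.
      by rewrite row_mxEl mxE mulr1n.
    exists (row_mx (sig t)%:M p); split.
      by split; rewrite /collar /tauq /= ?row_mxKr ?row0.
    move=> r [[r0 rs] rt rp]; rewrite -[RHS]hsubmxK rp; congr row_mx.
    apply/rowP => i; rewrite !ord1 !mxE eqxx mulr1n.
    rewrite (_ : lshift 3 0 = 0); last exact/val_inj.
    by rewrite -rt /tauq sigK.
  move=> bb x hx dtau; have hx' := in_e' hx.
  have /andP[s0 s1] := hx; have sz : x 0 0 != 0 by rewrite gt_eqF.
  have Y0 := Yfun_gt0 e1 D2 hx'; have Yz : Yfun D (x 0 0) != 0 by rewrite gt_eqF.
  have p0 := rprof_gt0 prof1 hx'; have pz : rprof a b (x 0 0) != 0 by rewrite gt_eqF.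
  have tE : tauq (cyl bb x) = tau D (x 0 0) by rewrite /tauq cyl00.
  rewrite (@pullback_proj bb _ x (Yfun D (x 0 0) ^+ 2)); last first.
    move=> p; rewrite /gt tE sigK // (sinh_tau e1 D2) //.
    by rewrite mulrC mulKf.
  rewrite gE' // /dtau differential_tau // tE (sinh_tau e1 D2) //.
  rewrite tr_row_mx trmx0 tr_scalar_mx mul_col_row mul0mx !mulmx0 -!diag_block !diag_const_mx.
  rewrite add_block_mx !addr0 add0r raddf0 addr0 scale_block_mx !scaler0.
  rewrite -scalar_mxM !scale_scalar_mx -(rprof_sqr prof1 hx').
  by congr (block_mx _%:M 0 0 _%:M); field; rewrite ?sz ?Yz ?pz.
- by move=> bb u; rewrite (@pullback_stereo _ _ _ (- a)) // tr_scalar_mx.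
- move=> bb i j k.
  have oTT : open (setT : set 'rV[R]_2) by exact: openT.
  apply: (@Ck_eq _ _ _ _ (fun u => - a * (i == j)%:R * (4 * (1 + (u 0 0 ^+ 2 + u 0 1 ^+ 2)) ^- 2))) => //.
    move=> u _; rewrite (@pullback_stereo _ _ _ (- a)) // mxE /conf normsqE.
    by rewrite -mulr_natr; ring.
  by ck => u _; rewrite expf_neq0 // gt_eqF // ltr_pwDl // addr_ge0 ?sqr_ge0.
pose err (bb : bool) (i j : 'I_2) (z : 'rV[R]_(1 + 2)) : R := pullback (stereo bb)
  (fun p => gt (z 0 0) p - 1%:M - (z 0 0 ^+ 3 / 3) *: (- a)%:M) (rsubmx z) i j.
suff: (forall bb i j, Ck 2 (slab 0 t0) (err bb i j)) /\
    exists C : R, forall bb i j (l : seq 'I_(1 + 2)) z,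
      (size l <= 2)%N -> slab 0 t0 z -> normsq (rsubmx z) <= 1 ->
      `|partials l (err bb i j) z| <= C * z 0 0 ^+ (4 - count_mem ord0 l) by [].
have errE bb i j : err bb i j = fun z => (i == j)%:R * (q (z 0 0) * confx z).
  apply/funext => z; rewrite /err.
  rewrite (@pullback_stereo _ _ _ (q (z 0 0))).
    by rewrite mxE [RHS]mulr_natl.
  apply/matrixP => i' j'; rewrite /gt !mxE /q.
  case: (i' == j'); rewrite ?mulr1n ?mulr0n.
    by move: (Defs.sinh _ / _) => y; field.
  by rewrite mulr0 !subr0.
have Cc k := Ck_confx k oT.
split.
  by move=> bb i j; rewrite errE; have Cq := Sq 2%N; have C2 := Cc 2%N; ck.
exists (112 * C) => bb i j l z l2 zt zn; rewrite errE.
have [_|_] := eqVneq i j.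
  under eq_fun do rewrite mul1r.
  exact: (separated_bounds dq Bq').
under eq_fun do rewrite mul0r.
have Z : partials l (fun=> 0 : R) = fun=> 0.
  elim: l {l2} => [//|k l IH] /=; rewrite IH.
  by apply/funext => y; apply: der_partial; exact: derC.
rewrite Z normr0 mulr_ge0 ?exprn_ge0 //; last by case/andP: zt => /ltW.
have [h _ _] := Bq' _ zt; rewrite mulr_ge0 //.
have := le_trans (normr_ge0 _) h; rewrite pmulr_lge0 // exprn_gt0 //.
by case/andP: zt.
Qed.

End RadialCollar.

Theorem proposition3p2 (R : realType) (m : R) (hm : 0 <= m) (f : R -> R)
    (hf : SSCMC m 1 f) :
  let scal (b : bool) (x : 'rV[R]_(1 + 2)) : R :=
    scalar_curvature (pullback (cyl b) (induced_metric m f)) x in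
  [/\ strongly_AH (pullback of_s (induced_metric m f)),
      exists C r0 : R, forall (b : bool) (x : 'rV[R]_(1 + 2)),
        2 * m < x 0 0 -> r0 < x 0 0 ->
        `|scal b x + 6| <= C * (x 0 0)^-1 ^+ 6 &
      forall (b : bool) (x : 'rV[R]_(1 + 2)),
        2 * m < x 0 0 -> 0 <= scal b x + 6].
Proof.
move=> scal; have [c fc] := SSCMC_first_integral hm hf.
have scalE b (x : 'rV[R]_(1 + 2)) : 2 * m < x 0 0 -> scal b x + 6 = 6 * c ^+ 2 * (x 0 0)^-1 ^+ 6.
  exact: scalar_curvature_SSCMC.
have x6 (y : R) : 0 <= y ^+ 6 by rewrite exprn_even_ge0.
have s0 (y : R) : 0 <= 6 * c ^+ 2 * y ^+ 6.
  by apply: mulr_ge0 => //; apply: mulr_ge0 => //; exact: sqr_ge0.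
split; last by move=> b x /scalE ->.
  have m2 : 0 < 2 * m + 1 by rewrite ltr_wpDl // mulr_ge0.
  have c20 : 0 <= c ^+ 2 by rewrite sqr_ge0.
  have em0 : 0 < (2 * m + 1)^-1 by rewrite invr_gt0.
  have [e [D [[e0 em e1] [prof1 D0 dD D2]]]] := exponent_exists (2 * c - 2 * m) c20 em0.
  apply: (strongly_AH_radial e0 e1 prof1 D0 dD D2) => q hq.
  have /andP[q0 qe] := hq; have qz : q 0 0 != 0 by rewrite gt_eqF.
  have q00 : of_s q 0 0 = (q 0 0)^-1.
    rewrite /of_s (_ : (0 : 'I_(1 + 3)) = lshift 3 0); last exact/val_inj.
    rewrite row_mxEl mxE mulr1n; congr (q 0 _)^-1; exact/val_inj.
  have mr : 2 * m < of_s q 0 0.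
    rewrite q00; apply: (@lt_trans _ _ (2 * m + 1)); first by rewrite ltrDl.
    by rewrite -[ltLHS]invrK ltf_pV2 ?posrE // (lt_le_trans qe).
  have E := induced_metricE fc mr; rewrite (pullback_of_s qz E) q00.
  have P0 : prof (2 * c - 2 * m) (c ^+ 2) (q 0 0) != 0.
    rewrite gt_eqF // (lt_le_trans ltr01) // prof1 // qe andbT.
    by rewrite (lt_trans _ q0) // oppr_lt0.
  congr (block_mx _%:M 0 0 _%:M); last by rewrite exprVn.
  rewrite -invfM; congr (_^-1); rewrite /prof /h; by field.
exists (6 * c ^+ 2), 0 => b x mr _.
by rewrite scalE // ger0_norm.
Qed.
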